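(* Let $\Gamma$ be a non-Abelian, torsion-free hyperbolic group, let $G$ be an iterated extension of centralizers over $\Gamma$, and let $G'$ be a rank $n$ extension of a cyclic centralizer of $G$. Then the $G$-discriminating complexity of $G'$ is asymptotically dominated by a polynomial of degree $n$, i.e. $C_{G'}^{G} \preceq (R\mapsto R^n)$.
   Context: For $u \in G$ with $C = C_G(u)$ Abelian, the (free, rank $n$) extension of the centralizer $C$ is $G(u,A) := G *_{C} A$ where $A = C \times \mathbb{Z}^n$ and $C$ is amalgamated with the factor $C$ of $A$. An iterated extension of centralizers over $\Gamma$ is a group $H$ with a finite chain $\Gamma = G_0 \le G_1 \le \dots \le G_k = H$ where each $G_{i+1}$ is a free finite-rank extension of a centralizer of $G_i$. A group $G'$ is fully residually $G$ if for every finite set $S \subseteq G'-\{1\}$ there is a homomorphism $\phi: G' \to G$ with $1 \notin \phi(S)$. For finite generating sets $X$ of $G'$ and $Y$ of $G$, $|\phi|_X^Y := \max_{x\in X}|\phi(x)|_Y$, and the $G$-discriminating complexity of $G'$ is $C(R) := \min\{|\phi|_X^Y : \phi: G'\to G,\ 1 \notin \phi(B_R(G',X)-\{1\})\}$, with $B_R$ the closed word-metric ball of radius $R$. For $f,g:\mathbb{N}\to\mathbb{N}$, $f \preceq g$ means there is $K$ with $f(R) \le K g(KR)+K$ for all $R$; this class of $C$ is independent of the generating sets. *)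

(* Defs.v *)
From Stdlib Require Import ZArith List Lia Fin FunctionalExtensionality ProofIrrelevance.
Import ListNotations.
Set Implicit Arguments.
Unset Strict Implicit.

Record Group : Type := {
  carrier :> Type;
  gmul : carrier -> carrier -> carrier;
  ginv : carrier -> carrier;
  gone : carrier;
  gmulA : forall x y z, gmul x (gmul y z) = gmul (gmul x y) z;
  gmul1l : forall x, gmul gone x = x;
  gmul1r : forall x, gmul x gone = x;
  gmulVl : forall x, gmul (ginv x) x = gone;
  gmulVr : forall x, gmul x (ginv x) = gone }.

Arguments gmul {_} _ _.
Arguments ginv {_} _.
Arguments gone {_}.

Record hom (G H : Group) := {
  hmap :> G -> H;
  hmorph : forall x y : G, hmap (gmul x y) = gmul (hmap x) (hmap y) }.

Fixpoint gpow (G : Group) (g : G) (k : nat) : G :=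
  match k with O => gone | S k => gmul g (gpow g k) end.

Arguments gpow {G} g k.

Definition gpowZ (G : Group) (g : G) (k : Z) : G :=
  match k with
  | Z0 => gone
  | Zpos p => gpow g (Pos.to_nat p)
  | Zneg p => ginv (gpow g (Pos.to_nat p))
  end.

Definition nonabelian (G : Group) : Prop := exists g h : G, gmul g h <> gmul h g.

Definition torsion_free (G : Group) : Prop :=
  forall (g : G) (k : nat), gpow g (S k) = gone -> g = gone.

Definition letter_val (G : Group) (p : G * bool) : G :=
  if snd p then ginv (fst p) else fst p.

Definition word_val (G : Group) (w : list (G * bool)) : G :=
  fold_right (fun p acc => gmul (letter_val p) acc) gone w.

Definition wlen_le (G : Group) (X : list G) (g : G) (n : nat) : Prop :=
  exists w : list (G * bool),
    (forall p, In p w -> In (fst p) X) /\ length w <= n /\ word_val w = g.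

Definition generates (G : Group) (X : list G) : Prop :=
  forall g : G, exists n, wlen_le X g n.

Definition wdist (G : Group) (X : list G) (g h : G) (d : nat) : Prop :=
  wlen_le X (gmul (ginv g) h) d /\
  forall m, wlen_le X (gmul (ginv g) h) m -> d <= m.

(** Gromov hyperbolic group: the word metric w.r.t. some finite generating set
    satisfies the four-point condition
    (x|y)_w >= min((x|z)_w,(y|z)_w) - delta  (here multiplied by 2). *)
Definition hyperbolic (G : Group) : Prop :=
  exists X : list G, generates X /\
  exists delta : nat,
    forall (x y z w : G) (dxy dxz dyz dxw dyw dzw : nat),
      wdist X x y dxy -> wdist X x z dxz -> wdist X y z dyz ->
      wdist X x w dxw -> wdist X y w dyw -> wdist X z w dzw ->
      (Z.of_nat dxw + Z.of_nat dyw - Z.of_nat dxy >=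
       Z.min (Z.of_nat dxw + Z.of_nat dzw - Z.of_nat dxz)
             (Z.of_nat dyw + Z.of_nat dzw - Z.of_nat dyz) - 2 * Z.of_nat delta)%Z.

Definition commutes (G : Group) (u g : G) : Prop := gmul g u = gmul u g.

Lemma cent_one (G : Group) (u : G) : commutes u gone.
Proof. unfold commutes; now rewrite gmul1l, gmul1r. Qed.

Lemma cent_mul (G : Group) (u x y : G) :
  commutes u x -> commutes u y -> commutes u (gmul x y).
Proof.
  unfold commutes; intros Hx Hy.
  rewrite <- gmulA, Hy, gmulA, Hx, <- gmulA. reflexivity.
Qed.

Lemma cent_inv (G : Group) (u x : G) : commutes u x -> commutes u (ginv x).
Proof.
  unfold commutes; intros Hx.
  assert (E : gmul (ginv x) (gmul (gmul x u) (ginv x)) =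
              gmul (ginv x) (gmul (gmul u x) (ginv x))) by now rewrite Hx.
  rewrite (gmulA (ginv x) (gmul x u)), (gmulA (ginv x) x), gmulVl, gmul1l in E.
  rewrite <- (gmulA u x), gmulVr, gmul1r in E.
  exact (eq_sym E).
Qed.

Definition CentGroup (G : Group) (u : G) : Group.
Proof.
  refine (@Build_Group {g : G | commutes u g}
    (fun a b => exist _ (gmul (proj1_sig a) (proj1_sig b))
                        (cent_mul (proj2_sig a) (proj2_sig b)))
    (fun a => exist _ (ginv (proj1_sig a)) (cent_inv (proj2_sig a)))
    (exist _ gone (cent_one u)) _ _ _ _ _);
  intros; apply eq_sig_hprop; try (intros; apply proof_irrelevance); simpl;
  auto using gmulA, gmul1l, gmul1r, gmulVl, gmulVr.
Defined.

Arguments CentGroup : clear implicits.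

Definition cent_incl (G : Group) (u : G) : hom (CentGroup G u) G.
Proof. refine (@Build_hom (CentGroup G u) G (fun c => proj1_sig c) _). reflexivity. Defined.

Definition ZnGroup (n : nat) : Group.
Proof.
  refine (@Build_Group (Fin.t n -> Z) (fun a b i => (a i + b i)%Z)
            (fun a i => (- a i)%Z) (fun _ => 0%Z) _ _ _ _ _);
  intros; apply functional_extensionality; intros; lia.
Defined.

Definition ProdGroup (G H : Group) : Group.
Proof.
  refine (@Build_Group (G * H)
    (fun a b => (gmul (fst a) (fst b), gmul (snd a) (snd b)))
    (fun a => (ginv (fst a), ginv (snd a))) (gone, gone) _ _ _ _ _);
    intros; repeat match goal with p : _ * _ |- _ => destruct p end; simpl;
  f_equal; auto using gmulA, gmul1l, gmul1r, gmulVl, gmulVr.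
Defined.

Definition ExtA (G : Group) (u : G) (n : nat) : Group :=
  ProdGroup (CentGroup G u) (ZnGroup n).

Arguments ExtA : clear implicits.

Definition extA_incl (G : Group) (u : G) (n : nat) : hom (CentGroup G u) (ExtA G u n).
Proof.
  refine (@Build_hom (CentGroup G u) (ExtA G u n) (fun c => (c, @gone (ZnGroup n))) _).
  intros x y; simpl; f_equal; try (symmetry; apply (gmul1l (ZnGroup n))); reflexivity.
Defined.

Arguments cent_incl : clear implicits.
Arguments extA_incl : clear implicits.

(** * Amalgamated free product = pushout in the category of groups *)
Definition is_pushout (C G A H : Group) (a : hom C G) (b : hom C A)
    (i : hom G H) (j : hom A H) : Prop :=
  (forall c, i (a c) = j (b c)) /\
  forall (K : Group) (f : hom G K) (g : hom A K),
    (forall c, f (a c) = g (b c)) ->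
    exists h : hom H K,
      (forall x, h (i x) = f x) /\ (forall y, h (j y) = g y) /\
      forall h' : hom H K, (forall x, h' (i x) = f x) -> (forall y, h' (j y) = g y) ->
        forall z, h' z = h z.

(** H is (isomorphic to) the rank-n extension G(u,A) = G *_C A of the
    centralizer C = C_G(u), which must be Abelian. *)
Definition ExtCentralizer (G H : Group) (u : G) (n : nat) : Prop :=
  (forall x y : G, commutes u x -> commutes u y -> gmul x y = gmul y x) /\
  exists (i : hom G H) (j : hom (ExtA G u n) H),
    is_pushout (cent_incl G u) (extA_incl G u n) i j.

Arguments ExtCentralizer : clear implicits.

Definition cyclic_centralizer (G : Group) (u : G) : Prop :=
  exists c : G, commutes u c /\ forall g, commutes u g -> exists k : Z, g = gpowZ c k.

Definition CyclicCentExt (G H : Group) (n : nat) : Prop :=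
  exists u : G, cyclic_centralizer u /\ ExtCentralizer G H u n.

Arguments CyclicCentExt : clear implicits.

Inductive IterExt (Gamma : Group) : Group -> Prop :=
| ie_base : IterExt Gamma Gamma
| ie_step : forall (G H : Group) (u : G) (n : nat),
    IterExt Gamma G -> ExtCentralizer G H u n -> IterExt Gamma H.

Definition discriminates_ball (G' G : Group) (X : list G') (R : nat) (phi : hom G' G) : Prop :=
  forall g : G', wlen_le X g R -> g <> gone -> phi g <> gone.

Definition hom_norm_le (G' G : Group) (X : list G') (Y : list G) (phi : hom G' G) (M : nat) : Prop :=
  forall x, In x X -> wlen_le Y (phi x) M.

(** C(R) <= M, where C(R) = min { |phi|_X^Y : phi discriminates B_R(G',X) } *)
Definition complexity_le (G' G : Group) (X : list G') (Y : list G) (R M : nat) : Prop :=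
  exists phi : hom G' G, discriminates_ball X R phi /\ hom_norm_le X Y phi M.

(** C <= (R |-> R^n) in the sense of the preorder: exists K, C(R) <= K (K R)^n + K *)
Definition complexity_dominated_by_pow (G' G : Group) (X : list G') (Y : list G) (n : nat) : Prop :=
  exists K : nat, forall R : nat, complexity_le X Y R (K * (K * R) ^ n + K).

(* Main.v *)
Require Import Defs.
From Stdlib Require Import ZArith List Lia Classical ClassicalEpsilon.
From Stdlib Require Import FunctionalExtensionality PropExtensionality ProofIrrelevance.
From Stdlib Require Import Permutation Fin.
Import ListNotations.

(** The discriminating homomorphisms are the retractions G' -> G fixing G and sending the
    k-th stable letter to u^(B^k), where C(u) is the centralizer being extended and B is a
    large multiple of R.  A nontrivial element of the ball of radius R then maps to a product
    g0 u^m1 g1 ... u^mr gr with |gi| <= O(R), |mi| >= B and, for 0 < i < r, gi not in C(u), so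
    everything rests on a linear big powers property of G: such a product is nontrivial as
    soon as the exponents exceed a fixed multiple of R.

    In a group with a four-point hyperbolic length, the big powers property holds for a
    loxodromic weakly properly discontinuous u: if the Gromov product of u^p and g u^q were
    large compared with |g|, the axes of u and of its conjugate by g would fellow-travel long
    enough for a pigeonhole argument to give g u^b g^-1 = u^a, which forces g to commute
    with u; bounded Gromov products then make the product a broken geodesic with long pieces.
    This applies to Gamma with a word length.  For an extension G of a centralizer C(v) of H,
    an element whose centralizer has rank one is either conjugate into H, where the blocks
    between two stable letters stay outside C(v) because they do not commute with v, or it is
    hyperbolic on the Bass-Serre tree of the amalgam, whose length function is 0-hyperbolic.
    The normal form theorem, torsion-freeness, commutation of roots and malnormality of
    centralizers are inherited from Gamma because G is fully residually Gamma. *)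

(* The degree [n] comes from writing exponents in base [B]. A nonzero vector whose coordinates are
   smaller than [B] in absolute value is sent to a nonzero multiple of [B], hence to an admissible
   exponent, while the exponent of a single stable letter is at most [B^n]. Since the big powers
   threshold is linear in [R], [B] can be linear in [R] too. The obstacle is that linear big powers
   climb the tower only for elements with rank one centralizer, whereas the [v] extended at some
   stage may have a larger centralizer. Nontriviality of reduced forms is therefore tested in
   [Gamma], where every nontrivial element has big powers: a retraction onto [H] with large [B] is
   followed by a homomorphism to [Gamma] that keeps [v] and finitely many commutators nontrivial.
   This gives normal forms and residuality without control of constants. The linear constants are
   found separately, from the tree for hyperbolic elements and from [H] for elliptic ones. *)
Declare Scope group_scope.
Notation "x ** y" := (gmul x y) (at level 40, left associativity) : group_scope.
Notation "x ^-1" := (ginv x) (at level 3, left associativity, format "x ^-1") : group_scope.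
Notation "x ^^ n" := (gpowZ x n) (at level 30, right associativity) : group_scope.
Open Scope group_scope.
Open Scope Z_scope.

(** * Elementary identities, homomorphisms and integer powers *)

Section GroupBasics.
Context {G : Group}.
Implicit Types x y z : G.

Lemma mulKl x y : x^-1 ** (x ** y) = y.
Proof. now rewrite gmulA, gmulVl, gmul1l. Qed.

Lemma mulKr x y : x ** (x^-1 ** y) = y.
Proof. now rewrite gmulA, gmulVr, gmul1l. Qed.

Lemma mul_cancel_l x y z : x ** y = x ** z -> y = z.
Proof. intros E; now rewrite <- (mulKl x y), E, mulKl. Qed.

Lemma mul_cancel_r x y z : y ** x = z ** x -> y = z.
Proof.
  intros E. rewrite <- (gmul1r y), <- (gmul1r z), <- (gmulVr x), !gmulA. now rewrite E.
Qed.

Lemma inv_unique x y : x ** y = gone -> y = x^-1.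
Proof. intros E. apply mul_cancel_l with x. now rewrite E, gmulVr. Qed.

Lemma inv_one : (gone : G)^-1 = gone.
Proof. symmetry. apply inv_unique. apply gmul1l. Qed.

Lemma inv_inv x : x^-1^-1 = x.
Proof. symmetry. apply inv_unique. apply gmulVl. Qed.

Lemma inv_mul x y : (x ** y)^-1 = y^-1 ** x^-1.
Proof.
  symmetry. apply inv_unique.
  now rewrite <- gmulA, (gmulA y), gmulVr, gmul1l, gmulVr.
Qed.

Lemma mulA' x y z : x ** y ** z = x ** (y ** z).
Proof. symmetry; apply gmulA. Qed.
End GroupBasics.

Create HintDb grp.
#[export] Hint Rewrite @mulA' @mulKl @mulKr @gmul1l @gmul1r @gmulVl @gmulVr
  @inv_one @inv_inv @inv_mul : grp.
Ltac gsimp := autorewrite with grp.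
Ltac gsimp_in H := autorewrite with grp in H.

Lemma inv_eq_one {G : Group} (x : G) : x^-1 = gone -> x = gone.
Proof. intros E. rewrite <- (inv_inv x), E. apply inv_one. Qed.

Lemma mul_inv_one_eq {G : Group} (x y : G) : x^-1 ** y = gone -> x = y.
Proof. intros E. apply mul_cancel_l with (x^-1). now rewrite gmulVl, E. Qed.

Section Homs.
Context {G H : Group} (f : hom G H).

Lemma hom_one : f gone = gone.
Proof.
  apply mul_cancel_l with (f gone). rewrite <- hmorph. now rewrite !gmul1r.
Qed.

Lemma hom_inv x : f (x^-1) = (f x)^-1.
Proof. apply inv_unique. rewrite <- hmorph, gmulVr. apply hom_one. Qed.

Lemma hom_gpow x k : f (gpow x k) = gpow (f x) k.
Proof. induction k; simpl; [apply hom_one | now rewrite hmorph, IHk]. Qed.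

Lemma hom_gpowZ x k : f (x ^^ k) = f x ^^ k.
Proof.
  destruct k; simpl; [apply hom_one | apply hom_gpow | now rewrite hom_inv, hom_gpow].
Qed.
End Homs.

Definition hom_comp {A B C : Group} (g : hom B C) (f : hom A B) : hom A C.
Proof.
  refine (@Build_hom A C (fun x => g (f x)) _). intros; now rewrite !hmorph.
Defined.

Definition hom_id (A : Group) : hom A A.
Proof. refine (@Build_hom A A (fun x => x) _). reflexivity. Defined.

Definition hom_triv (A B : Group) : hom A B.
Proof. refine (@Build_hom A B (fun _ => gone) _). intros; now rewrite gmul1l. Defined.

Section Powers.
Context {G : Group}.
Implicit Types u x y g : G.

Lemma gpow_comm g k : gpow g k ** g = g ** gpow g k.
Proof.
  induction k; simpl; [now rewrite gmul1l, gmul1r|]. now rewrite mulA', IHk.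
Qed.

Lemma gpowZ_succ g k : g ^^ (k + 1) = g ** g ^^ k.
Proof.
  destruct k as [|p|p].
  - simpl. reflexivity.
  - simpl. rewrite Pos2Nat.inj_add. simpl. rewrite Nat.add_comm. reflexivity.
  - destruct (Pos.eq_dec p 1) as [->|Hp].
    + simpl. now rewrite gmul1r, gmulVr.
    + assert (E : Z.neg p + 1 = Z.neg (Pos.pred p)) by lia. rewrite E.
      simpl. assert (E2 : Pos.to_nat p = S (Pos.to_nat (Pos.pred p))) by lia.
      rewrite E2. simpl. rewrite <- gpow_comm. gsimp. reflexivity.
Qed.

Lemma gpowZ_pred g k : g ^^ (k - 1) = g^-1 ** g ^^ k.
Proof.
  apply mul_cancel_l with g. rewrite mulKr, <- gpowZ_succ. f_equal; lia.
Qed.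

Lemma gpowZ_add g a b : g ^^ (a + b) = g ^^ a ** g ^^ b.
Proof.
  revert a. apply Z.peano_ind.
  - simpl. now rewrite gmul1l.
  - intros a IH. replace (Z.succ a + b) with (a + b + 1) by lia.
    unfold Z.succ. rewrite !gpowZ_succ, IH. now rewrite gmulA.
  - intros a IH. replace (Z.pred a + b) with (a + b - 1) by lia.
    replace (Z.pred a) with (a - 1) by lia.
    rewrite !gpowZ_pred, IH. now rewrite gmulA.
Qed.

Lemma gpowZ_opp g a : g ^^ (- a) = (g ^^ a)^-1.
Proof.
  apply inv_unique. rewrite <- gpowZ_add, Z.add_opp_diag_r. reflexivity.
Qed.

Lemma gpowZ_1 g : g ^^ 1 = g.
Proof. simpl. apply gmul1r. Qed.

Lemma gpowZ_mul g a b : g ^^ (a * b) = (g ^^ a) ^^ b.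
Proof.
  revert b. apply Z.peano_ind.
  - now rewrite Z.mul_0_r.
  - intros b IH. unfold Z.succ. rewrite gpowZ_succ, <- IH, <- gpowZ_add. f_equal; lia.
  - intros b IH. replace (Z.pred b) with (b - 1) by lia.
    rewrite gpowZ_pred, <- IH, <- gpowZ_opp, <- gpowZ_add. f_equal; lia.
Qed.

Lemma gpowZ_conj p g a : (p ** g ** p^-1) ^^ a = p ** g ^^ a ** p^-1.
Proof.
  revert a. apply Z.peano_ind.
  - simpl. now gsimp.
  - intros a IH. unfold Z.succ. rewrite !gpowZ_succ, IH. now gsimp.
  - intros a IH. replace (Z.pred a) with (a - 1) by lia.
    rewrite !gpowZ_pred, IH. now gsimp.
Qed.

Lemma gpowZ_of_nat g k : g ^^ (Z.of_nat k) = gpow g k.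
Proof.
  induction k; [reflexivity|]. rewrite Nat2Z.inj_succ. unfold Z.succ.
  rewrite gpowZ_succ, IHk. reflexivity.
Qed.

Lemma gpowZ_comm g a b : g ^^ a ** g ^^ b = g ^^ b ** g ^^ a.
Proof. rewrite <- !gpowZ_add. f_equal; lia. Qed.

Lemma commutes_pow {u g} a : commutes u g -> commutes u (g ^^ a).
Proof.
  intros Hg. revert a. apply Z.peano_ind.
  - apply cent_one.
  - intros a IH. unfold Z.succ. rewrite gpowZ_succ. now apply cent_mul.
  - intros a IH. replace (Z.pred a) with (a - 1) by lia. rewrite gpowZ_pred.
    apply cent_mul; [now apply cent_inv | assumption].
Qed.

Lemma commutes_sym {u g} : commutes u g -> commutes g u.
Proof. unfold commutes; congruence. Qed.

Lemma commutes_refl u : commutes u u.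
Proof. reflexivity. Qed.

Lemma commutes_inv_iff {u g} : commutes u (g^-1) -> commutes u g.
Proof. intros Hc. rewrite <- (inv_inv g). now apply cent_inv. Qed.

Lemma gpowZ_commuting_mul {x y} a : commutes x y -> (x ** y) ^^ a = x ^^ a ** y ^^ a.
Proof.
  intros Hc.
  assert (E : forall b, y ** x ^^ b = x ^^ b ** y).
  { intros b. symmetry. apply (commutes_pow b (commutes_sym Hc)). }
  revert a. apply Z.peano_ind.
  - simpl. now gsimp.
  - intros a IH. unfold Z.succ. rewrite !gpowZ_succ, IH.
    rewrite !mulA'. f_equal. rewrite !gmulA. f_equal. apply E.
  - intros a IH. replace (Z.pred a) with (a - 1) by lia.
    apply mul_cancel_l with (x ** y). rewrite !gpowZ_pred, gmulA, gmulVr, gmul1l, IH.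
    rewrite mulA', (gmulA y), <- gpowZ_pred, E, gpowZ_pred. now gsimp.
Qed.
End Powers.

Lemma torsion_free_pow {G : Group} (u : G) a :
  torsion_free G -> u ^^ a = gone -> a <> 0 -> u = gone.
Proof.
  intros tf E Ha.
  assert (H : forall b, 0 < b -> u ^^ b = gone -> u = gone).
  { intros b Hb Eb. apply (tf u (Z.to_nat b - 1)%nat).
    replace (S (Z.to_nat b - 1))%nat with (Z.to_nat b) by lia.
    rewrite <- gpowZ_of_nat, Z2Nat.id by lia. exact Eb. }
  destruct (Z_lt_le_dec 0 a); [now apply (H a)|].
  apply (H (- a)); [lia|]. now rewrite gpowZ_opp, E, inv_one.
Qed.

Lemma torsion_free_pow_inj {G : Group} (u : G) a b :
  torsion_free G -> u <> gone -> u ^^ a = u ^^ b -> a = b.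
Proof.
  intros tf Hu E. destruct (Z.eq_dec a b) as [|Hab]; [assumption|].
  exfalso. apply Hu, torsion_free_pow with (a - b); [assumption| |lia].
  unfold Z.sub. now rewrite gpowZ_add, E, gpowZ_opp, gmulVr.
Qed.

(** Turns a failure to commute into a nontrivial element, which a discriminating homomorphism can be
    asked to keep nontrivial. *)
Definition commutator {G : Group} (u x : G) : G := (x ** u) ** (u ** x)^-1.

Lemma commutator_eq_one {G : Group} (u x : G) : commutator u x = gone <-> commutes u x.
Proof.
  unfold commutator, commutes. split; intros E.
  - apply mul_cancel_r with ((u ** x)^-1). now rewrite E, gmulVr.
  - rewrite E. apply gmulVr.
Qed.

Lemma hom_commutes {G H : Group} (f : hom G H) u x : commutes u x -> commutes (f u) (f x).
Proof. unfold commutes. rewrite <- !hmorph. congruence. Qed.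

Lemma hom_commutator {G H : Group} (f : hom G H) u x :
  f (commutator u x) = commutator (f u) (f x).
Proof. unfold commutator. now rewrite hmorph, hom_inv, !hmorph. Qed.

(** * Big powers *)

Record is_length {G : Group} (l : G -> Z) : Prop := {
  len_one : l gone = 0;
  len_inv : forall x, l (x^-1) = l x;
  len_mul : forall x y, l (x ** y) <= l x + l y }.
Arguments len_one {G l} _.
Arguments len_inv {G l} _ x.
Arguments len_mul {G l} _ x y.

Lemma len_ge0 {G : Group} {l : G -> Z} : is_length l -> forall x, 0 <= l x.
Proof.
  intros Hl x. assert (H := len_mul Hl x (x^-1)).
  rewrite gmulVr, (len_one Hl), (len_inv Hl) in H. lia.
Qed.

Lemma len_conj_le {G : Group} {l : G -> Z} : is_length l ->
  forall p x, l (p ** x ** p^-1) <= l x + 2 * l p.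
Proof.
  intros Hl p x. assert (H1 := len_mul Hl (p ** x) (p^-1)).
  assert (H2 := len_mul Hl p x). rewrite (len_inv Hl) in H1. lia.
Qed.

Lemma len_pow_le {G : Group} {l : G -> Z} : is_length l ->
  forall x m, l (x ^^ m) <= Z.abs m * l x.
Proof.
  intros Hl x.
  assert (H : forall n : nat, l (gpow x n) <= Z.of_nat n * l x).
  { induction n as [|n IH]; simpl gpow; [rewrite (len_one Hl); lia|].
    assert (E := len_mul Hl x (gpow x n)). lia. }
  intros [|p|p]; simpl gpowZ.
  - rewrite (len_one Hl); lia.
  - specialize (H (Pos.to_nat p)). rewrite positive_nat_Z in H. exact H.
  - rewrite (len_inv Hl). specialize (H (Pos.to_nat p)). rewrite positive_nat_Z in H.
    exact H.
Qed.

(* The elements u^m1 g1 u^m2 g2 ... u^mr gr, r >= 1, with large exponents and bounded gi,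
   where only the last gi may commute with u. *)
Inductive alt {G : Group} (u : G) (l : G -> Z) (N R : Z) : G -> Prop :=
| alt_one m g : N <= Z.abs m -> l g <= R -> alt u l N R (u ^^ m ** g)
| alt_cons m g x : N <= Z.abs m -> l g <= R -> ~ commutes u g -> alt u l N R x ->
    alt u l N R (u ^^ m ** (g ** x)).

(** Like the last factor of [x], [g0] may commute with [u]: only factors between two powers are
    constrained. *)
Definition big_powers {G : Group} (u : G) (l : G -> Z) : Prop :=
  exists K, 0 <= K /\ forall R x g0, 0 <= R ->
    alt u l (K * (1 + R)) R x -> l g0 <= R -> g0 ** x <> gone.

Lemma alt_weaken {G : Group} (u : G) (l l' : G -> Z) N N' R R' x :
  (forall g, l g <= R -> l' g <= R') -> N' <= N -> alt u l N R x -> alt u l' N' R' x.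
Proof.
  intros Hl HN Hx. induction Hx; [apply alt_one | apply alt_cons]; auto; lia.
Qed.

(** A bound on [l'] bounds [l]. This carries the property from a tree length to a word length, and
    from one generating set to another. *)
Lemma big_powers_le {G : Group} (u : G) (l l' : G -> Z) A :
  0 <= A -> (forall g, l g <= A * l' g) -> big_powers u l -> big_powers u l'.
Proof.
  intros HA Hll [K [HK H]]. exists (K * (1 + A)). split; [nia|].
  intros R x g0 HR Hx Hg0. apply (H (A * R)); [nia| |].
  - apply alt_weaken with (3 := Hx); [|nia].
    intros g Hg. specialize (Hll g). nia.
  - specialize (Hll g0). nia.
Qed.

Lemma alt_conj {G : Group} {u p : G} {l : G -> Z} {N R x} : is_length l ->
  alt (p ** u ** p^-1) l N R x -> alt u l N (R + 2 * l p) (p^-1 ** x ** p).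
Proof.
  intros Hl Hx. induction Hx as [m g Hm Hg|m g x Hm Hg Hc Hx IH].
  - rewrite gpowZ_conj.
    replace (p^-1 ** (p ** u ^^ m ** p^-1 ** g) ** p)
      with (u ^^ m ** (p^-1 ** g ** p^-1^-1)) by now gsimp.
    apply alt_one; [assumption|].
    assert (E := len_conj_le Hl (p^-1) g). rewrite (len_inv Hl) in E. lia.
  - rewrite gpowZ_conj.
    replace (p^-1 ** (p ** u ^^ m ** p^-1 ** (g ** x)) ** p)
      with (u ^^ m ** ((p^-1 ** g ** p^-1^-1) ** (p^-1 ** x ** p))) by now gsimp.
    apply alt_cons; [assumption| | |assumption].
    + assert (E := len_conj_le Hl (p^-1) g). rewrite (len_inv Hl) in E. lia.
    + intros E. apply Hc. red in E |- *.
      assert (E2 : p ** (p^-1 ** g ** p^-1^-1 ** u) ** p^-1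
                 = p ** (u ** (p^-1 ** g ** p^-1^-1)) ** p^-1) by now rewrite E.
      gsimp_in E2. gsimp. exact E2.
Qed.

Lemma big_powers_conj {G : Group} {u : G} (p : G) {l : G -> Z} : is_length l ->
  big_powers u l -> big_powers (p ** u ** p^-1) l.
Proof.
  intros Hl [K [HK H]]. assert (Hp := len_ge0 Hl p).
  exists (K * (1 + 2 * l p)). split; [nia|].
  intros R x g0 HR Hx Hg0 E.
  apply (H (R + 2 * l p) (p^-1 ** x ** p) (p^-1 ** g0 ** p^-1^-1)); [lia| | |].
  - apply (alt_conj Hl). apply alt_weaken with (3 := Hx); [auto|nia].
  - assert (E2 := len_conj_le Hl (p^-1) g0). rewrite (len_inv Hl) in E2. lia.
  - transitivity (p^-1 ** (g0 ** x) ** p); [now gsimp|]. rewrite E. now gsimp.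
Qed.

Section AltCommutator.
Context {G : Group} (u : G) (l : G -> Z) (Hl : is_length l) (N R : Z) (b : G).
Context (HR : 0 <= R) (Hb : forall g, ~ commutes u (g ** b ** g^-1)).

Let alt2 := alt u l N (2 * R + l b).

(** The induction peels [x] from the left, and the inverse of each peeled piece is moved to the
    front of [y]; the two alternatives for [y] are the shapes that arise in this way. At the centre
    [b] is conjugated by the last factor of [x], whence the bound [2 * R + l b] and the assumption
    on conjugates of [b]. *)
Lemma alt_conj_tail x y : alt u l N R x ->
  (l y <= 2 * R + l b \/
   exists g z, l g <= 2 * R + l b /\ ~ commutes u g /\ alt2 z /\ y = g ** z) ->
  alt2 (x ** b ** x^-1 ** y).
Proof.
  assert (Hlb := len_ge0 Hl b).
  intros Hx. revert y. induction Hx as [m g Hm Hg|m g x Hm Hg Hc Hx IH]; intros y Hy.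
  - assert (Hy2 : alt2 (u ^^ (- m) ** y)).
    { destruct Hy as [Hy|[g' [z [Hg' [Hc' [Hz ->]]]]]].
      - apply alt_one; [lia|assumption].
      - apply alt_cons; try assumption; lia. }
    replace (u ^^ m ** g ** b ** (u ^^ m ** g)^-1 ** y)
      with (u ^^ m ** ((g ** b ** g^-1) ** (u ^^ (- m) ** y)))
      by (rewrite gpowZ_opp; now gsimp).
    apply alt_cons; auto. assert (E := len_conj_le Hl g b). lia.
  - assert (Hy2 : alt2 (u ^^ (- m) ** y)).
    { destruct Hy as [Hy|[g' [z [Hg' [Hc' [Hz ->]]]]]].
      - apply alt_one; [lia|assumption].
      - apply alt_cons; try assumption; lia. }
    replace (u ^^ m ** (g ** x) ** b ** (u ^^ m ** (g ** x))^-1 ** y)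
      with (u ^^ m ** (g ** (x ** b ** x^-1 ** (g^-1 ** (u ^^ (- m) ** y)))))
      by (rewrite gpowZ_opp; now gsimp).
    apply alt_cons; [assumption|lia|assumption|].
    apply IH. right. exists (g^-1), (u ^^ (- m) ** y). repeat split; auto.
    + rewrite (len_inv Hl). lia.
    + intros E. apply Hc. now apply commutes_inv_iff.
Qed.
End AltCommutator.

(* If g0 x commutes with v, then g0 x v x^-1 g0^-1 v^-1 = 1, although this is again an
   alternating product. *)
Lemma big_powers_not_commuting {G : Group} {u v : G} {l : G -> Z} : is_length l ->
  big_powers u l -> (forall g, ~ commutes u (g ** v ** g^-1)) ->
  exists K, 0 <= K /\ forall R x g0, 0 <= R ->
    alt u l (K * (1 + R)) R x -> l g0 <= R -> ~ commutes v (g0 ** x).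
Proof.
  intros Hl [K [HK H]] Hv. assert (Hlv := len_ge0 Hl v).
  exists (K * (2 + l v)). split; [nia|]. intros R x g0 HR Hx Hg0 E.
  assert (Hx2 : alt u l (K * (1 + (2 * R + l v))) R x).
  { apply alt_weaken with (3 := Hx); [auto|nia]. }
  apply (H (2 * R + l v) (x ** v ** x^-1 ** (g0^-1 ** v^-1)) g0); [lia| |lia|].
  - apply alt_conj_tail; auto. left.
    assert (E1 := len_mul Hl (g0^-1) (v^-1)). rewrite !(len_inv Hl) in E1. lia.
  - transitivity ((g0 ** x) ** v ** (g0 ** x)^-1 ** v^-1); [now gsimp|].
    red in E. rewrite E. now gsimp.
Qed.

(** * Hyperbolic length functions *)

(* The four-point inequality for d(x,y) = l(x^-1 y), with D standing for 2 delta. *)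
Definition four_point {G : Group} (l : G -> Z) (D : Z) : Prop :=
  forall x y z w : G,
    l (x^-1 ** y) + l (z^-1 ** w) <=
    Z.max (l (x^-1 ** z) + l (y^-1 ** w)) (l (x^-1 ** w) + l (y^-1 ** z)) + D.

Section Hyperbolic.
Context {G : Group} (l : G -> Z) (Hl : is_length l) (D : Z) (HD : 0 <= D).
Context (H4 : four_point l D).

Definition gdist (x y : G) := l (x^-1 ** y).

Lemma dist_sym x y : gdist x y = gdist y x.
Proof. unfold gdist. rewrite <- (len_inv Hl). now gsimp. Qed.

Lemma dist_tri x y z : gdist x z <= gdist x y + gdist y z.
Proof.
  unfold gdist. assert (E := len_mul Hl (x^-1 ** y) (y^-1 ** z)). gsimp_in E.
  exact E.
Qed.

Lemma dist_left g x y : gdist (g ** x) (g ** y) = gdist x y.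
Proof. unfold gdist. now gsimp. Qed.

Lemma dist_4 x y z w :
  gdist x y + gdist z w <= Z.max (gdist x z + gdist y w) (gdist x w + gdist y z) + D.
Proof. apply H4. Qed.

Lemma dist_1l x : gdist gone x = l x.
Proof. unfold gdist. now rewrite inv_one, gmul1l. Qed.

Lemma dist_1r x : gdist x gone = l x.
Proof. now rewrite dist_sym, dist_1l. Qed.

Lemma dist_ge0 x y : 0 <= gdist x y.
Proof. apply (len_ge0 Hl). Qed.

Lemma dist_mul_r x y : gdist x (x ** y) = l y.
Proof. unfold gdist. now gsimp. Qed.

Section BrokenGeodesic.
Context (u : G) (K1 K2 : Z) (HK1 : 0 <= K1) (HK2 : 1 <= K2).
Context (growth : forall m, Z.abs m <= K2 * (l (u ^^ m) + 1)).
Context (product_le : forall g p q, ~ commutes u g ->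
  l (u ^^ p) + l (g ** u ^^ q) - gdist (u ^^ p) (g ** u ^^ q) <= K1 * (1 + l g)).

(** Passage from local to global: the induction carries the claim that the end [u^m] of the first
    piece lies almost on a geodesic from 1 to [x]. The constant makes each piece longer than the
    errors of the adjacent corners together. *)
Lemma broken_geodesic {R x} : 0 <= R ->
  alt u l (K2 * ((4 * (K1 + D + 2) + 10) * (1 + R))) R x ->
  exists m, (4 * (K1 + D + 2) + 10) * (1 + R) <= l (u ^^ m) + 1 /\
    l (u ^^ m) + gdist (u ^^ m) x - (K1 * (1 + R) + 2 * R + D) <= l x.
Proof.
  intros HR Hx.
  assert (Hlong : forall m, K2 * ((4 * (K1 + D + 2) + 10) * (1 + R)) <= Z.abs m ->
            (4 * (K1 + D + 2) + 10) * (1 + R) <= l (u ^^ m) + 1).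
  { intros m Hm. specialize (growth m).
    apply Z.mul_le_mono_pos_l with K2; lia. }
  induction Hx as [m g Hm Hg|m g x Hm Hg Hc Hx IH]; exists m; split; auto.
  - rewrite dist_mul_r. assert (E := dist_tri gone (u ^^ m ** g) (u ^^ m)).
    rewrite !dist_1l, (dist_sym _ (u ^^ m)), dist_mul_r in E. nia.
  - destruct IH as [m' [Hm' IH]].
    assert (P := product_le g (- m) m' Hc).
    assert (HP : K1 * (1 + l g) <= K1 * (1 + R)) by nia.
    (* The first alternative of the maximum would bound [2 * l (u ^^ m')] by the error terms. The
       second one is the lower bound for the length of [u^m g x]. *)
    assert (E := dist_4 (u ^^ (- m)) (g ** u ^^ m') gone (g ** x)).
    rewrite dist_left, !dist_1l, !dist_1r in E.
    assert (E1 := dist_tri gone (g ** x) g). assert (E2 := dist_tri gone g (g ** x)).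
    assert (E3 := dist_tri gone (g ** u ^^ m') g).
    assert (E4 := dist_tri g gone (g ** x)).
    assert (E5 := dist_tri g gone (g ** u ^^ m')).
    rewrite (dist_sym _ g), !dist_1l, !dist_mul_r in *. rewrite !dist_1r in *.
    assert (E6 : gdist (u ^^ (- m)) (g ** x) = l (u ^^ m ** (g ** x))).
    { unfold gdist. rewrite gpowZ_opp. now gsimp. }
    assert (E7 : l (u ^^ (- m)) = l (u ^^ m)).
    { rewrite gpowZ_opp. apply (len_inv Hl). }
    assert (0 <= K1 * R) by nia. assert (0 <= D * R) by nia.
    rewrite Z.mul_add_distr_l, !Z.mul_add_distr_r in Hm'. lia.
Qed.

Lemma big_powers_of_product : big_powers u l.
Proof.
  exists (K2 * (4 * (K1 + D + 2) + 10)). split; [nia|].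
  intros R x g0 HR Hx Hg0 E.
  rewrite <- Z.mul_assoc in Hx.
  destruct (broken_geodesic HR Hx) as [m [Hm H]].
  assert (Ex : l x <= R).
  { apply inv_unique in E. now rewrite E, (len_inv Hl). }
  assert (E0 := dist_ge0 (u ^^ m) x).
  assert (0 <= K1 * R) by nia. assert (0 <= D * R) by nia. nia.
Qed.
End BrokenGeodesic.
End Hyperbolic.

Lemma pigeonhole {A : Type} (L : list A) (rel : nat -> A -> Prop) (N : nat) :
  (length L <= N)%nat -> (forall k, (k <= N)%nat -> exists v, In v L /\ rel k v) ->
  exists k k' v, (k < k' <= N)%nat /\ rel k v /\ rel k' v.
Proof.
  intros HN H. destruct (H 0%nat ltac:(lia)) as [v0 _].
  destruct (@ClassicalEpsilon.choice nat A
    (fun k v => (k <= N)%nat -> In v L /\ rel k v)) as [F HF].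
  { intros k. destruct (classic (k <= N)%nat) as [Hk|Hk].
    - destruct (H k Hk) as [v Hv]. now exists v.
    - exists v0. tauto. }
  apply NNPP. intros Hno.
  assert (Hnd : NoDup (map F (seq 0 (S N)))).
  { apply NoDup_map_NoDup_ForallPairs; [|apply seq_NoDup].
    intros a b Ha Hb E. apply in_seq in Ha, Hb.
    destruct (HF a ltac:(lia)) as [_ Ra]. destruct (HF b ltac:(lia)) as [_ Rb].
    destruct (Nat.lt_trichotomy a b) as [Hab|[Hab|Hab]]; [|assumption|].
    - exfalso. apply Hno. exists a, b, (F a). rewrite E at 2. repeat split; auto; lia.
    - exfalso. apply Hno. exists b, a, (F b). rewrite <- E at 2. repeat split; auto; lia. }
  assert (Hin : incl (map F (seq 0 (S N))) L).
  { intros v Hv. apply in_map_iff in Hv. destruct Hv as [k [<- Hk]].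
    apply in_seq in Hk. apply HF. lia. }
  apply NoDup_incl_length in Hin; [|assumption].
  rewrite length_map, length_seq in Hin. lia.
Qed.

(** The elements that conjugate some power of [u] to a nonzero power form the elementary closure of
    a loxodromic [u]; here it is required to lie in the centralizer. *)
Definition rootable {G : Group} (u : G) : Prop :=
  forall g a b, a <> 0 -> g ** u ^^ b ** g^-1 = u ^^ a -> commutes u g.

(** * Loxodromic elements, their axes and weak proper discontinuity *)

Section Loxodromic.
Context {G : Group} (l : G -> Z) (Hl : is_length l) (D : Z) (HD : 0 <= D).
Context (H4 : four_point l D).

Notation dist := (gdist l).

(** Linear growth says that the orbit of [u] is a quasi-geodesic. Additivity up to [C] is what the
    Morse lemma would add: intermediate powers lie near the segment between the ends. *)
Definition loxodromic (u : G) : Prop := exists C K, 0 <= C /\ 1 <= K /\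
  (forall i j, 0 <= i -> 0 <= j -> l (u ^^ i) + l (u ^^ j) - C <= l (u ^^ (i + j))) /\
  (forall m, Z.abs m <= K * (l (u ^^ m) + 1)).

(* Bestvina-Fujiwara's weak proper discontinuity, with the finiteness of the set W of
   elements that displace both 1 and u^M only a little expressed by an injective labelling. *)
Definition wpd (u : G) : Prop := forall eps,
  exists M (A : Type) (L : list A) (f : G -> A), 0 <= M /\
  let W g := l g <= eps /\ exists M', l (u ^^ (- M) ** g ** u ^^ M') <= eps in
  (forall g, W g -> In (f g) L) /\ (forall g g', W g -> W g' -> f g = f g' -> g = g').

Lemma dist_pow u a b : dist (u ^^ a) (u ^^ b) = l (u ^^ (b - a)).
Proof.
  unfold gdist. rewrite <- gpowZ_opp, <- gpowZ_add. do 2 f_equal. lia.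
Qed.

Lemma len_pow_0 u : l (u ^^ 0) = 0.
Proof. apply (len_one Hl). Qed.

Lemma len_pow_opp u a : l (u ^^ (- a)) = l (u ^^ a).
Proof. rewrite gpowZ_opp. apply (len_inv Hl). Qed.

Lemma len_pow_abs u a : l (u ^^ (Z.abs a)) = l (u ^^ a).
Proof.
  destruct (Z.abs_spec a) as [[_ ->]|[_ ->]]; [reflexivity|apply len_pow_opp].
Qed.

Lemma len_pow_add_le u a b : l (u ^^ (a + b)) <= l (u ^^ a) + l (u ^^ b).
Proof. rewrite gpowZ_add. apply (len_mul Hl). Qed.

(** The four-point inequality for 1, [h^2], [h] and [h^(n+3)] propagates the gap between the lengths
    of consecutive powers: it loses [D] of the initial [2 * D + 1], so each further power is longer
    by at least [D + 1]. *)
Lemma loxodromic_criterion h : l h + 2 * D + 1 <= l (h ^^ 2) -> loxodromic h.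
Proof.
  intros Hh.
  assert (Hstep : forall n : nat,
            l (h ^^ (Z.of_nat n + 1)) + D + 1 <= l (h ^^ (Z.of_nat n + 2))).
  { induction n as [|n IH].
    - simpl Z.of_nat. rewrite Z.add_0_l, gpowZ_1. rewrite Z.add_0_l. lia.
    - assert (E := dist_4 l D H4 gone (h ^^ 2) (h ^^ 1) (h ^^ (Z.of_nat n + 3))).
      rewrite !dist_pow, !(dist_1l l) in E.
      replace (Z.of_nat n + 3 - 1) with (Z.of_nat n + 2) in E by lia.
      replace (Z.of_nat n + 3 - 2) with (Z.of_nat n + 1) in E by lia.
      replace (1 - 2) with (- (1)) in E by lia.
      rewrite len_pow_opp, gpowZ_1 in E.
      rewrite Nat2Z.inj_succ.
      replace (Z.succ (Z.of_nat n) + 1) with (Z.of_nat n + 2) by lia.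
      replace (Z.succ (Z.of_nat n) + 2) with (Z.of_nat n + 3) by lia. lia. }
  assert (Hinc : forall n, 1 <= n -> l (h ^^ n) + D + 1 <= l (h ^^ (n + 1))).
  { intros n Hn. specialize (Hstep (Z.to_nat (n - 1))).
    rewrite Z2Nat.id in Hstep by lia.
    replace (n - 1 + 1) with n in Hstep by lia.
    now replace (n - 1 + 2) with (n + 1) in Hstep by lia. }
  assert (Hgrow : forall n : nat, Z.of_nat n <= l (h ^^ (Z.of_nat n)) + 1).
  { induction n as [|n IH]; [simpl Z.of_nat; rewrite len_pow_0; lia|].
    rewrite Nat2Z.inj_succ. unfold Z.succ.
    destruct n as [|n]; [assert (E := len_ge0 Hl (h ^^ (Z.of_nat 0 + 1))); lia|].
    specialize (Hinc (Z.of_nat (S n))). lia. }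
  assert (Hh1 := len_ge0 Hl h).
  exists (l h + D), 1. repeat split; [lia|lia| |].
  - intros i j Hi Hj.
    destruct (Z.eq_dec i 0) as [->|Hi0]; [rewrite len_pow_0; change (0 + j) with j; lia|].
    destruct (Z.eq_dec j 0) as [->|Hj0]; [rewrite len_pow_0, (Z.add_0_r i); lia|].
    destruct (Z.eq_dec j 1) as [->|Hj1].
    { specialize (Hinc i ltac:(lia)). rewrite gpowZ_1. lia. }
    assert (E := dist_4 l D H4 gone (h ^^ (i + 1)) (h ^^ i) (h ^^ (i + j))).
    rewrite !dist_pow, !(dist_1l l) in E.
    replace (i + j - i) with j in E by lia.
    replace (i + j - (i + 1)) with (j - 1) in E by lia.
    replace (i - (i + 1)) with (- (1)) in E by lia.
    rewrite len_pow_opp, gpowZ_1 in E.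
    assert (E1 := Hinc i ltac:(lia)). assert (E2 := Hinc (j - 1) ltac:(lia)).
    replace (j - 1 + 1) with j in E2 by lia. lia.
  - intros m. specialize (Hgrow (Z.to_nat (Z.abs m))).
    rewrite Z2Nat.id, len_pow_abs in Hgrow by lia. lia.
Qed.

Lemma loxodromic_root u k p : 1 <= k -> loxodromic (p^-1 ** u ^^ k ** p) -> loxodromic u.
Proof.
  intros Hk [C [K [HC [HK [Hq Hg]]]]].
  set (h := p^-1 ** u ^^ k ** p) in *.
  assert (Hp := len_ge0 Hl p). assert (Hu := len_ge0 Hl u).
  assert (Eh : forall n, h ^^ n = p^-1 ** u ^^ (k * n) ** p).
  { intros n. unfold h. rewrite <- (inv_inv p) at 2. rewrite gpowZ_conj.
    now rewrite inv_inv, gpowZ_mul. }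
  assert (Hn : forall n, Z.abs (l (h ^^ n) - l (u ^^ (k * n))) <= 2 * l p).
  { intros n. rewrite Eh.
    assert (E1 := len_conj_le Hl (p^-1) (u ^^ (k * n))).
    assert (E2 := len_conj_le Hl p (p^-1 ** u ^^ (k * n) ** p)).
    rewrite (len_inv Hl), inv_inv in E1.
    replace (p ** (p^-1 ** u ^^ (k * n) ** p) ** p^-1) with (u ^^ (k * n)) in E2
      by now gsimp. lia. }
  assert (Hr : forall a r B, 0 <= r <= B -> Z.abs (l (u ^^ (a + r)) - l (u ^^ a)) <= B * l u).
  { intros a r B HB.
    assert (E1 := len_pow_add_le u a r). assert (E2 := len_pow_add_le u (a + r) (- r)).
    rewrite len_pow_opp in E2. replace (a + r + - r) with a in E2 by lia.
    assert (E3 := len_pow_le Hl u r). assert (Z.abs r * l u <= B * l u) by nia. lia. }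
  (* Three comparisons of a power of [h] with its conjugate cost [2 * l p] each; rounding [i], [j]
     and [i + j] to multiples of [k] costs [k * l u] for each of the first two and twice that for
     the sum. *)
  exists (C + 6 * l p + 4 * (k * l u)), (k * (K * (k * l u + 2 * l p + 1) + 1)).
  repeat split; [nia|nia| |].
  - intros i j Hi Hj.
    assert (Ei := Z.div_mod i k ltac:(lia)). assert (Bi := Z.mod_pos_bound i k ltac:(lia)).
    assert (Ej := Z.div_mod j k ltac:(lia)). assert (Bj := Z.mod_pos_bound j k ltac:(lia)).
    set (a := i / k) in *. set (r := i mod k) in *.
    set (b := j / k) in *. set (s := j mod k) in *.
    assert (Ha : 0 <= a) by (apply Z.div_pos; lia).
    assert (Hb : 0 <= b) by (apply Z.div_pos; lia).
    assert (E1 := Hr (k * a) r k ltac:(lia)). assert (E2 := Hr (k * b) s k ltac:(lia)).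
    assert (E3 := Hr (k * (a + b)) (r + s) (2 * k) ltac:(lia)).
    rewrite <- Ei in E1. rewrite <- Ej in E2.
    replace (k * (a + b) + (r + s)) with (i + j) in E3 by lia.
    assert (F1 := Hn a). assert (F2 := Hn b). assert (F3 := Hn (a + b)).
    specialize (Hq a b Ha Hb). lia.
  - intros m. rewrite <- len_pow_abs.
    set (i := Z.abs m). assert (Hi : 0 <= i) by lia.
    assert (Ei := Z.div_mod i k ltac:(lia)). assert (Bi := Z.mod_pos_bound i k ltac:(lia)).
    set (a := i / k) in *. set (r := i mod k) in *.
    assert (Ha : 0 <= a) by (apply Z.div_pos; lia).
    assert (E1 := Hr (k * a) r k ltac:(lia)). rewrite <- Ei in E1.
    assert (F1 := Hn a). specialize (Hg a). assert (L := len_ge0 Hl (u ^^ i)).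
    set (B := k * l u + 2 * l p + 1) in *.
    assert (Ha2 : a <= K * (l (u ^^ i) + B)).
    { assert (K * (l (h ^^ a) + 1) <= K * (l (u ^^ i) + B)); [|lia].
      apply Z.mul_le_mono_nonneg_l; unfold B; lia. }
    assert (HB : 1 <= B) by (unfold B; nia).
    assert (i <= k * (a + 1)) by nia.
    assert (a + 1 <= (K * B + 1) * (l (u ^^ i) + 1)) by nia. nia.
Qed.

Section Axis.
Context (u : G) (C K : Z) (HC : 0 <= C) (HK : 1 <= K).
Context (quasi : forall i j, 0 <= i -> 0 <= j ->
  l (u ^^ i) + l (u ^^ j) - C <= l (u ^^ (i + j))).
Context (growth : forall m, Z.abs m <= K * (l (u ^^ m) + 1)).

(** A discrete intermediate value theorem: consecutive powers differ in length by at most [l u]. *)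
Lemma level_exists (q : nat) t : 0 <= t <= l (u ^^ (Z.of_nat q)) ->
  exists j, 0 <= j <= Z.of_nat q /\ t <= l (u ^^ j) <= t + l u.
Proof.
  induction q as [|q IH]; intros Ht.
  - exists 0. assert (H := len_ge0 Hl u). simpl Z.of_nat in Ht.
    rewrite len_pow_0 in *. lia.
  - destruct (Z_le_gt_dec t (l (u ^^ (Z.of_nat q)))) as [Hle|Hgt].
    + destruct IH as [j Hj]; [lia|]. exists j. lia.
    + exists (Z.of_nat (S q)). split; [lia|].
      assert (E := len_pow_add_le u (Z.of_nat q) 1). rewrite gpowZ_1 in E.
      replace (Z.of_nat q + 1) with (Z.of_nat (S q)) in E by lia. lia.
Qed.

(** Both [x] and a power of [u] at about the same distance from 1 lie almost on a segment from 1 to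
    [u^q]; in a hyperbolic space two such points are close. The index [j'] takes the sign of [q]. *)
Lemma near_axis x q E : 0 <= E -> l x + dist x (u ^^ q) <= l (u ^^ q) + E ->
  exists j, dist x (u ^^ j) <= 2 * E + C + D + l u.
Proof.
  intros HE Hx. assert (Hu := len_ge0 Hl u). assert (Hlx := len_ge0 Hl x).
  assert (Hd := dist_ge0 l Hl x (u ^^ q)).
  set (t := Z.min (l x) (l (u ^^ q))).
  destruct (@level_exists (Z.to_nat (Z.abs q)) t) as [j [Hj Ht]].
  { rewrite Z2Nat.id, len_pow_abs by lia. assert (H := len_ge0 Hl (u ^^ q)).
    unfold t; lia. }
  rewrite Z2Nat.id in Hj by lia.
  assert (Hsum : l (u ^^ j) + l (u ^^ (Z.abs q - j)) - C <= l (u ^^ q)).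
  { rewrite <- (len_pow_abs u q). replace (Z.abs q) with (j + (Z.abs q - j)) at 2 by lia.
    apply quasi; lia. }
  assert (Hfin : exists j', l (u ^^ j') = l (u ^^ j) /\
                   dist (u ^^ j') (u ^^ q) = l (u ^^ (Z.abs q - j))).
  { destruct (Z.abs_spec q) as [[Hq Eq]|[Hq Eq]]; rewrite Eq in *.
    - exists j. now rewrite dist_pow.
    - exists (- j). rewrite dist_pow, len_pow_opp. split; [reflexivity|].
      rewrite <- len_pow_opp. do 2 f_equal. lia. }
  destruct Hfin as [j' [E1 E2]]. exists j'.
  assert (F := dist_4 l D H4 x (u ^^ j') gone (u ^^ q)).
  rewrite !(dist_1l l), !(dist_1r l Hl), E1, E2 in F. unfold t in Ht. lia.
Qed.

(** A point [u^i] before the place where the segments from 1 to [u^p] and to [g u^q] diverge lies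
    almost on the second one. If it is also farther from 1 than [g], it lies almost on the segment
    from [g] to [g u^q], and [near_axis] applies after translation by [g^-1]. *)
Lemma fellow_travel : exists C' T, 0 <= T /\ forall g p q i,
  0 <= i * p -> Z.abs i <= Z.abs p -> l g + T <= l (u ^^ i) ->
  2 * l (u ^^ i) + T <= l (u ^^ p) + l (g ** u ^^ q) - dist (u ^^ p) (g ** u ^^ q) ->
  exists j, dist (u ^^ i) (g ** u ^^ j) <= C'.
Proof.
  exists (2 * (C + 2 * D) + C + D + l u), (C + 2 * D + 1). split; [lia|].
  intros g p q i Hs Hip Hi HP.
  set (y := u ^^ i) in *. set (a := u ^^ p) in *. set (b := g ** u ^^ q) in *.
  assert (Q : l y + dist y a - C <= l a).
  { unfold y, a. rewrite dist_pow, <- (len_pow_abs u i), <- (len_pow_abs u (p - i)).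
    rewrite <- (len_pow_abs u p).
    replace (Z.abs p) with (Z.abs i + Z.abs (p - i)) by nia. apply quasi; lia. }
  assert (F1 := dist_4 l D H4 y b gone a). rewrite !(dist_1l l), !(dist_1r l Hl) in F1.
  rewrite (dist_sym l Hl b a) in F1.
  assert (F2 := dist_4 l D H4 gone b g y). rewrite !(dist_1l l) in F2.
  rewrite (dist_sym l Hl b y), (dist_sym l Hl b g) in F2.
  assert (H0 := dist_ge0 l Hl g y). assert (Hg := len_ge0 Hl g).
  destruct (@near_axis (g^-1 ** y) q (C + 2 * D)) as [j Hj]; [lia| |].
  - replace (l (g^-1 ** y)) with (dist g y) by reflexivity.
    assert (E1 : dist (g^-1 ** y) (u ^^ q) = dist y b).
    { unfold b. rewrite <- (dist_left l g). now rewrite mulKr. }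
    assert (E2 : l (u ^^ q) = dist g b) by (unfold b; now rewrite dist_mul_r).
    rewrite E1, E2. lia.
  - exists j. rewrite <- (dist_left l g), mulKr in Hj. exact Hj.
Qed.

Lemma gromov_product_le : wpd u -> rootable u -> exists K1, 0 <= K1 /\
  forall g p q, ~ commutes u g ->
  l (u ^^ p) + l (g ** u ^^ q) - dist (u ^^ p) (g ** u ^^ q) <= K1 * (1 + l g).
Proof.
  intros Hw Hroot. destruct fellow_travel as [C' [T [HT Hf]]].
  destruct (Hw C') as [M [A0 [L [f [HM [HfN Hinj]]]]]].
  set (N := length L).
  assert (Hu := len_ge0 Hl u).
  (* Fellow-travelling is needed for indices up to [X]: [I0] to get past [g], [N] for the pigeonhole
     and [M] for the second displaced point. Only [I0] depends on [g], linearly, and so the final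
     bound is linear in [l g]. *)
  set (A := 2 * (K * (T + 1) + Z.of_nat N + M) * (l u + 1) + T).
  exists (A + 2 * K * (l u + 1)). split; [unfold A; nia|].
  intros g p q Hc. apply Z.nlt_ge. intros HP. apply Hc.
  assert (Hg := len_ge0 Hl g).
  set (P := l (u ^^ p) + l (g ** u ^^ q) - dist (u ^^ p) (g ** u ^^ q)) in *.
  set (I0 := K * (l g + T + 1)).
  set (X := I0 + Z.of_nat N + M).
  assert (HI0 : 0 <= I0) by (unfold I0; nia).
  assert (HPX : 2 * X * (l u + 1) + T <= P).
  { assert (0 <= A * l g) by (unfold A; nia). unfold X, I0, A in *. nia. }
  assert (HpX : X <= Z.abs p).
  { assert (E1 : P <= 2 * l (u ^^ p)).
    { assert (E := dist_tri l Hl gone (u ^^ p) (g ** u ^^ q)).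
      rewrite !(dist_1l l) in E. unfold P. lia. }
    assert (E2 := len_pow_le Hl u p). apply Z.nlt_ge. intros Hlt.
    assert (Z.abs p * l u <= X * l u) by nia. nia. }
  assert (Hgood : forall i, 0 <= i * p -> I0 <= Z.abs i <= X ->
            exists j, dist (u ^^ i) (g ** u ^^ j) <= C').
  { intros i Hs Hi. apply (Hf g p q i); [assumption|lia| |].
    - specialize (growth i). unfold I0 in Hi.
      assert (K * (l g + T + 1) <= K * (l (u ^^ i) + 1)) by lia.
      assert (l g + T + 1 <= l (u ^^ i) + 1); [|lia].
      apply Z.mul_le_mono_pos_l with K; lia.
    - fold P. assert (E := len_pow_le Hl u i).
      assert (Z.abs i * l u <= X * (l u + 1)) by nia. lia. }
  (* all indices below have the sign of p, and so do their translates by M *)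
  set (idx := fun k : nat => if Z_le_gt_dec 0 p then I0 + Z.of_nat k
                             else - (I0 + Z.of_nat k + M)).
  (* By fellow-travelling at [i] and at [i + M], the element [u^-i g u^j] displaces both 1 and [u^M]
     by at most [C'], hence carries one of [N] labels. A repeated label makes [g] conjugate
     [u^(j-j')] to [u^(i-i')]. *)
  destruct (@pigeonhole A0 L
    (fun k v => exists j, let y := u ^^ (- idx k) ** g ** u ^^ j in
       (l y <= C' /\ exists M', l (u ^^ (- M) ** y ** u ^^ M') <= C') /\ f y = v) N)
    as [k [k' [v [Hk [[j [Wj Ej]] [j' [Wj' Ej']]]]]]].
  - apply Nat.le_refl.
  - intros k Hk.
    assert (Hi : exists j, dist (u ^^ idx k) (g ** u ^^ j) <= C').
    { apply Hgood; unfold idx, X; destruct (Z_le_gt_dec 0 p); nia. }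
    assert (HiM : exists j, dist (u ^^ (idx k + M)) (g ** u ^^ j) <= C').
    { apply Hgood; unfold idx, X; destruct (Z_le_gt_dec 0 p); nia. }
    destruct Hi as [j Hj]. destruct HiM as [j' Hj'].
    unfold gdist in Hj, Hj'. rewrite <- gpowZ_opp in Hj, Hj'.
    assert (W : l (u ^^ (- idx k) ** g ** u ^^ j) <= C' /\ exists M',
      l (u ^^ (- M) ** (u ^^ (- idx k) ** g ** u ^^ j) ** u ^^ M') <= C').
    { split; [now rewrite mulA'|]. exists (j' - j).
      replace (u ^^ (- M) ** (u ^^ (- idx k) ** g ** u ^^ j) ** u ^^ (j' - j))
        with (u ^^ (- (idx k + M)) ** (g ** u ^^ j')); [assumption|].
      replace (- (idx k + M)) with (- M + - idx k) by lia.
      replace (u ^^ j') with (u ^^ (j + (j' - j))) by (f_equal; lia).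
      rewrite !gpowZ_add. now rewrite !mulA'. }
    exists (f (u ^^ (- idx k) ** g ** u ^^ j)). split; [|now exists j].
    now apply HfN.
  - assert (E := Hinj _ _ Wj Wj' (eq_trans Ej (eq_sym Ej'))).
    apply (Hroot g (idx k - idx k') (j - j')).
    + unfold idx. destruct (Z_le_gt_dec 0 p); lia.
    + assert (E2 : u ^^ (idx k) ** (u ^^ (- idx k) ** g ** u ^^ j) ** u ^^ (- j') ** g^-1
        = u ^^ (idx k) ** (u ^^ (- idx k') ** g ** u ^^ j') ** u ^^ (- j') ** g^-1)
        by now rewrite E.
      unfold Z.sub. rewrite !gpowZ_add. rewrite !gpowZ_opp in *. gsimp_in E2. gsimp.
      exact E2.
Qed.
End Axis.

Theorem big_powers_of_wpd u : loxodromic u -> wpd u -> rootable u -> big_powers u l.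
Proof.
  intros [C [K [HC [HK [Hq Hg]]]]] Hw Hr.
  destruct (@gromov_product_le u C K HC HK Hq Hg Hw Hr) as [K1 [HK1 H]].
  apply (@big_powers_of_product G l Hl D HD H4 u K1 K HK1 HK Hg H).
Qed.
End Loxodromic.

(** * Word lengths *)

Section WordLength.
Context {G : Group} (X : list G).

(** The least length if there is one; without a word for [g] the value is arbitrary. *)
Definition wlen (g : G) : Z := Z.of_nat
  (epsilon (inhabits 0%nat)
     (fun n => wlen_le X g n /\ forall m, wlen_le X g m -> (n <= m)%nat)).

Lemma wlen_le_mono g n m : wlen_le X g n -> (n <= m)%nat -> wlen_le X g m.
Proof. intros [w [H1 [H2 H3]]] Hm. exists w. repeat split; auto; lia. Qed.

Lemma word_val_app (v w : list (G * bool)) : word_val (v ++ w) = word_val v ** word_val w.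
Proof.
  induction v as [|p v IH]; [now rewrite gmul1l|]. simpl.
  now rewrite IH, gmulA.
Qed.

Lemma wlen_le_one n : wlen_le X gone n.
Proof. exists []. split; [intros p []|]. split; [simpl; lia|reflexivity]. Qed.

Lemma wlen_le_mul g h n m : wlen_le X g n -> wlen_le X h m -> wlen_le X (g ** h) (n + m).
Proof.
  intros [v [Hv [Lv <-]]] [w [Hw [Lw <-]]]. exists (v ++ w). repeat split.
  - intros p Hp. apply in_app_or in Hp. destruct Hp; auto.
  - rewrite length_app. lia.
  - apply word_val_app.
Qed.

Lemma wlen_le_letter x b : In x X -> wlen_le X (letter_val (x, b)) 1.
Proof.
  intros Hx. exists [(x, b)]. repeat split; [|simpl; lia|apply gmul1r].
  intros p [<-|[]]. exact Hx.
Qed.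

Lemma wlen_le_inv g n : wlen_le X g n -> wlen_le X (g^-1) n.
Proof.
  intros [w [Hw [Lw <-]]]. apply wlen_le_mono with (length w); [|assumption]. clear Lw.
  induction w as [|[x b] w IH].
  - simpl. rewrite inv_one. apply wlen_le_one.
  - simpl word_val. rewrite inv_mul. replace (length ((x, b) :: w)) with (length w + 1)%nat
      by (simpl; lia).
    apply wlen_le_mul; [apply IH; intros p Hp; apply Hw; now right|].
    assert (Hx : In x X) by (apply (Hw (x, b)); now left).
    assert (E := wlen_le_letter x (negb b) Hx).
    replace ((letter_val (x, b))^-1) with (letter_val (x, negb b)); [assumption|].
    destruct b; unfold letter_val; simpl; now rewrite ?inv_inv.
Qed.

Context (HX : generates X).

Lemma wlen_spec g : exists n, wlen g = Z.of_nat n /\ wlen_le X g n /\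
  forall m, wlen_le X g m -> (n <= m)%nat.
Proof.
  unfold wlen. eexists. split; [reflexivity|]. apply epsilon_spec.
  destruct (HX g) as [n0 H0].
  destruct (dec_inh_nat_subset_has_unique_least_element (wlen_le X g)) as [n [Hn _]].
  - intros n. apply classic.
  - now exists n0.
  - exists n. split; apply Hn.
Qed.

Lemma wlen_le_iff g n : wlen g <= Z.of_nat n <-> wlen_le X g n.
Proof.
  destruct (wlen_spec g) as [k [E [Hk Hmin]]]. rewrite E. split.
  - intros H. apply wlen_le_mono with k; [assumption|lia].
  - intros H. apply Hmin in H. lia.
Qed.

Lemma wlen_is_length : is_length wlen.
Proof.
  assert (Hmul : forall x y, wlen (x ** y) <= wlen x + wlen y).
  { intros x y. destruct (wlen_spec x) as [n [En [Hn _]]].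
    destruct (wlen_spec y) as [m [Em [Hm _]]]. rewrite En, Em.
    rewrite <- Nat2Z.inj_add. apply wlen_le_iff. now apply wlen_le_mul. }
  assert (Hinv : forall x, wlen (x^-1) <= wlen x).
  { intros x. destruct (wlen_spec x) as [n [En [Hn _]]]. rewrite En.
    apply wlen_le_iff. now apply wlen_le_inv. }
  constructor; [| |assumption].
  - assert (E : wlen gone <= Z.of_nat 0).
    { apply wlen_le_iff, wlen_le_one. }
    destruct (wlen_spec gone) as [n [En _]]. lia.
  - intros x. assert (H1 := Hinv x). assert (H2 := Hinv (x^-1)).
    rewrite inv_inv in H2. lia.
Qed.

Lemma wlen_gen x : In x X -> wlen x <= 1.
Proof.
  intros Hx. apply (wlen_le_iff x 1). exact (wlen_le_letter x false Hx).
Qed.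

Lemma wlen_le_ind (P : nat -> G -> Prop) : P 0%nat gone ->
  (forall n x b g, In x X -> P n g -> P (S n) (letter_val (x, b) ** g)) ->
  forall g, P (Z.to_nat (wlen g)) g.
Proof.
  intros P0 PS g. destruct (wlen_spec g) as [n [-> [[w [Hw [Lw E]]] Hmin]]].
  assert (En : n = length w).
  { assert (n <= length w)%nat; [|lia]. apply Hmin. exists w. repeat split; auto. }
  rewrite Nat2Z.id, En, <- E. clear - Hw P0 PS.
  induction w as [|[x b] w IH]; [exact P0|]. simpl. apply PS.
  - apply (Hw (x, b)). now left.
  - apply IH. intros p Hp. apply Hw. now right.
Qed.

Lemma wlen_geodesic g k : 0 <= k <= wlen g ->
  exists m, wlen m = k /\ wlen (m^-1 ** g) = wlen g - k.
Proof.
  intros Hk. destruct (wlen_spec g) as [n [En [[w [Hw [Lw E]]] Hmin]]].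
  set (a := firstn (Z.to_nat k) w). set (b := skipn (Z.to_nat k) w).
  assert (Ew : w = a ++ b) by (symmetry; apply firstn_skipn).
  assert (La : (length a <= Z.to_nat k)%nat) by apply firstn_le_length.
  assert (Lb : length b = (length w - Z.to_nat k)%nat) by apply length_skipn.
  exists (word_val a).
  assert (Ha : wlen (word_val a) <= k).
  { rewrite <- (Z2Nat.id k) by lia. apply wlen_le_iff. exists a. repeat split; auto.
    intros p Hp. apply Hw. rewrite Ew. apply in_or_app. now left. }
  assert (Eb : (word_val a)^-1 ** g = word_val b).
  { rewrite <- E, Ew, word_val_app. apply mulKl. }
  assert (Hb : wlen (word_val b) <= wlen g - k).
  { rewrite En in *. replace (Z.of_nat n - k) with (Z.of_nat (n - Z.to_nat k)) by lia.
    apply wlen_le_iff. exists b. repeat split; [|lia].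
    intros p Hp. apply Hw. rewrite Ew. apply in_or_app. now right. }
  assert (Hsum : wlen g <= wlen (word_val a) + wlen (word_val b)).
  { rewrite <- E at 1. rewrite Ew, word_val_app. apply (len_mul wlen_is_length). }
  rewrite Eb. lia.
Qed.

Lemma wlen_ball_finite r : exists L, forall g, wlen g <= r -> In g L.
Proof.
  assert (H : forall n : nat, exists L, forall g, (Z.to_nat (wlen g) <= n)%nat -> In g L).
  { induction n as [|n [L HL]].
    - exists [gone]. intros g Hg. left.
      destruct (wlen_spec g) as [k [Ek [[w [_ [Lw E]]] _]]].
      assert (k = 0%nat) by lia. subst k. destruct w; [exact E|simpl in Lw; lia].
    - exists (L ++ flat_map (fun x => map (gmul x) L ++ map (gmul (x^-1)) L) X).
      intros g Hg. apply in_or_app.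
      destruct (wlen_spec g) as [k [Ek [[w [Hw [Lw E]]] _]]].
      destruct w as [|[x b] w].
      { left. apply HL. replace g with (gone : G).
        rewrite (len_one wlen_is_length). simpl; lia. }
      right. apply in_flat_map. exists x. split; [apply (Hw (x, b)); now left|].
      assert (Hin : In (word_val w) L).
      { apply HL. assert (wlen (word_val w) <= Z.of_nat (length w)).
        { apply wlen_le_iff. exists w. repeat split; auto.
          intros p Hp. apply Hw. now right. }
        simpl in Lw. lia. }
      rewrite <- E. simpl. apply in_or_app.
      destruct b; [right|left]; apply in_map_iff; exists (word_val w); auto. }
  destruct (H (Z.to_nat r)) as [L HL]. exists L. intros g Hg. apply HL. lia.
Qed.

Lemma len_hom_le {H : Group} (l : H -> Z) (f : hom G H) M : is_length l -> 0 <= M ->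
  (forall x, In x X -> l (f x) <= M) -> forall g, l (f g) <= M * wlen g.
Proof.
  intros Hl HM Hf g. assert (Hg := len_ge0 wlen_is_length g).
  rewrite <- (Z2Nat.id (wlen g)) by assumption.
  apply (@wlen_le_ind (fun n g => l (f g) <= M * Z.of_nat n)).
  - rewrite hom_one, (len_one Hl). lia.
  - clear g Hg. intros n x b g Hx IH. rewrite hmorph.
    assert (E := len_mul Hl (f (letter_val (x, b))) (f g)).
    assert (E2 : l (f (letter_val (x, b))) <= M).
    { destruct b; unfold letter_val; simpl; rewrite ?hom_inv, ?(len_inv Hl); auto. }
    lia.
Qed.
End WordLength.

Lemma list_bound {A : Type} (l : A -> Z) (L : list A) :
  exists M, 0 <= M /\ forall x, In x L -> l x <= M.
Proof.
  induction L as [|a L [M [HM H]]]; [exists 0; simpl; split; [lia|tauto]|].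
  exists (Z.max M (l a)). split; [lia|]. intros x [<-|Hx]; [lia|].
  specialize (H x Hx). lia.
Qed.

Lemma len_le_wlen {G : Group} (X : list G) (l : G -> Z) : generates X -> is_length l ->
  exists M, 0 <= M /\ forall g, l g <= M * wlen X g.
Proof.
  intros HX Hl. destruct (list_bound l X) as [M [HM H]]. exists M. split; [assumption|].
  exact (len_hom_le X HX l (hom_id G) M Hl HM H).
Qed.

Lemma hyperbolic_four_point {G : Group} : hyperbolic G ->
  exists (X : list G) D, generates X /\ 0 <= D /\ four_point (wlen X) D.
Proof.
  intros [X [HX [delta H]]]. exists X, (2 * Z.of_nat delta).
  split; [assumption|]. split; [lia|]. intros x y z w.
  assert (Hd : forall a b, exists n, wlen X (a^-1 ** b) = Z.of_nat n /\ wdist X a b n).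
  { intros a b. destruct (wlen_spec X HX (a^-1 ** b)) as [n [E Hn]]. exists n.
    split; [exact E | exact Hn]. }
  destruct (Hd x y) as [dxy [Exy Hxy]]. destruct (Hd x z) as [dxz [Exz Hxz]].
  destruct (Hd y z) as [dyz [Eyz Hyz]]. destruct (Hd x w) as [dxw [Exw Hxw]].
  destruct (Hd y w) as [dyw [Eyw Hyw]]. destruct (Hd z w) as [dzw [Ezw Hzw]].
  assert (E := H x y z w _ _ _ _ _ _ Hxy Hxz Hyz Hxw Hyw Hzw).
  rewrite Exy, Exz, Eyz, Exw, Eyw, Ezw. lia.
Qed.

(** * Torsion-free hyperbolic groups *)

Section TorsionFreeHyperbolic.
Context {G : Group} (tf : torsion_free G) (l : G -> Z) (Hl : is_length l).
Context (D : Z) (HD : 0 <= D) (H4 : four_point l D).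
Context (ball_finite : forall r, exists L : list G, forall g, l g <= r -> In g L).
Context (geodesic : forall g k, 0 <= k <= l g ->
  exists m, l m = k /\ l (m^-1 ** g) = l g - k).

Notation dist := (gdist l).

Lemma powers_unbounded u B : u <> gone -> exists n, B < l (u ^^ n).
Proof.
  intros Hu. apply NNPP. intros Hno. destruct (ball_finite B) as [L HL].
  destruct (pigeonhole L (fun k v => u ^^ (Z.of_nat k) = v) (length L))
    as [k [k' [v [Hk [E E']]]]]; [lia| |].
  - intros k _. exists (u ^^ (Z.of_nat k)). split; [|reflexivity]. apply HL.
    apply Z.nlt_ge. intros Hlt. apply Hno. now exists (Z.of_nat k).
  - assert (Z.of_nat k = Z.of_nat k'); [|lia].
    apply torsion_free_pow_inj with u; [assumption..|congruence].
Qed.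

(* If m is the midpoint of a long segment [1, a] with a commuting with h and h short, then
   h shifts m along [1, a]; if h^2 does not shift m by about twice as much, the shift is
   small. *)
Lemma midpoint_displacement a h m :
  commutes a h -> 2 * l m <= l a <= 2 * l m + 1 -> dist m a = l a - l m ->
  100 * (l h + D + 1) <= l a ->
  dist m (h ** (h ** m)) <= dist m (h ** m) + 2 * D -> dist m (h ** m) <= 7 * D.
Proof.
  intros Hc Hm Hma Ha H2.
  assert (Hlh := len_ge0 Hl h).
  assert (Eha : dist (h ** a) a = l h).
  { red in Hc. rewrite Hc, (dist_sym l Hl). apply dist_mul_r. }
  assert (E1 : dist h (h ** a) = l a) by apply dist_mul_r.
  assert (E2 : dist h (h ** m) = l m) by apply dist_mul_r.
  assert (E3 : dist (h ** m) (h ** a) = dist m a) by apply dist_left.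
  assert (E4 : dist (h ** (h ** m)) (h ** a) = dist (h ** m) a) by apply dist_left.
  assert (E5 : dist (h ** (h ** m)) (h ** m) = dist (h ** m) m) by apply dist_left.
  assert (E6 : dist (h ** (h ** m)) h = l (h ** m)).
  { rewrite (dist_sym l Hl). apply dist_mul_r. }
  assert (Q1 := dist_4 l D H4 gone (h ** m) h (h ** a)).
  assert (Q2 := dist_4 l D H4 gone (h ** a) (h ** m) a).
  assert (Q3 := dist_4 l D H4 m (h ** m) gone a).
  assert (Q4 := dist_4 l D H4 (h ** (h ** m)) gone (h ** m) h).
  assert (Q4' := dist_4 l D H4 (h ** (h ** m)) h (h ** m) gone).
  assert (Q5 := dist_4 l D H4 (h ** (h ** m)) a (h ** m) (h ** a)).
  assert (Q5' := dist_4 l D H4 (h ** (h ** m)) (h ** a) (h ** m) a).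
  assert (T1 := dist_tri l Hl gone h (h ** m)).
  assert (T2 := dist_tri l Hl h gone (h ** m)).
  assert (T3 := dist_tri l Hl gone (h ** a) a).
  assert (T3' := dist_tri l Hl gone a (h ** a)).
  assert (T4 := dist_tri l Hl (h ** m) (h ** a) a).
  assert (T5 := dist_tri l Hl (h ** m) a (h ** a)).
  assert (T6 := dist_tri l Hl gone m (h ** (h ** m))).
  assert (T7 := dist_tri l Hl gone (h ** (h ** m)) m).
  assert (T8 := dist_tri l Hl m (h ** (h ** m)) a).
  assert (T9 := dist_tri l Hl (h ** (h ** m)) m a).
  rewrite ?(dist_1l l), ?(dist_1r l Hl) in *.
  rewrite (dist_sym l Hl (h ** m) h) in *.
  rewrite (dist_sym l Hl (h ** a) (h ** m)) in *.
  rewrite (dist_sym l Hl a (h ** a)) in *.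
  rewrite (dist_sym l Hl a (h ** m)) in *.
  rewrite (dist_sym l Hl (h ** m) m) in *.
  rewrite (dist_sym l Hl (h ** (h ** m)) m) in *.
  assert (P1 := dist_ge0 l Hl m (h ** m)).
  lia.
Qed.

(** If [u] is not loxodromic, no conjugate of a power passes the criterion, so no power displaces
    any point about twice as far when doubled. Then all small powers move the midpoint of a long
    segment from 1 to [u^n] by at most [7 * D]; there are more of them than elements in that ball,
    which contradicts torsion-freeness. *)
Lemma loxodromic_of_neq_one u : u <> gone -> loxodromic l u.
Proof.
  intros Hu. apply NNPP. intros Hlox.
  assert (Hshort : forall k m, 1 <= k ->
    dist m (u ^^ k ** (u ^^ k ** m)) <= dist m (u ^^ k ** m) + 2 * D).
  { intros k m Hk. apply Z.nlt_ge. intros Hlt. apply Hlox.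
    apply (loxodromic_root l Hl u k m Hk). apply (loxodromic_criterion l Hl D HD H4).
    unfold gdist in Hlt.
    replace ((m^-1 ** u ^^ k ** m) ^^ 2) with (m^-1 ** (u ^^ k ** (u ^^ k ** m))).
    - rewrite mulA'. lia.
    - change 2 with (1 + 1). rewrite gpowZ_add, gpowZ_1. now gsimp. }
  destruct (ball_finite (7 * D)) as [L HL].
  set (A := (Z.of_nat (length L) + 1) * l u).
  destruct (powers_unbounded u (100 * (A + D + 1)) Hu) as [n Hn].
  set (a := u ^^ n) in *.
  assert (Ha := len_ge0 Hl a).
  destruct (geodesic a (l a / 2)) as [m [Em Ema]].
  { split; [apply Z.div_pos; lia | apply Z.div_le_upper_bound; lia]. }
  assert (Hdiv := Z.div_mod (l a) 2 ltac:(lia)).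
  assert (Hmod := Z.mod_pos_bound (l a) 2 ltac:(lia)).
  destruct (pigeonhole L (fun k v => m^-1 ** (u ^^ (Z.of_nat k + 1) ** m) = v) (length L))
    as [k [k' [v [Hk [E E']]]]]; [lia| |].
  - intros k Hk. exists (m^-1 ** (u ^^ (Z.of_nat k + 1) ** m)). split; [|reflexivity].
    apply HL. apply (midpoint_displacement a); [| | | |apply Hshort; lia].
    + unfold a, commutes. apply gpowZ_comm.
    + lia.
    + rewrite Em. exact Ema.
    + assert (E := len_pow_le Hl u (Z.of_nat k + 1)).
      assert (Hu0 := len_ge0 Hl u).
      assert (Z.abs (Z.of_nat k + 1) * l u <= A) by (unfold A; nia). lia.
  - assert (Z.of_nat k + 1 = Z.of_nat k' + 1); [|lia].
    apply torsion_free_pow_inj with u; [assumption..|].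
    rewrite <- E' in E. apply mul_cancel_l, mul_cancel_r in E. exact E.
Qed.

(** An element [g] commuting with [w] moves both ends of the segment from [w^-p] to [w^p] by only
    [l g]. For [p] large compared with [l g], the image [g] of the middle point 1 is then almost on
    the original segment, hence near a power of [w]. *)
Lemma centralizer_near_powers w : w <> gone -> exists B, forall g, commutes w g ->
  exists i, l (w ^^ i ** g) <= B.
Proof.
  intros Hw. destruct (loxodromic_of_neq_one w Hw) as [C [K [HC [HK [Hq Hg]]]]].
  exists (2 * (C + 2 * D) + C + D + l w). intros g Hc.
  assert (Hlg := len_ge0 Hl g).
  set (p := K * (4 * (l g + C + D + 1) + 1)).
  assert (Hp : 0 <= p) by (unfold p; nia).
  assert (Hfp : 4 * (l g + C + D + 1) <= l (w ^^ p)).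
  { specialize (Hg p). rewrite Z.abs_eq in Hg by assumption. unfold p in Hg at 1.
    apply Z.mul_le_mono_pos_l in Hg; lia. }
  set (f := l (w ^^ p)) in *.
  assert (Hf2 := Hq p p Hp Hp). fold f in Hf2.
  assert (Hcp : forall i, g ** w ^^ i = w ^^ i ** g).
  { intros i. symmetry. apply (commutes_pow i (commutes_sym Hc)). }
  set (a := w ^^ (- p)). set (b := w ^^ p).
  assert (Eab : dist a b = l (w ^^ (p + p))).
  { unfold a, b. rewrite dist_pow. do 2 f_equal. lia. }
  assert (Ea : dist a (g ** a) = l g) by (unfold a; rewrite Hcp; apply dist_mul_r).
  assert (Eb : dist b (g ** b) = l g) by (unfold b; rewrite Hcp; apply dist_mul_r).
  assert (Ega : dist g (g ** a) = f).
  { rewrite dist_mul_r. unfold a. now rewrite (len_pow_opp l Hl). }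
  assert (Egb : dist g (g ** b) = f) by apply dist_mul_r.
  assert (Eg : dist (g ** a) (g ** b) = dist a b) by apply dist_left.
  assert (Q1 := dist_4 l D H4 a g (g ** a) (g ** b)).
  assert (Q2 := dist_4 l D H4 a (g ** b) g b).
  assert (T1 := dist_tri l Hl g a (g ** a)).
  assert (T2 := dist_tri l Hl g b (g ** b)).
  assert (T3 := dist_tri l Hl a (g ** b) b).
  assert (T4 := dist_tri l Hl a g b).
  assert (T5 := dist_tri l Hl a (g ** a) g).
  assert (T6 := dist_tri l Hl a (g ** a) (g ** b)).
  assert (T7 := dist_tri l Hl (g ** a) a (g ** b)).
  rewrite (dist_sym l Hl g a), (dist_sym l Hl (g ** b) b), (dist_sym l Hl (g ** b) g),
    (dist_sym l Hl (g ** a) a), (dist_sym l Hl (g ** a) g) in *.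
  (* Segments in [near_axis] start at 1, so everything is translated by [w^p]. *)
  destruct (near_axis l Hl D H4 w C HC Hq (b ** g) (p + p) (C + 2 * D)) as [j Hj].
  - lia.
  - assert (F1 : l (b ** g) = dist a g).
    { unfold gdist, a, b. rewrite <- gpowZ_opp. do 3 f_equal. lia. }
    assert (F2 : dist (b ** g) (w ^^ (p + p)) = dist g b).
    { rewrite gpowZ_add. apply dist_left. }
    rewrite F1, F2, <- Eab. lia.
  - exists (p - j). unfold gdist in Hj. rewrite <- (len_inv Hl) in Hj.
    rewrite inv_mul, inv_inv, <- gpowZ_opp, gmulA in Hj. unfold b in Hj.
    rewrite <- gpowZ_add in Hj. replace (- j + p) with (p - j) in Hj by lia. exact Hj.
Qed.

Lemma commensurable (w x : G) : w <> gone -> commutes w x -> exists a b, a <> 0 /\ x ^^ a = w ^^ b.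
Proof.
  intros Hw Hc. destruct (centralizer_near_powers w Hw) as [B HB].
  destruct (ball_finite B) as [L HL].
  destruct (pigeonhole L (fun k v => exists i, w ^^ i ** x ^^ (Z.of_nat k) = v) (length L))
    as [k [k' [v [Hk [[i E] [i' E']]]]]]; [lia| |].
  - intros k _. destruct (HB _ (commutes_pow (Z.of_nat k) Hc)) as [i Hi].
    eexists. split; [apply HL, Hi|]. now exists i.
  - exists (Z.of_nat k - Z.of_nat k'), (- i + i'). split; [lia|].
    unfold Z.sub. rewrite !gpowZ_add, !gpowZ_opp. rewrite <- E' in E.
    apply mul_cancel_l with (w ^^ i). rewrite mulKr, gmulA, E. now gsimp.
Qed.

(** * The transfer from a centralizer to its central cyclic subgroup *)

Section Transfer.
Context (w : G) (Hw : w <> gone).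

(** The predicate given to [epsilon] depends only on the coset of [g], so by extensionality all
    elements of a coset get the same representative. *)
Definition coset_repr (g : G) : G :=
  epsilon (inhabits gone) (fun h => exists i, h = w ^^ i ** g).

Definition coset_exp (g : G) : Z :=
  epsilon (inhabits 0) (fun i => g = w ^^ i ** coset_repr g).

Lemma coset_repr_spec g : exists i, coset_repr g = w ^^ i ** g.
Proof.
  apply (epsilon_spec (inhabits gone) (fun h => exists i, h = w ^^ i ** g)).
  exists g, 0. now rewrite gmul1l.
Qed.

Lemma coset_exp_spec g : g = w ^^ coset_exp g ** coset_repr g.
Proof.
  apply (epsilon_spec (inhabits 0) (fun i => g = w ^^ i ** coset_repr g)).
  destruct (coset_repr_spec g) as [i E]. exists (- i). rewrite E, gpowZ_opp.
  now rewrite mulKl.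
Qed.

Lemma coset_repr_mul k g : coset_repr (w ^^ k ** g) = coset_repr g.
Proof.
  unfold coset_repr. f_equal. apply functional_extensionality. intros h.
  apply propositional_extensionality. split; intros [i ->].
  - exists (i + k). now rewrite gpowZ_add, mulA'.
  - exists (i - k). unfold Z.sub. rewrite gpowZ_add, gpowZ_opp. now gsimp.
Qed.

Lemma coset_exp_unique g i : g = w ^^ i ** coset_repr g -> coset_exp g = i.
Proof.
  intros E. apply torsion_free_pow_inj with w; [assumption..|].
  apply mul_cancel_r with (coset_repr g). rewrite <- E. symmetry. apply coset_exp_spec.
Qed.

Definition is_transversal (B : list G) : Prop :=
  NoDup B /\ (forall b, In b B -> commutes w b /\ coset_repr b = b) /\
  (forall g, commutes w g -> In (coset_repr g) B).

Lemma transversal_exists : exists B, is_transversal B.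
Proof.
  destruct (centralizer_near_powers w Hw) as [r Hr].
  destruct (ball_finite r) as [L HL].
  set (dec := fun g => if excluded_middle_informative (commutes w g) then true else false).
  exists (nodup (fun x y => excluded_middle_informative (x = y))
            (map coset_repr (filter dec L))).
  split; [apply NoDup_nodup|]. split.
  - intros b Hb. apply nodup_In, in_map_iff in Hb. destruct Hb as [g [<- Hg]].
    apply filter_In in Hg. destruct Hg as [_ Hg]. unfold dec in Hg.
    destruct (excluded_middle_informative (commutes w g)) as [Hc|]; [|discriminate].
    destruct (coset_repr_spec g) as [i E]. split.
    + rewrite E. apply cent_mul; [|assumption]. apply commutes_pow, commutes_refl.
    + rewrite E at 1. apply coset_repr_mul.
  - intros g Hc. destruct (Hr g Hc) as [i Hi]. rewrite <- (coset_repr_mul i g).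
    apply nodup_In, in_map, filter_In. split; [now apply HL|]. unfold dec.
    destruct (excluded_middle_informative (commutes w (w ^^ i ** g))) as [|Hn];
      [reflexivity|].
    exfalso. apply Hn. apply cent_mul; [|assumption]. apply commutes_pow, commutes_refl.
Qed.

Definition Zsum (L : list Z) : Z := fold_right Z.add 0 L.

Lemma Zsum_perm L L' : Permutation L L' -> Zsum L = Zsum L'.
Proof. unfold Zsum. induction 1; simpl; lia. Qed.

Context (B : list G) (HB : is_transversal B).

(** The classical transfer to a subgroup of finite index, read in the integers through the exponent
    of [w]. *)
Definition transfer (g : G) : Z := Zsum (map (fun b => coset_exp (b ** g)) B).

(** Right multiplication by [g] permutes the cosets, so the sum for [h] may be taken over the
    permuted representatives, and then the identity holds term by term. *)
Lemma transfer_mul g h : commutes w g -> commutes w h ->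
  transfer (g ** h) = transfer g + transfer h.
Proof.
  intros Hg Hh. destruct HB as [HB1 [HB2 HB3]].
  set (s := fun b => coset_repr (b ** g)).
  assert (Hperm : Permutation (map s B) B).
  { apply NoDup_Permutation_bis.
    - apply NoDup_map_NoDup_ForallPairs; [|assumption]. intros b b' Hb Hb' E.
      unfold s in E.
      destruct (coset_repr_spec (b ** g)) as [i Ei].
      destruct (coset_repr_spec (b' ** g)) as [i' Ei'].
      rewrite Ei, Ei', !gmulA in E. apply mul_cancel_r in E.
      rewrite <- (proj2 (HB2 b Hb)), <- (proj2 (HB2 b' Hb')).
      rewrite <- (coset_repr_mul i b), E. apply coset_repr_mul.
    - now rewrite length_map.
    - intros x Hx. apply in_map_iff in Hx. destruct Hx as [b [<- Hb]].
      apply HB3, cent_mul; [apply (HB2 b Hb)|assumption]. }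
  assert (E : transfer h = Zsum (map (fun b => coset_exp (s b ** h)) B)).
  { unfold transfer. rewrite <- (map_map s (fun b => coset_exp (b ** h))).
    apply Zsum_perm, Permutation_map, Permutation_sym, Hperm. }
  rewrite E. unfold transfer.
  assert (Hterm : forall b, coset_exp (b ** (g ** h)) =
                    coset_exp (b ** g) + coset_exp (s b ** h)).
  { intros b. apply coset_exp_unique.
    assert (E1 : b ** (g ** h) = w ^^ coset_exp (b ** g) ** (s b ** h)).
    { rewrite gmulA, (coset_exp_spec (b ** g)) at 1. apply mulA'. }
    rewrite E1, coset_repr_mul, gpowZ_add, mulA', <- coset_exp_spec. reflexivity. }
  clear - Hterm. induction B as [|b L IH]; simpl; [reflexivity|].
  rewrite Hterm, IH. lia.
Qed.

Lemma transfer_pow g a : commutes w g -> transfer (g ^^ a) = a * transfer g.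
Proof.
  intros Hg. assert (H1 : transfer gone = 0).
  { assert (E := transfer_mul gone gone (cent_one w) (cent_one w)).
    rewrite gmul1l in E. lia. }
  revert a. apply Z.peano_ind.
  - rewrite Z.mul_0_l. exact H1.
  - intros a IH. unfold Z.succ. rewrite gpowZ_add, gpowZ_1, transfer_mul;
      [lia|now apply commutes_pow|assumption].
  - intros a IH. assert (E := transfer_mul (g ^^ (Z.pred a)) g (commutes_pow _ Hg) Hg).
    rewrite <- (gpowZ_1 g) in E at 2. rewrite <- gpowZ_add in E.
    replace (Z.pred a + 1) with a in E by lia. lia.
Qed.

Lemma transfer_self : transfer w = Z.of_nat (length B).
Proof.
  destruct HB as [HB1 [HB2 HB3]]. unfold transfer.
  assert (Hterm : forall b, In b B -> coset_exp (b ** w) = 1).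
  { intros b Hb. destruct (HB2 b Hb) as [Hc E]. apply coset_exp_unique.
    red in Hc. rewrite Hc. rewrite <- (gpowZ_1 w) at 3.
    rewrite coset_repr_mul, E, gpowZ_1. reflexivity. }
  clear - Hterm. induction B as [|b L IH]; [reflexivity|]. simpl map. simpl length.
  rewrite Nat2Z.inj_succ. simpl Zsum. rewrite Hterm by now left.
  rewrite IH; [lia|]. intros; apply Hterm; now right.
Qed.

(** Some nonzero power of [g] is a power of [w], and the transfer of [w] is the positive index; a
    zero transfer therefore makes [g] a torsion element. *)
Lemma transfer_inj g : commutes w g -> transfer g = 0 -> g = gone.
Proof.
  intros Hg E. destruct (commensurable w g Hw Hg) as [a [b [Ha Eab]]].
  assert (E1 := transfer_pow g a Hg).
  rewrite Eab, (transfer_pow w b (commutes_refl w)), transfer_self, E in E1.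
  assert (HBpos : (0 < length B)%nat).
  { assert (H := proj2 (proj2 HB) gone (cent_one w)). destruct B; [destruct H|simpl; lia]. }
  assert (b = 0) by nia. subst b. apply torsion_free_pow with a; assumption.
Qed.
End Transfer.

(** Commutators die under the transfer, which has trivial kernel on the centralizer. *)
Lemma centralizer_abelian (w x y : G) : w <> gone -> commutes w x -> commutes w y -> commutes x y.
Proof.
  intros Hw Hx Hy. destruct (transversal_exists w Hw) as [B HB].
  assert (Hx' := cent_inv Hx). assert (Hy' := cent_inv Hy).
  assert (E : y ** x ** (x ** y)^-1 = gone).
  { rewrite inv_mul. apply (transfer_inj w Hw B HB); [repeat apply cent_mul; assumption|].
    rewrite !(transfer_mul w Hw B HB) by (repeat apply cent_mul; assumption).
    assert (E1 := transfer_pow w Hw B HB x (-1) Hx).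
    assert (E2 := transfer_pow w Hw B HB y (-1) Hy).
    change (-1) with (- (1)) in E1, E2. rewrite gpowZ_opp, gpowZ_1 in E1, E2. lia. }
  apply mul_cancel_r with ((x ** y)^-1). now rewrite E, gmulVr.
Qed.

(** An argument on translation lengths: if [a < b], quasi-additivity makes the two lengths differ by
    that of [u^(k(b-a))], up to [C], and this is unbounded in [k]. *)
Lemma conj_pow_exponents (g u : G) a b : u <> gone -> 0 < a -> 0 < b ->
  (forall k, Z.abs (l (u ^^ (k * a)) - l (u ^^ (k * b))) <= 2 * l g) -> a = b.
Proof.
  intros Hu. destruct (loxodromic_of_neq_one u Hu) as [C [K [HC [HK [Hq Hg]]]]].
  assert (Hlg := len_ge0 Hl g).
  revert a b. enough (H : forall a b, 0 < a -> 0 < b ->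
    (forall k, Z.abs (l (u ^^ (k * a)) - l (u ^^ (k * b))) <= 2 * l g) -> ~ a < b).
  { intros a b Ha Hb Hk. assert (H1 := H a b Ha Hb Hk).
    assert (H2 : ~ b < a). { apply H; auto. intros k. specialize (Hk k). lia. }
    lia. }
  intros a b Ha Hb Hk Hab.
  set (k := K * (2 * l g + C + 2)). specialize (Hk k).
  assert (Hk0 : 0 <= k) by (unfold k; nia).
  assert (E := Hq (k * a) (k * (b - a)) ltac:(nia) ltac:(nia)).
  replace (k * a + k * (b - a)) with (k * b) in E by lia.
  specialize (Hg (k * (b - a))).
  assert (K * (2 * l g + C + 2) <= K * (l (u ^^ (k * (b - a))) + 1)) by (fold k; nia).
  assert (2 * l g + C + 2 <= l (u ^^ (k * (b - a))) + 1)
    by (apply Z.mul_le_mono_pos_l with K; lia).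
  lia.
Qed.

Lemma centralizer_pow (u g : G) a : u <> gone -> a <> 0 -> commutes (u ^^ a) g -> commutes u g.
Proof.
  intros Hu Ha Hg. apply (centralizer_abelian (u ^^ a)); [| |assumption].
  - intros E. apply Hu, torsion_free_pow with a; assumption.
  - apply commutes_sym, commutes_pow, commutes_refl.
Qed.

(** Conjugate powers have equal translation lengths, so [a] and [b] agree up to sign; if they are
    equal, [g] centralizes a power of [u] and hence [u]. *)
Lemma rootable_of_torsion_free_hyperbolic (u : G) : u <> gone -> rootable u.
Proof.
  intros Hu g a b Ha E.
  assert (Epow : forall k, g ** u ^^ (k * b) ** g^-1 = u ^^ (k * a)).
  { intros k. rewrite (Z.mul_comm k b), (Z.mul_comm k a), !gpowZ_mul, <- gpowZ_conj.
    now rewrite E. }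
  assert (Hb : b <> 0).
  { intros ->. apply Hu, torsion_free_pow with a; [assumption| |assumption].
    rewrite <- E. simpl. now gsimp. }
  assert (Hab : Z.abs a = Z.abs b).
  { apply (conj_pow_exponents g u); [assumption|lia|lia|]. intros k.
    assert (Habs : forall c, l (u ^^ (k * Z.abs c)) = l (u ^^ (k * c))).
    { intros c. destruct (Z.abs_spec c) as [[_ ->]|[_ ->]]; [reflexivity|].
      rewrite Z.mul_opp_r. apply (len_pow_opp l Hl). }
    rewrite !Habs. rewrite <- Epow.
    assert (E1 := len_conj_le Hl g (u ^^ (k * b))).
    assert (E2 := len_conj_le Hl (g^-1) (g ** u ^^ (k * b) ** g^-1)).
    rewrite (len_inv Hl), inv_inv in E2.
    replace (g^-1 ** (g ** u ^^ (k * b) ** g^-1) ** g) with (u ^^ (k * b)) in E2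
      by now gsimp. lia. }
  destruct (Z.eq_dec a b) as [->|Hne].
  - apply (centralizer_pow u g b Hu Hb). red.
    rewrite <- E at 2. now gsimp.
  - assert (Eb : a = - b) by lia. subst a.
    (* g inverts u^b, so g^2 centralizes u^b and hence u, and g lies in the abelian C(g^2) *)
    destruct (classic (g = gone)) as [->|Hg]; [apply cent_one|].
    apply commutes_sym. apply (centralizer_abelian (g ^^ 2)).
    + intros E2. apply Hg, torsion_free_pow with 2; [assumption..|lia].
    + apply commutes_sym, commutes_pow, commutes_refl.
    + apply commutes_sym. apply (centralizer_pow u _ b Hu Hb).
      assert (E1 : g ** u ^^ (- b) ** g^-1 = u ^^ b).
      { specialize (Epow (-1)).
        replace (-1 * b) with (- b) in Epow by lia.
        replace (-1 * - b) with b in Epow by lia. exact Epow. }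
      red. change 2 with (1 + 1). rewrite gpowZ_add, gpowZ_1.
      rewrite <- E1 at 2. rewrite <- E. now gsimp.
Qed.

(** Both [z] and its conjugate are commensurable with [u], so [h^-1] conjugates a power of [z] to a
    nonzero power of [z], and rootability applies to [z]. *)
Lemma malnormal_of_torsion_free_hyperbolic (u z h : G) : u <> gone -> z <> gone ->
  commutes u z -> commutes u (h^-1 ** z ** h) -> commutes u h.
Proof.
  intros Hu Hz Hc Hc'.
  set (z' := h^-1 ** z ** h) in *.
  destruct (commensurable u z Hu Hc) as [a [b [Ha E]]].
  destruct (commensurable u z' Hu Hc') as [a' [b' [Ha' E']]].
  assert (Hz' : z' <> gone).
  { intros E0. apply Hz. unfold z' in E0. apply mul_cancel_r with h.
    rewrite gmul1l. apply mul_cancel_l with (h^-1). now rewrite gmulA, E0, gmulVl. }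
  assert (Hnz : forall x c d, x <> gone -> c <> 0 -> x ^^ c = u ^^ d -> d <> 0).
  { intros x c d Hx Hc0 Ex ->. apply Hx, torsion_free_pow with c; assumption. }
  assert (Hb := Hnz z a b Hz Ha E). assert (Hb' := Hnz z' a' b' Hz' Ha' E').
  apply (centralizer_abelian z); [assumption|now apply commutes_sym|].
  apply commutes_inv_iff.
  apply (rootable_of_torsion_free_hyperbolic z Hz (h^-1) (a * b') (a' * b)); [lia|].
  rewrite <- gpowZ_conj, inv_inv. fold z'.
  rewrite !gpowZ_mul, E, E', <- !gpowZ_mul. f_equal. lia.
Qed.

Lemma big_powers_of_torsion_free_hyperbolic u : u <> gone -> big_powers u l.
Proof.
  intros Hu. apply (big_powers_of_wpd l Hl D HD H4 u).
  - now apply loxodromic_of_neq_one.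
  - intros eps. destruct (ball_finite eps) as [L HL].
    (* Balls are finite, so a small displacement of 1 alone leaves finitely many elements. *)
    exists 0, G, L, (fun g => g). split; [lia|]. split; [|auto].
    intros g [Hg _]. now apply HL.
  - now apply rootable_of_torsion_free_hyperbolic.
Qed.
End TorsionFreeHyperbolic.

(** * Free abelian groups *)

(* The Horner form of e_1 B + e_2 B^2 + ... + e_n B^n. *)
Fixpoint dot (B : Z) (n : nat) : (Fin.t n -> Z) -> Z :=
  match n with
  | O => fun _ => 0
  | S n => fun e => B * (e F1 + dot B n (fun k => e (FS k)))
  end.

Lemma dot_add B n e e' : dot B n (fun k => e k + e' k) = dot B n e + dot B n e'.
Proof.
  induction n as [|n IH]; simpl; [reflexivity|].
  rewrite (IH (fun k => e (FS k)) (fun k => e' (FS k))). lia.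
Qed.

Lemma dot_mul B n e : exists q, dot B n e = B * q.
Proof. destruct n; simpl; [exists 0; lia|eexists; reflexivity]. Qed.

(** With signed digits smaller than [B], the first nonzero digit cannot be cancelled by the multiple
    of [B] that follows it. The lowest weight is [B] and not 1, so a nonzero value is at least
    [B]. *)
Lemma dot_large B n (e : ZnGroup n) : e <> gone -> (forall k, Z.abs (e k) < B) ->
  B <= Z.abs (dot B n e).
Proof.
  revert e. induction n as [|n IH]; intros e He Hb.
  - exfalso. apply He. apply functional_extensionality. intros k. inversion k.
  - simpl. assert (Hb0 := Hb F1).
    assert (Hne : e F1 + dot B n (fun k => e (FS k)) <> 0); [|nia].
    destruct (Z.eq_dec (e F1) 0) as [E0|E0].
    + assert (He' : (fun k => e (FS k)) <> (gone : ZnGroup n)).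
      { intros E. apply He. apply functional_extensionality. intros k.
        pattern k. apply Fin.caseS'; [exact E0|]. intros k'.
        exact (f_equal (fun f => f k') E). }
      assert (E := IH _ He' (fun k => Hb (FS k))). lia.
    + destruct (dot_mul B n (fun k => e (FS k))) as [q ->]. intros E.
      destruct (Z.eq_dec q 0) as [->|Hq]; [lia|].
      assert (B <= Z.abs (B * q)) by (rewrite Z.abs_mul; nia). lia.
Qed.

Definition unit_vec {n} (k : Fin.t n) : ZnGroup n :=
  fun k' => if Fin.eq_dec k k' then 1 else 0.

Lemma unit_vec_same {n} (k : Fin.t n) : unit_vec k k = 1.
Proof. unfold unit_vec. destruct (Fin.eq_dec k k); congruence. Qed.

Lemma unit_vec_other {n} (k k' : Fin.t n) : k <> k' -> unit_vec k k' = 0.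
Proof. unfold unit_vec. destruct (Fin.eq_dec k k'); congruence. Qed.

Fixpoint all_fin (n : nat) : list (Fin.t n) :=
  match n with O => [] | S n => F1 :: map FS (all_fin n) end.

Lemma in_all_fin {n} (k : Fin.t n) : In k (all_fin n).
Proof.
  induction k; simpl; [now left|]. right. now apply in_map.
Qed.

Lemma dot_zero B n : dot B n (fun _ => 0) = 0.
Proof. induction n as [|n IH]; simpl; [reflexivity|rewrite IH; lia]. Qed.

(** The largest weight, and the source of the degree [n]. *)
Lemma dot_unit_vec_le B n (k : Fin.t n) : 1 <= B ->
  Z.abs (dot B n (unit_vec k)) <= B ^ Z.of_nat n.
Proof.
  intros HB. induction k as [n|n k IH].
  - simpl dot. replace (fun k => unit_vec F1 (FS k)) with (fun _ : Fin.t n => 0).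
    + rewrite dot_zero, unit_vec_same.
      rewrite Nat2Z.inj_succ, Z.pow_succ_r by lia.
      assert (0 < B ^ Z.of_nat n) by (apply Z.pow_pos_nonneg; lia). nia.
    + apply functional_extensionality. intros k. symmetry.
      apply unit_vec_other. discriminate.
  - simpl dot. replace (fun k0 => unit_vec (FS k) (FS k0)) with (unit_vec k).
    + rewrite Nat2Z.inj_succ, Z.pow_succ_r by lia. nia.
    + apply functional_extensionality. intros k'. unfold unit_vec.
      destruct (Fin.eq_dec k k') as [->|Hk].
      * destruct (Fin.eq_dec (FS k') (FS k')); congruence.
      * destruct (Fin.eq_dec (FS k) (FS k')) as [E|]; [|reflexivity].
        apply Fin.FS_inj in E. contradiction.
Qed.

Lemma Zn_pow_apply {n} (e : ZnGroup n) z k : (e ^^ z) k = z * e k.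
Proof.
  revert z. apply Z.peano_ind; [reflexivity| |]; intros z IH.
  - unfold Z.succ. rewrite gpowZ_succ. simpl. rewrite IH. lia.
  - replace (Z.pred z) with (z - 1) by lia. rewrite gpowZ_pred. simpl. rewrite IH. lia.
Qed.

Lemma wlen_le_pow {G : Group} (X : list G) g n z : wlen_le X g n ->
  exists m, wlen_le X (g ^^ z) m.
Proof.
  intros Hg. revert z. apply Z.peano_ind.
  - exists 0%nat. apply wlen_le_one.
  - intros z [m Hm]. exists (n + m)%nat. unfold Z.succ. rewrite gpowZ_succ.
    now apply wlen_le_mul.
  - intros z [m Hm]. exists (n + m)%nat. replace (Z.pred z) with (z - 1) by lia.
    rewrite gpowZ_pred. apply wlen_le_mul; [now apply wlen_le_inv|assumption].
Qed.

Definition Zn_basis n : list (ZnGroup n) := map unit_vec (all_fin n).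

Lemma Zn_basis_generates n : generates (Zn_basis n).
Proof.
  assert (H : forall (L : list (Fin.t n)) (e : ZnGroup n),
            (forall k, ~ In k L -> e k = 0) -> exists m, wlen_le (Zn_basis n) e m).
  { induction L as [|a L IH]; intros e He.
    - exists 0%nat. replace e with (gone : ZnGroup n); [apply wlen_le_one|].
      apply functional_extensionality. intros k. symmetry. apply He. simpl. tauto.
    - destruct (IH (fun k => if Fin.eq_dec a k then 0 else e k)) as [m Hm].
      { intros k Hk. destruct (Fin.eq_dec a k); [reflexivity|].
        apply He. intros [E|Hin]; contradiction. }
      destruct (wlen_le_pow (Zn_basis n) (unit_vec a) 1 (e a)) as [m' Hm'].
      { exact (wlen_le_letter _ (unit_vec a) false (in_map _ _ _ (in_all_fin a))). }
      exists (m' + m)%nat.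
      replace e with (unit_vec a ^^ e a ** (fun k => if Fin.eq_dec a k then 0 else e k)).
      + now apply wlen_le_mul.
      + apply functional_extensionality. intros k. simpl. rewrite Zn_pow_apply.
        unfold unit_vec. destruct (Fin.eq_dec a k) as [->|]; lia. }
  intros e. apply (H (all_fin n)). intros k Hk. exfalso. apply Hk, in_all_fin.
Qed.

Lemma coord_le_wlen n (e : ZnGroup n) k : Z.abs (e k) <= wlen (Zn_basis n) e.
Proof.
  rewrite <- (Z.mul_1_l (wlen _ _)).
  apply (len_hom_le (Zn_basis n) (Zn_basis_generates n) (fun e : ZnGroup n => Z.abs (e k))
           (hom_id _) 1); [|lia|].
  - constructor; intros; simpl; lia.
  - intros x Hx. apply in_map_iff in Hx. destruct Hx as [k' [<- _]].
    simpl. unfold unit_vec. destruct (Fin.eq_dec k' k); lia.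
Qed.

(** * Extensions of centralizers *)

(** The two images generate the pushout: the universal map into the subgroup [S], followed by
    inclusion, is the identity by uniqueness, so [S] is everything. *)
Lemma pushout_ind {C H A G : Group} (a : hom C H) (b : hom C A) (i : hom H G) (j : hom A G) :
  is_pushout a b i j -> forall P : G -> Prop, P gone ->
  (forall h x, P x -> P (i h ** x)) -> (forall y x, P x -> P (j y ** x)) -> forall x, P x.
Proof.
  intros [Hc Hu] P P1 Pi Pj.
  (* The equivalence, rather than an implication, closes [S] under inverses. *)
  set (S := fun x => forall y, P y <-> P (x ** y)).
  assert (Si : forall h, S (i h)).
  { intros h y. split; [apply Pi|]. intros Hy. apply (Pi (h^-1)) in Hy.
    now rewrite hom_inv, mulKl in Hy. }
  assert (Sj : forall h, S (j h)).
  { intros h y. split; [apply Pj|]. intros Hy. apply (Pj (h^-1)) in Hy.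
    now rewrite hom_inv, mulKl in Hy. }
  assert (Smul : forall x y, S x -> S y -> S (x ** y)).
  { intros x y Hx Hy z. rewrite mulA', <- (Hx (y ** z)). apply Hy. }
  assert (Sone : S gone) by (intros y; now rewrite gmul1l).
  assert (Sinv : forall x, S x -> S (x^-1)).
  { intros x Hx y. rewrite (Hx (x^-1 ** y)), mulKr. reflexivity. }
  assert (Heq : forall p q : {x | S x}, proj1_sig p = proj1_sig q -> p = q).
  { intros p q E. apply eq_sig_hprop; [intros; apply proof_irrelevance|exact E]. }
  set (K := @Build_Group {x | S x}
    (fun p q => exist _ (proj1_sig p ** proj1_sig q) (Smul _ _ (proj2_sig p) (proj2_sig q)))
    (fun p => exist _ ((proj1_sig p)^-1) (Sinv _ (proj2_sig p)))
    (exist _ gone Sone)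
    (fun x y z => Heq (exist _ _ _) (exist _ _ _) (gmulA _ _ _))
    (fun x => Heq (exist _ _ _) x (gmul1l _)) (fun x => Heq (exist _ _ _) x (gmul1r _))
    (fun x => Heq (exist _ _ _) (exist _ _ _) (gmulVl _))
    (fun x => Heq (exist _ _ _) (exist _ _ _) (gmulVr _))).
  set (f := @Build_hom H K (fun h => exist _ (i h) (Si h))
              (fun x y => Heq (exist _ _ _) (exist _ _ _) (hmorph i x y))).
  set (g := @Build_hom A K (fun h => exist _ (j h) (Sj h))
              (fun x y => Heq (exist _ _ _) (exist _ _ _) (hmorph j x y))).
  set (incl := @Build_hom K G (fun p => proj1_sig p) (fun x y => eq_refl)).
  destruct (Hu K f g) as [k [Ki [Kj _]]].
  { intros c. apply Heq. apply Hc. }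
  destruct (Hu G i j Hc) as [k0 [_ [_ Huniq]]].
  intros x.
  assert (E : hom_comp incl k x = hom_id G x).
  { rewrite (Huniq (hom_id G)) by reflexivity. apply Huniq.
    - intros h. simpl. now rewrite Ki.
    - intros h. simpl. now rewrite Kj. }
  simpl in E. assert (Sx := proj2_sig (k x)). simpl in Sx. rewrite E in Sx.
  specialize (Sx gone). rewrite gmul1r in Sx. now apply Sx.
Qed.

Definition fully_residually (G Gamma : Group) : Prop :=
  forall L : list G, (forall x, In x L -> x <> gone) ->
  exists f : hom G Gamma, forall x, In x L -> f x <> gone.

(** The length may depend on [u]: this qualitative form serves normal forms and residuality, where
    constants are irrelevant. *)
Definition has_big_powers (Gamma : Group) : Prop :=
  forall u : Gamma, u <> gone -> exists l, is_length l /\ big_powers u l.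

Section Extension.
Context {H G : Group} (v : H) (d : nat).
Context (i : hom H G) (j : hom (ExtA H v d) G).
Context (Hpo : is_pushout (cent_incl H v) (extA_incl H v d) i j).

Definition stable (e : ZnGroup d) : G := j ((gone : CentGroup H v), e).
Notation t := stable.

Lemma pair_eq {A B : Group} (x x' : A) (y y' : B) :
  x = x' -> y = y' -> ((x, y) : ProdGroup A B) = (x', y').
Proof. now intros -> ->. Qed.

Lemma stable_mul e e' : t (e ** e') = t e ** t e'.
Proof.
  unfold stable. rewrite <- hmorph. f_equal. apply pair_eq; [|reflexivity].
  symmetry. apply gmul1l.
Qed.

Lemma stable_one : t gone = gone.
Proof. apply (hom_one j). Qed.

Lemma stable_inv e : t (e^-1) = (t e)^-1.
Proof. apply inv_unique. rewrite <- stable_mul, gmulVr. apply stable_one. Qed.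

Lemma stable_pow e a : t (e ^^ a) = t e ^^ a.
Proof.
  set (f := @Build_hom (ZnGroup d) G t stable_mul). exact (hom_gpowZ f e a).
Qed.

Lemma ext_pair c e : j (c, e) = i (proj1_sig c) ** t e.
Proof.
  rewrite (proj1 Hpo c : i (proj1_sig c) = _). unfold stable. rewrite <- hmorph.
  f_equal. apply pair_eq; symmetry; [apply gmul1r|apply gmul1l].
Qed.

Lemma stable_comm c e : commutes v c -> t e ** i c = i c ** t e.
Proof.
  intros Hc. set (c' := exist _ c Hc : CentGroup H v).
  change (i c) with (i (proj1_sig c')).
  rewrite (proj1 Hpo c' : i (proj1_sig c') = _). unfold stable. rewrite <- !hmorph.
  f_equal. apply pair_eq.
  - now rewrite gmul1l, gmul1r.
  - now rewrite gmul1l, gmul1r.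
Qed.

Lemma ext_hom {K : Group} (f : hom H K) (g : hom (ZnGroup d) K) :
  (forall c e, commutes v c -> g e ** f c = f c ** g e) ->
  exists h : hom G K, (forall x, h (i x) = f x) /\ (forall e, h (t e) = g e).
Proof.
  intros Hfg.
  assert (Hm : forall p q : ExtA H v d,
    f (proj1_sig (fst (p ** q))) ** g (snd (p ** q)) =
    (f (proj1_sig (fst p)) ** g (snd p)) ** (f (proj1_sig (fst q)) ** g (snd q))).
  { intros [c e] [c' e'].
    change (f (proj1_sig c ** proj1_sig c') ** g (e ** e') =
            (f (proj1_sig c) ** g e) ** (f (proj1_sig c') ** g e')).
    rewrite !hmorph. assert (E := Hfg (proj1_sig c') e (proj2_sig c')).
    rewrite !mulA'. f_equal. rewrite (gmulA (g e)), E. apply gmulA. }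
  set (ga := @Build_hom (ExtA H v d) K
    (fun p => f (proj1_sig (fst p)) ** g (snd p)) Hm).
  destruct (proj2 Hpo K f ga) as [h [Hi [Hj _]]].
  { intros c. simpl. change (fun _ : Fin.t d => 0) with (gone : ZnGroup d).
    now rewrite hom_one, gmul1r. }
  exists h. split; [exact Hi|]. intros e. unfold stable. rewrite Hj. simpl.
  now rewrite hom_one, gmul1l.
Qed.

Definition is_retraction (B : Z) (r : hom G H) : Prop :=
  (forall x, r (i x) = x) /\ (forall e, r (t e) = v ^^ dot B d e).

Lemma retraction_exists B : exists r, is_retraction B r.
Proof.
  set (g := @Build_hom (ZnGroup d) H (fun e => v ^^ dot B d e)
    (fun e e' => eq_trans (f_equal (gpowZ v) (dot_add B d e e')) (gpowZ_add _ _ _))).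
  destruct (@ext_hom H (hom_id H) g) as [r Hr].
  - intros c e Hc. simpl. apply (commutes_pow _ (commutes_sym Hc)).
  - exists r. exact Hr.
Qed.

Lemma base_inj x y : i x = i y -> x = y.
Proof.
  destruct (retraction_exists 0) as [r [Hr _]]. intros E.
  rewrite <- (Hr x), <- (Hr y). now rewrite E.
Qed.

Lemma ext_ind (P : G -> Prop) : P gone -> (forall h x, P x -> P (i h ** x)) ->
  (forall e x, P x -> P (t e ** x)) -> forall x, P x.
Proof.
  intros P1 Pi Pt. apply (pushout_ind _ _ i j Hpo P P1 Pi).
  intros [c e] x Hx. rewrite ext_pair, mulA'. auto.
Qed.

#[local] Opaque ZnGroup.

(** ** Reduced forms *)

Fixpoint nval (L : list (H * ZnGroup d)) (h : H) : G :=
  match L with [] => i h | p :: L => i (fst p) ** (t (snd p) ** nval L h) end.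

Definition inner (p : H * ZnGroup d) : Prop := ~ commutes v (fst p) /\ snd p <> gone.

(** Reduced words of the amalgam: the [t e] represent the cosets of [C(v)] in the other factor, so
    besides nontrivial exponents only the base elements between two stable letters are constrained;
    the first and the last are free. *)
Definition reduced (L : list (H * ZnGroup d)) : Prop :=
  match L with [] => True | p :: L => snd p <> gone /\ Forall inner L end.

Lemma inner_reduced L : Forall inner L -> reduced L.
Proof. intros HL. destruct HL as [|p L Hp HL]; simpl; [trivial|]. split; [apply Hp|assumption]. Qed.

Lemma val_app L L' h : nval (L ++ L') h = nval L gone ** nval L' h.
Proof.
  induction L as [|p L IH]; cbn [nval app]; [now rewrite hom_one, gmul1l|].
  now rewrite IH, !mulA'.
Qed.

Section Cost.
Context (lH : H -> Z) (HlH : is_length lH) (lE : ZnGroup d -> Z) (HlE : is_length lE).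

Fixpoint cost (L : list (H * ZnGroup d)) (h : H) : Z :=
  match L with [] => lH h | p :: L => lH (fst p) + lE (snd p) + cost L h end.

Lemma cost_ge0 L h : 0 <= cost L h.
Proof.
  induction L as [|p L IH]; simpl; [apply (len_ge0 HlH)|].
  assert (E1 := len_ge0 HlH (fst p)). assert (E2 := len_ge0 HlE (snd p)). lia.
Qed.

Lemma reduced_mul_base x L h : reduced L -> exists L' h', reduced L' /\
  nval L' h' = i x ** nval L h /\ cost L' h' <= lH x + cost L h /\ length L' = length L.
Proof.
  intros HL. destruct L as [|[s e] L].
  - exists [], (x ** h). simpl. rewrite hmorph. repeat split. apply (len_mul HlH).
  - exists ((x ** s, e) :: L), h. simpl in *. rewrite hmorph, mulA'.
    assert (E := len_mul HlH x s). repeat split; try tauto. lia.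
Qed.

(** A head [s] in [C(v)] slides to the left of [t e], and the two exponents merge. If they cancel,
    [s] is absorbed by the next base element, which is now first and so unconstrained. *)
Lemma reduced_mul_stable e L h : reduced L -> exists L' h', reduced L' /\
  nval L' h' = t e ** nval L h /\ cost L' h' <= lE e + cost L h.
Proof.
  intros HL. assert (He0 := len_ge0 HlE e).
  destruct (classic (e = gone)) as [->|He].
  { exists L, h. rewrite stable_one, gmul1l. repeat split; [assumption|lia]. }
  assert (Hcons : Forall inner L -> exists L' h', reduced L' /\
    nval L' h' = t e ** nval L h /\ cost L' h' <= lE e + cost L h).
  { intros Hin. exists ((gone, e) :: L), h. simpl. rewrite hom_one, gmul1l, (len_one HlH).
    repeat split; [assumption..|lia]. }
  destruct L as [|[s e'] L]; [apply Hcons; constructor|].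
  simpl in HL. destruct HL as [He' HL].
  destruct (classic (commutes v s)) as [Hs|Hs]; [|apply Hcons; now constructor].
  assert (E : t e ** nval ((s, e') :: L) h = i s ** (t (e ** e') ** nval L h)).
  { simpl. rewrite stable_mul, gmulA, stable_comm by assumption. now rewrite !mulA'. }
  rewrite E. destruct (classic (e ** e' = gone)) as [E0|E0].
  - rewrite E0, stable_one, gmul1l.
    destruct (reduced_mul_base s L h (inner_reduced L HL)) as [L' [h' [H1 [H2 [H3 _]]]]].
    exists L', h'. simpl. assert (F := len_ge0 HlE e'). repeat split; [assumption..|lia].
  - exists ((s, e ** e') :: L), h. simpl. assert (F := len_mul HlE e e').
    repeat split; [assumption..|lia].
Qed.
End Cost.

Lemma zero_length {K : Group} : is_length (fun _ : K => 0).
Proof. constructor; intros; lia. Qed.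

Lemma reduced_exists g : exists L h, reduced L /\ nval L h = g.
Proof.
  revert g. apply ext_ind.
  - exists [], gone. split; [exact Logic.I|apply hom_one].
  - intros x g [L [h [HL <-]]].
    destruct (reduced_mul_base _ zero_length (fun _ => 0) x L h HL) as [L' [h' Hx]].
    exists L', h'. tauto.
  - intros e g [L [h [HL <-]]].
    destruct (reduced_mul_stable _ zero_length _ zero_length e L h HL) as [L' [h' Hx]].
    exists L', h'. tauto.
Qed.

Definition ext_gens (Y : list H) : list G := map i Y ++ map t (Zn_basis d).

Lemma ext_gens_generates Y : generates Y -> generates (ext_gens Y).
Proof.
  intros HY.
  assert (Hsub : forall (K : Group) (f : hom K G) (X : list K), generates X ->
    (forall x, In x X -> In (f x) (ext_gens Y)) ->
    forall x, exists n, wlen_le (ext_gens Y) (f x) n).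
  { intros K f X HX Hin x. destruct (HX x) as [n [w [Hw [_ <-]]]]. clear n.
    induction w as [|[y b] w IH].
    - exists 0%nat. simpl. rewrite hom_one. apply wlen_le_one.
    - destruct IH as [n IH]; [intros p Hp; apply Hw; now right|].
      exists (1 + n)%nat. cbn [word_val fold_right]. rewrite hmorph. apply wlen_le_mul; [|assumption].
      assert (Hy : In y X) by (apply (Hw (y, b)); now left).
      assert (E := wlen_le_letter _ (f y) b (Hin y Hy)).
      destruct b; unfold letter_val in *; simpl in *; rewrite ?hom_inv; exact E. }
  intros g. revert g. apply ext_ind.
  - exists 0%nat. apply wlen_le_one.
  - intros h x [n Hn]. destruct (Hsub H i Y HY) with (x := h) as [m Hm].
    + intros y Hy. apply in_or_app. left. now apply in_map.
    + exists (m + n)%nat. now apply wlen_le_mul.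
  - intros e x [n Hn].
    destruct (Hsub _ (@Build_hom (ZnGroup d) G t stable_mul) _ (Zn_basis_generates d))
      with (x := e) as [m Hm].
    + intros y Hy. apply in_or_app. right. now apply in_map.
    + exists (m + n)%nat. now apply wlen_le_mul.
Qed.

(** Each letter multiplied on the left adds at most 1 to the total length of the syllables, since
    reductions only merge them. All syllables of an element of the ball of radius [R] are thus
    bounded by [R] itself. *)
Lemma reduced_cost Y g : generates Y -> exists L h, reduced L /\ nval L h = g /\
  cost (wlen Y) (wlen (Zn_basis d)) L h <= wlen (ext_gens Y) g.
Proof.
  intros HY. assert (HG := ext_gens_generates Y HY).
  assert (Hg := len_ge0 (wlen_is_length _ HG) g).
  rewrite <- (Z2Nat.id (wlen (ext_gens Y) g)) by assumption.
  assert (HlH := wlen_is_length Y HY).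
  assert (HlE := wlen_is_length _ (Zn_basis_generates d)).
  apply (wlen_le_ind (ext_gens Y) HG (fun n g => exists L h, reduced L /\ nval L h = g /\
    cost (wlen Y) (wlen (Zn_basis d)) L h <= Z.of_nat n)).
  - exists [], gone. simpl. rewrite hom_one, (len_one HlH). repeat split; lia.
  - clear g Hg. intros n x b g Hx [L [h [HL [<- Hc]]]].
    apply in_app_or in Hx. destruct Hx as [Hx|Hx]; apply in_map_iff in Hx;
      destruct Hx as [y [<- Hy]].
    + destruct (reduced_mul_base _ HlH (wlen (Zn_basis d)) (letter_val (y, b)) L h HL)
        as [L' [h' [H1 [H2 [H3 _]]]]].
      exists L', h'. split; [assumption|]. split.
      * rewrite H2. f_equal. destruct b; unfold letter_val; simpl; now rewrite ?hom_inv.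
      * assert (E : wlen Y (letter_val (y, b)) <= 1).
        { destruct b; unfold letter_val; simpl; rewrite ?(len_inv HlH); now apply wlen_gen. }
        lia.
    + destruct (reduced_mul_stable _ HlH _ HlE (letter_val (y, b)) L h HL)
        as [L' [h' [H1 [H2 H3]]]].
      exists L', h'. split; [assumption|]. split.
      * rewrite H2. f_equal. destruct b; unfold letter_val; cbn [fst snd];
          now rewrite ?stable_inv.
      * assert (E : wlen (Zn_basis d) (letter_val (y, b)) <= 1).
        { destruct b; unfold letter_val; cbn [fst snd]; rewrite ?(len_inv HlE);
            apply wlen_gen; auto using Zn_basis_generates. }
        lia.
Qed.

(** The extra [f] covers two uses: a homomorphism to [Gamma] for normal forms, and the identity for
    the discriminating retraction. *)
Lemma retraction_alt {K : Group} (f : hom H K) (l : K -> Z) B r N R e L h :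
  is_retraction B r ->
  N <= Z.abs (dot B d e) -> l (f h) <= R ->
  (forall p, In p L -> N <= Z.abs (dot B d (snd p)) /\ l (f (fst p)) <= R /\
                       ~ commutes (f v) (f (fst p))) ->
  alt (f v) l N R (f (r (t e ** nval L h))).
Proof.
  intros [Hi Ht] He Hh. revert e He.
  induction L as [|p L IH]; intros e He HL; simpl nval.
  - rewrite !hmorph, Ht, Hi, hom_gpowZ. now apply alt_one.
  - destruct (HL p) as [H1 [H2 H3]]; [now left|].
    rewrite hmorph, hmorph, Ht, hmorph, Hi, hmorph, hom_gpowZ.
    apply alt_cons; [assumption..|]. apply IH; [assumption|].
    intros q Hq. apply HL. now right.
Qed.

Lemma Zn_bounded (e : ZnGroup d) : exists b, forall k, Z.abs (e k) < b.
Proof.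
  exists (wlen (Zn_basis d) e + 1). intros k. assert (E := coord_le_wlen d e k). lia.
Qed.

Context (Gamma : Group) (HG : has_big_powers Gamma) (Hres : fully_residually H Gamma).
Context (Hv : v <> gone).

(** A homomorphism [f] that keeps [v] and its commutators with the inner base elements nontrivial
    turns the retracted reduced form into an alternating product around [f v]. *)
Lemma retraction_neq_one L h : reduced L -> (L = [] -> h <> gone) ->
  exists N, forall B r, N <= B -> is_retraction B r -> r (nval L h) <> gone.
Proof.
  intros HL Hne. destruct L as [|[s e] L].
  { exists 0. intros B r _ [Hi _]. simpl. rewrite Hi. now apply Hne. }
  simpl in HL. destruct HL as [He HL].
  destruct (Hres (v :: map (fun p => commutator v (fst p)) L)) as [f Hf].
  { intros x [<-|Hx]; [assumption|]. apply in_map_iff in Hx. destruct Hx as [p [<- Hp]].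
    rewrite commutator_eq_one. rewrite Forall_forall in HL. apply (HL p Hp). }
  destruct (HG (f v)) as [l [Hl [K [HK HBP]]]]; [apply Hf; now left|].
  destruct (list_bound (fun x => l (f x)) (s :: h :: map fst L)) as [R [HR HRb]].
  assert (HbE : exists b, forall e', In e' (e :: map snd L) -> forall k, Z.abs (e' k) < b).
  { clear. induction (e :: map snd L) as [|a M [b Hb]].
    - exists 0. intros _ [].
    - destruct (Zn_bounded a) as [b' Hb']. exists (Z.max b b').
      intros e' [<-|He'] k; [specialize (Hb' k)|specialize (Hb e' He' k)]; lia. }
  destruct HbE as [b Hb].
  exists (Z.max b (K * (1 + R))). intros B r HB Hr E.
  assert (Hdot : forall e', In e' (e :: map snd L) -> e' <> gone ->
            K * (1 + R) <= Z.abs (dot B d e')).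
  { intros e' He' Hne'. assert (F : B <= Z.abs (dot B d e')); [|lia].
    apply dot_large; [assumption|]. intros k. specialize (Hb e' He' k). lia. }
  apply (HBP R (f (r (t e ** nval L h))) (f s)); [assumption| | |].
  - apply (retraction_alt f l B); [assumption| | |].
    + apply Hdot; [now left|assumption].
    + apply (HRb h). right. now left.
    + intros p Hp. rewrite Forall_forall in HL. destruct (HL p Hp) as [Hc He']. repeat split.
      * apply Hdot; [right; now apply in_map|assumption].
      * apply (HRb (fst p)). right. right. now apply in_map.
      * intros Hcf. apply (Hf (commutator v (fst p))).
        { right. apply in_map_iff. now exists p. }
        now rewrite hom_commutator, commutator_eq_one.
  - apply (HRb s). now left.
  - assert (E2 : f (r (nval ((s, e) :: L) h)) = gone) by now rewrite E, hom_one.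
    simpl in E2. rewrite hmorph, hmorph, (proj1 Hr) in E2. exact E2.
Qed.
End Extension.

Arguments stable {H G v d} j e.
Arguments nval {H G v d} i j L h.
Arguments inner {H} v {d} p.
Arguments reduced {H} v {d} L.
Arguments cost {H d} lH lE L h.
Arguments is_retraction {H G v d} i j B r.
Arguments ext_gens {H G v d} i j Y.
Arguments reduced_mul_base {H G v d} i j {lH} HlH lE x L h _.
Arguments reduced_exists {H G v d i j} Hpo g.
Arguments stable_comm {H G v d i j} Hpo c e _.
Arguments reduced_cost {H G v d i j} Hpo {Y} g _.
Arguments base_inj {H G v d i j} Hpo x y _.
Arguments retraction_exists {H G v d i j} Hpo B.
Arguments ext_gens_generates {H G v d i j} Hpo {Y} _.

(** * Canonical forms and the length function of the Bass-Serre tree *)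

Section NormalForms.
Context {H G : Group} {v : H} {d : nat} {i : hom H G} {j : hom (ExtA H v d) G}.
Context (Hpo : is_pushout (cent_incl H v) (extA_incl H v d) i j).
Context (Hnf : forall p L h, reduced v (p :: L) -> nval i j (p :: L) h <> gone).
Notation t := (stable j).
Notation val := (nval i j).
Notation reduced := (@reduced H v d).
Notation inner := (@inner H v d).

Lemma commutes_inv_l x : ~ commutes v x -> ~ commutes v (x^-1).
Proof. intros Hx E. now apply Hx, commutes_inv_iff. Qed.

Lemma val_mul_base L h x : val L h ** i x = val L (h ** x).
Proof.
  induction L as [|p L IH]; cbn [nval]; [now rewrite hmorph|].
  now rewrite !mulA', IH.
Qed.

Lemma val_mul_cons L h s e L' h' :
  val L h ** val ((s, e) :: L') h' = val (L ++ (h ** s, e) :: L') h'.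
Proof.
  induction L as [|p L IH]; cbn [nval app fst snd]; [now rewrite hmorph, mulA'|].
  rewrite <- IH. cbn [nval fst snd]. now rewrite !mulA'.
Qed.

Lemma val_base_mul x s e L h : i x ** val ((s, e) :: L) h = val ((x ** s, e) :: L) h.
Proof. exact (val_mul_cons [] x s e L h). Qed.

Lemma reduced_not_base p L h x : reduced (p :: L) -> val (p :: L) h <> i x.
Proof.
  intros HL E. apply (Hnf p L (h ** x^-1) HL).
  rewrite <- val_mul_base, E, <- hmorph, gmulVr. apply hom_one.
Qed.

Definition heads_differ (L L' : list (H * ZnGroup d)) : Prop :=
  match L, L' with
  | p :: _, p' :: _ => ~ commutes v ((fst p)^-1 ** fst p')
  | _, _ => True
  end.

(** The inverse of the first syllable of [L] is moved to the front of [L'], which then starts with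
    trivial base element; the next syllable of [L] is outside [C(v)], so the heads differ again. *)
Lemma reduced_inv_mul L : forall h L' h', reduced L -> reduced L' -> heads_differ L L' ->
  exists L'' h'', reduced L'' /\ val L'' h'' = (val L h)^-1 ** val L' h' /\
  length L'' = (length L + length L')%nat.
Proof.
  induction L as [|[s e] L IH]; intros h L' h' HL HL' Hd.
  - destruct (reduced_mul_base i j zero_length (fun _ => 0) (h^-1) L' h' HL')
      as [L'' [h'' [H1 [H2 [_ H3]]]]].
    exists L'', h''. rewrite H2, hom_inv. auto.
  - destruct HL as [He HL]. cbn [snd] in He.
    assert (He' : e^-1 <> gone) by (intros E; now apply He, inv_eq_one).
    assert (Hy : exists L1 h1, reduced ((gone, e^-1) :: L1) /\ length L1 = length L' /\
      val ((gone, e^-1) :: L1) h1 = (t e)^-1 ** ((i s)^-1 ** val L' h')).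
    { destruct L' as [|[s' e'] L'].
      - exists [], (s^-1 ** h'). split; [split; [assumption|constructor]|].
        split; [reflexivity|]. cbn [nval fst snd].
        now rewrite hom_one, gmul1l, stable_inv, hmorph, hom_inv.
      - exists ((s^-1 ** s', e') :: L'), h'. destruct HL' as [He1 HL'].
        split; [split; [assumption|constructor; [split; assumption|assumption]]|].
        split; [reflexivity|]. cbn [nval fst snd].
        now rewrite hom_one, gmul1l, stable_inv, hmorph, hom_inv, mulA'. }
    destruct Hy as [L1 [h1 [HL1 [Hlen E1]]]].
    destruct (IH h ((gone, e^-1) :: L1) h1) as [L'' [h'' [H1 [H2 H3]]]].
    + now apply inner_reduced.
    + assumption.
    + destruct HL as [|[s2 e2] L [Hs2 _] _]; [exact Logic.I|]. cbn.
      rewrite gmul1r. now apply commutes_inv_l.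
    + exists L'', h''. split; [assumption|]. split.
      * rewrite H2, E1. cbn [nval fst snd]. now rewrite !inv_mul, !mulA'.
      * rewrite H3. cbn [length]. lia.
Qed.

(** A representative of the coset [h C(v)], constant on cosets by extensionality. *)
Definition crep (h : H) : H := epsilon (inhabits gone) (fun r => commutes v (r^-1 ** h)).

Lemma crep_spec h : commutes v ((crep h)^-1 ** h).
Proof.
  apply (epsilon_spec (inhabits gone) (fun r => commutes v (r^-1 ** h))).
  exists h. rewrite gmulVl. apply cent_one.
Qed.

Lemma crep_eq h h' : commutes v (h^-1 ** h') -> crep h = crep h'.
Proof.
  intros Hc. unfold crep. f_equal. apply functional_extensionality. intros r.
  apply propositional_extensionality. split; intros Hr.
  - replace (r^-1 ** h') with ((r^-1 ** h) ** (h^-1 ** h')) by now gsimp.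
    now apply cent_mul.
  - replace (r^-1 ** h) with ((r^-1 ** h') ** (h^-1 ** h')^-1) by now gsimp.
    apply cent_mul; [assumption|now apply cent_inv].
Qed.

Lemma crep_crep h : crep (crep h) = crep h.
Proof. apply crep_eq, crep_spec. Qed.

Definition canonical (L : list (H * ZnGroup d)) : Prop :=
  Forall (fun p => crep (fst p) = fst p) L.

Lemma val_crep s e L h : val ((s, e) :: L) h =
  i (crep s) ** (t e ** (i ((crep s)^-1 ** s) ** val L h)).
Proof.
  cbn [nval fst snd]. rewrite (gmulA (t e)), (stable_comm Hpo) by apply crep_spec.
  rewrite !gmulA, <- hmorph, mulKr. reflexivity.
Qed.

(** Replacing a base element by its representative leaves a factor in [C(v)], which passes the
    stable letter and is handed on to the next syllable as [z]. *)
Lemma inner_canonical L : forall z h, Forall inner L -> commutes v z ->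
  exists L' h', Forall inner L' /\ canonical L' /\ val L' h' = i z ** val L h /\
  length L' = length L.
Proof.
  induction L as [|[s e] L IH]; intros z h HL Hz.
  - exists [], (z ** h). repeat split; try constructor. apply hmorph.
  - inversion HL as [|p L0 [Hs He] HL1]. subst.
    destruct (IH ((crep (z ** s))^-1 ** (z ** s)) h HL1 (crep_spec _))
      as [L' [h' [H1 [H2 [H3 H4]]]]].
    exists ((crep (z ** s), e) :: L'), h'. repeat split.
    + constructor; [|assumption]. split; [|assumption]. cbn [fst] in *. intros Hc. apply Hs.
      replace s with (z^-1 ** (crep (z ** s) ** ((crep (z ** s))^-1 ** (z ** s))))
        by now gsimp.
      apply cent_mul; [now apply cent_inv|]. apply cent_mul; [assumption|apply crep_spec].
    + constructor; [|assumption]. apply crep_crep.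
    + rewrite val_base_mul, (val_crep (z ** s)), <- H3. reflexivity.
    + cbn [length]. now rewrite H4.
Qed.

Lemma reduced_canonical L h : reduced L ->
  exists L' h', reduced L' /\ canonical L' /\ val L' h' = val L h /\ length L' = length L.
Proof.
  intros HL. destruct L as [|[s e] L].
  - exists [], h. repeat split; constructor.
  - destruct HL as [He HL].
    destruct (inner_canonical L ((crep s)^-1 ** s) h HL (crep_spec _))
      as [L' [h' [H1 [H2 [H3 H4]]]]].
    exists ((crep s, e) :: L'), h'. repeat split; [assumption..| | |].
    + constructor; [apply crep_crep|assumption].
    + rewrite (val_crep s), <- H3. reflexivity.
    + cbn [length]. now rewrite H4.
Qed.

(* s and e are counted separately, as each of them crosses one edge of the Bass-Serre tree:
   this is the distance from the base vertex to the branching point. *)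
Fixpoint prefix (L L' : list (H * ZnGroup d)) : Z :=
  match L, L' with
  | p :: L, p' :: L' =>
      if excluded_middle_informative (fst p = fst p') then
        if excluded_middle_informative (snd p = snd p') then 2 + prefix L L' else 1
      else 0
  | _, _ => 0
  end.

Lemma prefix_bounds L L' : 0 <= prefix L L' /\ prefix L L' <= 2 * Z.of_nat (length L) /\
  prefix L L' <= 2 * Z.of_nat (length L').
Proof.
  revert L'. induction L as [|p L IH]; intros [|p' L']; cbn [prefix length]; try lia.
  destruct (excluded_middle_informative (fst p = fst p')); [|lia].
  destruct (excluded_middle_informative (snd p = snd p')); [|lia].
  specialize (IH L'). lia.
Qed.

Lemma prefix_sym L L' : prefix L L' = prefix L' L.
Proof.
  revert L'. induction L as [|p L IH]; intros [|p' L']; cbn [prefix]; try reflexivity.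
  destruct (excluded_middle_informative (fst p = fst p'));
  destruct (excluded_middle_informative (fst p' = fst p)); try congruence.
  destruct (excluded_middle_informative (snd p = snd p'));
  destruct (excluded_middle_informative (snd p' = snd p)); try congruence.
Qed.

Lemma prefix_ultrametric L1 L2 L3 :
  Z.min (prefix L1 L2) (prefix L2 L3) <= prefix L1 L3.
Proof.
  revert L2 L3. induction L1 as [|p1 L1 IH]; intros L2 L3.
  { cbn [prefix]. assert (E := prefix_bounds L2 L3). lia. }
  destruct L2 as [|p2 L2].
  { assert (E := prefix_bounds (p1 :: L1) L3). cbn [prefix] in *. lia. }
  destruct L3 as [|p3 L3].
  { assert (E := prefix_bounds (p1 :: L1) (p2 :: L2)). cbn [prefix] in *. lia. }
  cbn [prefix]. specialize (IH L2 L3).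
  assert (E1 := prefix_bounds L1 L2). assert (E2 := prefix_bounds L2 L3).
  assert (E3 := prefix_bounds L1 L3).
  destruct (excluded_middle_informative (fst p1 = fst p2));
  destruct (excluded_middle_informative (fst p2 = fst p3));
  destruct (excluded_middle_informative (fst p1 = fst p3)); try congruence;
  destruct (excluded_middle_informative (snd p1 = snd p2));
  destruct (excluded_middle_informative (snd p2 = snd p3));
  destruct (excluded_middle_informative (snd p1 = snd p3)); try congruence; lia.
Qed.

(** Common syllables cancel in pairs. At the first difference, equal base elements with different
    exponents leave one merged syllable, a loss of 1, while different canonical base elements lie in
    different cosets and nothing is lost. *)
Lemma canonical_inv_mul L : forall h L' h', reduced L -> reduced L' ->
  canonical L -> canonical L' ->
  exists L'' h'', reduced L'' /\ val L'' h'' = (val L h)^-1 ** val L' h' /\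
  Z.of_nat (length L'') = Z.of_nat (length L) + Z.of_nat (length L') - prefix L L'.
Proof.
  assert (Hgen : forall L h L' h', reduced L -> reduced L' -> heads_differ L L' ->
    exists L'' h'', reduced L'' /\ val L'' h'' = (val L h)^-1 ** val L' h' /\
    Z.of_nat (length L'') = Z.of_nat (length L) + Z.of_nat (length L') - 0).
  { intros L0 h L' h' HL HL' Hd.
    destruct (reduced_inv_mul L0 h L' h' HL HL' Hd) as [L'' [h'' [H1 [H2 H3]]]].
    exists L'', h''. repeat split; [assumption..|lia]. }
  induction L as [|[s e] L IH]; intros h L' h' HL HL' Hc Hc'.
  { apply Hgen; [assumption..|exact Logic.I]. }
  destruct L' as [|[s' e'] L']; [apply Hgen; [assumption..|exact Logic.I]|].
  inversion Hc as [|p0 L0 Cs CL]. inversion Hc' as [|p0' L0' Cs' CL']. subst.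
  cbn [prefix fst snd] in *.
  destruct (excluded_middle_informative (s = s')) as [->|Hs].
  - destruct HL as [He HL]. destruct HL' as [He' HL']. cbn [snd] in *.
    destruct (excluded_middle_informative (e = e')) as [->|Hee].
    + destruct (IH h L' h' (inner_reduced v d L HL) (inner_reduced v d L' HL') CL CL')
        as [L'' [h'' [H1 [H2 H3]]]].
      exists L'', h''. split; [assumption|]. split.
      * rewrite H2. cbn [nval fst snd]. now gsimp.
      * cbn [length]. lia.
    + destruct (reduced_inv_mul L h ((gone, e^-1 ** e') :: L') h')
        as [L'' [h'' [H1 [H2 H3]]]].
      * now apply inner_reduced.
      * split; [|assumption]. cbn [snd]. intros E. now apply Hee, mul_inv_one_eq.
      * destruct HL as [|[s2 e2] L [Hs2 _] _]; [exact Logic.I|]. cbn.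
        rewrite gmul1r. now apply commutes_inv_l.
      * exists L'', h''. split; [assumption|]. split.
        -- rewrite H2. cbn [nval fst snd].
           rewrite hom_one, stable_mul, stable_inv. now gsimp.
        -- rewrite H3. cbn [length]. lia.
  - apply Hgen; [assumption..|]. cbn. intros Hcom. apply Hs.
    rewrite <- Cs, <- Cs'. now apply crep_eq.
Qed.

(** The final base element is dropped: the list describes the vertex [gH]. *)
Definition nform (g : G) : list (H * ZnGroup d) :=
  epsilon (inhabits []) (fun L => reduced L /\ canonical L /\ exists h, val L h = g).

Lemma nform_spec g : reduced (nform g) /\ canonical (nform g) /\ exists h, val (nform g) h = g.
Proof.
  apply (epsilon_spec (inhabits [])
    (fun L => reduced L /\ canonical L /\ exists h, val L h = g)).
  destruct (reduced_exists Hpo g) as [L [h [HL <-]]].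
  destruct (reduced_canonical L h HL) as [L' [h' [H1 [H2 [H3 _]]]]].
  exists L'. repeat split; [assumption..|]. now exists h'.
Qed.

(* Half the distance from H to gH in the Bass-Serre tree. *)
Definition tree_len (g : G) : Z := Z.of_nat (length (nform g)).

(** For two canonical forms of one element the quotient is 1, so its reduced form is empty and the
    prefix equals the sum of the lengths. Being at most twice either length, it forces them to
    agree. *)
Lemma tree_len_reduced L h : reduced L -> tree_len (val L h) = Z.of_nat (length L).
Proof.
  intros HL. unfold tree_len.
  destruct (reduced_canonical L h HL) as [L1 [h1 [H1 [H2 [H3 <-]]]]]. rewrite <- H3.
  destruct (nform_spec (val L1 h1)) as [N1 [N2 [h2 N3]]].
  set (L2 := nform (val L1 h1)) in *.
  destruct (canonical_inv_mul L1 h1 L2 h2) as [L'' [h'' [F1 [F2 F3]]]]; [assumption..|].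
  rewrite N3, gmulVl in F2. destruct L'' as [|p L''].
  - cbn [length] in F3. assert (E := prefix_bounds L1 L2). lia.
  - exfalso. exact (Hnf p L'' h'' F1 F2).
Qed.

Lemma tree_len_inv_mul x y :
  tree_len (x^-1 ** y) = tree_len x + tree_len y - prefix (nform x) (nform y).
Proof.
  destruct (nform_spec x) as [X1 [X2 [hx X3]]].
  destruct (nform_spec y) as [Y1 [Y2 [hy Y3]]].
  destruct (canonical_inv_mul (nform x) hx (nform y) hy) as [L [h [F1 [F2 F3]]]];
    [assumption..|].
  rewrite X3, Y3 in F2. rewrite <- F2, tree_len_reduced by assumption. exact F3.
Qed.

Lemma tree_len_base x : tree_len (i x) = 0.
Proof. exact (tree_len_reduced [] x Logic.I). Qed.

Lemma tree_len_eq0 g : tree_len g = 0 -> exists x, g = i x.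
Proof.
  unfold tree_len. intros E. destruct (nform_spec g) as [_ [_ [h Eh]]].
  destruct (nform g); [|discriminate]. exists h. now rewrite <- Eh.
Qed.

Lemma tree_len_is_length : is_length tree_len.
Proof.
  assert (H1 : tree_len gone = 0) by (rewrite <- (hom_one i); apply tree_len_base).
  assert (Hinv : forall x, tree_len (x^-1) = tree_len x).
  { intros x. assert (E := tree_len_inv_mul x gone). rewrite gmul1r, H1 in E.
    assert (F := prefix_bounds (nform x) (nform gone)). unfold tree_len in H1. lia. }
  constructor; [assumption..|]. intros x y. assert (E := tree_len_inv_mul (x^-1) y).
  rewrite inv_inv, Hinv in E. assert (F := prefix_bounds (nform (x^-1)) (nform y)). lia.
Qed.

Lemma tree_len_four_point : four_point tree_len 0.
Proof.
  intros x y z w.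
  assert (Hd : forall a b, tree_len (a^-1 ** b) = tree_len (w^-1 ** a) +
    tree_len (w^-1 ** b) - prefix (nform (w^-1 ** a)) (nform (w^-1 ** b))).
  { intros a b. rewrite <- tree_len_inv_mul. f_equal. now gsimp. }
  assert (Hw : forall a, tree_len (a^-1 ** w) = tree_len (w^-1 ** a)).
  { intros a. rewrite <- (len_inv tree_len_is_length). f_equal. now gsimp. }
  rewrite !Hw, (Hd x y), (Hd x z), (Hd y z).
  assert (E := prefix_ultrametric (nform (w^-1 ** x)) (nform (w^-1 ** z)) (nform (w^-1 ** y))).
  rewrite (prefix_sym (nform (w^-1 ** z)) (nform (w^-1 ** y))) in E. lia.
Qed.
End NormalForms.

(** * Elements acting hyperbolically on the Bass-Serre tree *)

Section CyclicallyReduced.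
Context {H G : Group} {v : H} {d : nat} {i : hom H G} {j : hom (ExtA H v d) G}.
Context (Hpo : is_pushout (cent_incl H v) (extA_incl H v d) i j).
Context (Hnf : forall p L h, reduced v (p :: L) -> nval i j (p :: L) h <> gone).
Context (Hmal : forall z h, z <> gone -> commutes v z -> commutes v (h^-1 ** z ** h) ->
  commutes v h).
Notation t := (stable j).
Notation val := (nval i j).
Notation reduced := (@reduced H v d).
Notation inner := (@inner H v d).
Notation tree_len := (@tree_len H G v d i j).
Notation dist := (gdist tree_len).

Context (L : list (H * ZnGroup d)) (HL : Forall inner L) (Hne : L <> []).
Let u := val L gone.
Let r := Z.of_nat (length L).

Lemma cyc_len_pos : 1 <= r.
Proof. unfold r. destruct L; [congruence|cbn [length]; lia]. Qed.

Lemma cyc_pow n : exists L', Forall inner L' /\ val L' gone = gpow u n /\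
  length L' = (n * length L)%nat.
Proof.
  induction n as [|n [L' [H1 [H2 H3]]]].
  - exists []. repeat split; [constructor|]. apply hom_one.
  - exists (L ++ L'). repeat split.
    + now apply Forall_app.
    + rewrite val_app, H2. reflexivity.
    + rewrite length_app, H3. reflexivity.
Qed.

Lemma tree_len_cyc_pow m : tree_len (u ^^ m) = Z.abs m * r.
Proof.
  assert (Hn : forall n, tree_len (gpow u n) = Z.of_nat n * r).
  { intros n. destruct (cyc_pow n) as [L' [H1 [H2 H3]]]. rewrite <- H2.
    rewrite (tree_len_reduced Hpo Hnf) by now apply inner_reduced.
    rewrite H3. unfold r. lia. }
  destruct m as [|p|p].
  - exact (Hn 0%nat).
  - simpl gpowZ. rewrite Hn, positive_nat_Z. reflexivity.
  - simpl gpowZ. rewrite (len_inv (tree_len_is_length Hpo Hnf)), Hn, positive_nat_Z.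
    reflexivity.
Qed.

Lemma cyc_loxodromic : loxodromic tree_len u.
Proof.
  assert (Hr := cyc_len_pos). exists 0, 1. repeat split; try lia.
  - intros a b Ha Hb. rewrite !tree_len_cyc_pow, !Z.abs_eq by lia. lia.
  - intros m. rewrite tree_len_cyc_pow. nia.
Qed.

(** Otherwise the heads [s] and [z s] lie in different cosets, and nothing cancels in the
    conjugate. *)
Lemma conj_base_len_pos s e L' z : Forall inner ((s, e) :: L') ->
  tree_len ((val ((s, e) :: L') gone)^-1 ** (i z ** val ((s, e) :: L') gone)) = 0 ->
  commutes v (s^-1 ** z ** s).
Proof.
  intros Hin E. apply NNPP. intros Hc. rewrite val_base_mul in E.
  inversion Hin as [|p M [Hs He] HM]. subst.
  destruct (@reduced_inv_mul H G v d i j ((s, e) :: L') gone ((z ** s, e) :: L') gone)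
    as [L'' [h'' [H1 [H2 H3]]]].
  - now apply inner_reduced.
  - split; assumption.
  - cbn. now rewrite gmulA.
  - rewrite <- H2, (tree_len_reduced Hpo Hnf), H3 in E by assumption.
    cbn [length] in E. lia.
Qed.

(* Edge stabilizers are conjugates of C(v), so malnormality makes the stabilizer of two
   consecutive edge pairs on the axis trivial. *)
Lemma cyc_stabilizer g : tree_len g = 0 -> tree_len ((u ^^ 2)^-1 ** (g ** u ^^ 2)) = 0 ->
  g = gone.
Proof.
  intros E0 E. destruct (tree_len_eq0 Hpo g E0) as [x ->].
  assert (Hu2 : exists s1 e1 s2 e2 L', Forall inner ((s1, e1) :: (s2, e2) :: L') /\
            u ^^ 2 = val ((s1, e1) :: (s2, e2) :: L') gone).
  { assert (Hu : u ^^ 2 = val (L ++ L) gone).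
    { rewrite val_app. change 2 with (1 + 1). rewrite gpowZ_add, gpowZ_1. reflexivity. }
    assert (HLL : Forall inner (L ++ L)) by now apply Forall_app.
    assert (Hlen := length_app L L). assert (Hr := cyc_len_pos). unfold r in Hr.
    destruct (L ++ L) as [|[s1 e1] [|[s2 e2] L']]; cbn [length] in Hlen; try lia.
    exists s1, e1, s2, e2, L'. split; assumption. }
  destruct Hu2 as [s1 [e1 [s2 [e2 [L' [Hin Eu]]]]]]. rewrite Eu in E.
  assert (Hz := conj_base_len_pos _ _ _ _ Hin E). set (z := s1^-1 ** x ** s1) in *.
  inversion Hin as [|p M _ Hin2]. subst.
  assert (Hz2 : commutes v (s2^-1 ** z ** s2)).
  { apply (conj_base_len_pos _ _ _ _ Hin2). rewrite <- E. f_equal.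
    set (M := (s2, e2) :: L').
    change (val ((s1, e1) :: M) gone) with (i s1 ** (t e1 ** val M gone)).
    assert (Ex : i x ** i s1 = i s1 ** i z).
    { rewrite <- !hmorph. f_equal. unfold z. now gsimp. }
    rewrite (gmulA (i x)), Ex, mulA', (gmulA (i z)), <- (stable_comm Hpo) by assumption.
    now gsimp. }
  inversion Hin2 as [|p M [Hs2 _] _]. subst.
  destruct (classic (z = gone)) as [Ez|Ez].
  - assert (Ex : x = s1 ** z ** s1^-1) by (unfold z; now gsimp).
    rewrite Ex, Ez. gsimp. apply hom_one.
  - exfalso. exact (Hs2 (Hmal z s2 Ez Hz Hz2)).
Qed.

(** In the tree, the segment from [g] to [g u^M'] coincides with the one from 1 to [u^M] away from
    the ends. The sign condition puts [g u^k'] on the side of [g u^M'], and the bounds on [k'] put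
    it past the first end and before the second. *)
Lemma cyc_geodesic g M M' k : 0 <= k -> tree_len g < k -> 3 * k <= M ->
  dist (u ^^ M) (g ** u ^^ M') < k ->
  forall k', Z.abs k' <= k -> 0 <= k' * M' -> tree_len g < Z.abs k' ->
  tree_len (g ** u ^^ k') + dist (g ** u ^^ k') (u ^^ M) = tree_len (u ^^ M) /\
  tree_len (g ** u ^^ k') <= k * r + k.
Proof.
  intros Hk Hg HM HM' k' Hk' Hs Hgk.
  assert (Hl := tree_len_is_length Hpo Hnf).
  assert (H4 := tree_len_four_point Hpo Hnf).
  assert (Hr := cyc_len_pos).
  set (y := g ** u ^^ k'). set (a := g ** u ^^ M') in *. set (b := u ^^ M) in *.
  assert (Eb : tree_len b = M * r) by (unfold b; rewrite tree_len_cyc_pow; lia).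
  assert (Ega : dist g a = Z.abs M' * r).
  { unfold a. rewrite dist_mul_r. apply tree_len_cyc_pow. }
  assert (Egy : dist g y = Z.abs k' * r).
  { unfold y. rewrite dist_mul_r. apply tree_len_cyc_pow. }
  assert (T1 := dist_tri _ Hl gone g a). assert (T2 := dist_tri _ Hl gone a b).
  assert (T3 := dist_tri _ Hl g gone a). assert (T4 := dist_tri _ Hl gone b a).
  rewrite !(dist_1l tree_len), (dist_1r tree_len Hl) in *.
  rewrite (dist_sym _ Hl a b) in *.
  assert (HM'2 : k <= Z.abs M') by nia.
  assert (Eya : dist y a = (Z.abs M' - Z.abs k') * r).
  { unfold y, a. rewrite dist_left, dist_pow, tree_len_cyc_pow. f_equal. nia. }
  assert (Q1 := dist_4 _ 0 H4 gone y g a). assert (Q2 := dist_4 _ 0 H4 gone a y b).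
  assert (T5 := dist_tri _ Hl gone y g). assert (T6 := dist_tri _ Hl gone g y).
  assert (T7 := dist_tri _ Hl gone y b). assert (T8 := dist_tri _ Hl g gone y).
  rewrite !(dist_1l tree_len), ?(dist_1r tree_len Hl) in *.
  rewrite (dist_sym _ Hl a b), (dist_sym _ Hl y g), (dist_sym _ Hl a y) in *.
  assert (R1 : Z.abs k' <= Z.abs k' * r) by nia.
  assert (R2 : Z.abs k' * r <= k * r) by nia.
  assert (R3 : 3 * (k * r) <= M * r) by nia.
  assert (R4 : k <= k * r) by nia.
  rewrite Z.mul_sub_distr_r in Eya. lia.
Qed.

(** The label of [g] records the direction of the translated axis and the positions of two of its
    points on the segment from 1 to [u^M]. A point of a segment in a tree is determined by its
    distance from 1, so equal labels make [g^-1 g'] fix two vertices of the axis, and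
    [cyc_stabilizer] applies. *)
Lemma cyc_wpd : wpd tree_len u.
Proof.
  intros eps0. assert (Hl := tree_len_is_length Hpo Hnf).
  assert (H4 := tree_len_four_point Hpo Hnf). assert (Hr := cyc_len_pos).
  (* The exponents [eps + 1] and [eps + 3] used below both exceed the length of [g], and their gap
     is the 2 of [cyc_stabilizer]. *)
  set (eps := Z.max eps0 0). set (k := eps + 3). set (M := 3 * k).
  set (pos := fun g => if excluded_middle_informative
    (exists M', 0 <= M' /\ tree_len (u ^^ (- M) ** g ** u ^^ M') <= eps) then 1 else -1).
  set (f := fun g => (pos g, (tree_len (g ** u ^^ (pos g * (eps + 1))),
                              tree_len (g ** u ^^ (pos g * (eps + 3)))))).
  set (range := map Z.of_nat (seq 0 (S (Z.to_nat (k * r + k))))).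
  assert (Hrange : forall x, 0 <= x <= k * r + k -> In x range).
  { intros x Hx. apply in_map_iff. exists (Z.to_nat x). split; [lia|].
    apply in_seq. lia. }
  set (W := fun g => tree_len g <= eps0 /\
              exists M', tree_len (u ^^ (- M) ** g ** u ^^ M') <= eps0).
  assert (Hgeo : forall g k', W g -> eps + 1 <= k' <= eps + 3 ->
    tree_len (g ** u ^^ (pos g * k')) + dist (g ** u ^^ (pos g * k')) (u ^^ M) =
      tree_len (u ^^ M) /\ tree_len (g ** u ^^ (pos g * k')) <= k * r + k).
  { intros g k' [Hg [M1 HM1]] Hk'.
    assert (HM' : exists M', 0 <= pos g * M' /\
              tree_len (u ^^ (- M) ** g ** u ^^ M') <= eps).
    { unfold pos. destruct (excluded_middle_informative _) as [[M' HM']|Hno].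
      - exists M'. lia.
      - exists M1. split; [|lia]. apply Z.nlt_ge. intros Hlt. apply Hno.
        exists M1. lia. }
    destruct HM' as [M' [Hs HM']].
    assert (Hp : pos g = 1 \/ pos g = -1).
    { unfold pos. destruct (excluded_middle_informative _); auto. }
    apply (cyc_geodesic g M M' k); unfold M, k; try lia.
    - unfold gdist. fold k M. rewrite <- gpowZ_opp, gmulA. lia.
    - destruct Hp as [E|E]; rewrite E in Hs |- *; nia. }
  exists M, (Z * (Z * Z))%type, (list_prod [1; -1] (list_prod range range)), f.
  split; [unfold M, k; lia|]. split.
  - intros g Hg. unfold f. apply in_prod; [|apply in_prod].
    + unfold pos. destruct (excluded_middle_informative _); simpl; auto.
    + apply Hrange. split; [apply (len_ge0 Hl)|]. apply Hgeo; [assumption|lia].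
    + apply Hrange. split; [apply (len_ge0 Hl)|]. apply Hgeo; [assumption|lia].
  - intros g g' Hg Hg' E. unfold f in E. injection E as Ep E1 E2.
    assert (Hzero : forall k', eps + 1 <= k' <= eps + 3 ->
      tree_len (g ** u ^^ (pos g * k')) = tree_len (g' ** u ^^ (pos g' * k')) ->
      tree_len ((u ^^ (pos g * k'))^-1 ** ((g^-1 ** g') ** u ^^ (pos g * k'))) = 0).
    { intros k' Hk' Ek. destruct (Hgeo g k' Hg Hk') as [F1 _].
      destruct (Hgeo g' k' Hg' Hk') as [F2 _]. rewrite <- Ep in *.
      set (y := g ** u ^^ (pos g * k')) in *. set (y' := g' ** u ^^ (pos g * k')) in *.
      assert (Q := dist_4 _ 0 H4 y y' gone (u ^^ M)).
      rewrite !(dist_1r tree_len Hl), (dist_1l tree_len) in Q.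
      assert (Q0 := dist_ge0 _ Hl y y').
      transitivity (dist y y'); [|lia].
      unfold gdist, y, y'. f_equal. now gsimp. }
    assert (Z1 := Hzero (eps + 1) ltac:(lia) E1).
    assert (Z2 := Hzero (eps + 3) ltac:(lia) E2).
    assert (Hp : pos g = 1 \/ pos g = -1).
    { unfold pos. destruct (excluded_middle_informative _); auto. }
    apply mul_inv_one_eq.
    assert (Hconj : forall a, (u ^^ a)^-1 ** ((g^-1 ** g') ** u ^^ a) = gone ->
              g^-1 ** g' = gone).
    { intros a Ea. apply mul_cancel_r with (u ^^ a). apply mul_cancel_l with ((u ^^ a)^-1).
      rewrite Ea. now gsimp. }
    assert (Hshift : forall a, (u ^^ (a + 2))^-1 ** ((g^-1 ** g') ** u ^^ (a + 2)) =
      (u ^^ 2)^-1 ** ((u ^^ a)^-1 ** ((g^-1 ** g') ** u ^^ a) ** u ^^ 2)).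
    { intros a. rewrite gpowZ_add. now gsimp. }
    destruct Hp as [Hp|Hp]; rewrite Hp in Z1, Z2.
    + apply (Hconj (1 * (eps + 1))). apply cyc_stabilizer; [assumption|].
      rewrite <- Hshift. replace (1 * (eps + 1) + 2) with (1 * (eps + 3)) by lia. exact Z2.
    + apply (Hconj (-1 * (eps + 3))). apply cyc_stabilizer; [assumption|].
      rewrite <- Hshift. replace (-1 * (eps + 3) + 2) with (-1 * (eps + 1)) by lia. exact Z1.
Qed.

Lemma cyc_big_powers Y : generates Y -> rootable u -> big_powers u (wlen Y).
Proof.
  intros HY Hroot. assert (Hl := tree_len_is_length Hpo Hnf).
  destruct (len_le_wlen Y tree_len HY Hl) as [A [HA HAl]].
  apply big_powers_le with tree_len A; [assumption..|].
  apply (big_powers_of_wpd tree_len Hl 0); [lia|apply (tree_len_four_point Hpo Hnf)|..].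
  - apply cyc_loxodromic.
  - apply cyc_wpd.
  - assumption.
Qed.
End CyclicallyReduced.

(** * Big powers in iterated extensions *)

(** A power relation survives conjugation and pulls back along the inclusion of the base, as the
    induction over the tower requires. Only one exponent has to be nonzero, since [x] or [y] may be
    trivial. *)
Definition rank_one_centralizer {G : Group} (u : G) : Prop :=
  forall x y, commutes u x -> commutes u y ->
  exists a b, (a <> 0 \/ b <> 0) /\ x ^^ a = y ^^ b.

Lemma commutes_conj {G : Group} {u x : G} (p : G) :
  commutes u x -> commutes (p ** u ** p^-1) (p ** x ** p^-1).
Proof.
  unfold commutes. intros E.
  transitivity (p ** (x ** u) ** p^-1); [now gsimp|]. rewrite E. now gsimp.
Qed.

Lemma rank_one_centralizer_conj {G : Group} (u p : G) :
  rank_one_centralizer (p ** u ** p^-1) -> rank_one_centralizer u.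
Proof.
  intros Hr x y Hx Hy.
  destruct (Hr _ _ (commutes_conj p Hx) (commutes_conj p Hy)) as [a [b [Hab E]]].
  exists a, b. split; [assumption|]. rewrite !gpowZ_conj in E.
  now apply mul_cancel_r, mul_cancel_l in E.
Qed.

Section Step.
Context {H G : Group} {v : H} {d : nat} {i : hom H G} {j : hom (ExtA H v d) G}.
Context (Hpo : is_pushout (cent_incl H v) (extA_incl H v d) i j).
Context (Hnf : forall p L h, reduced v (p :: L) -> nval i j (p :: L) h <> gone).
Context (Hv : v <> gone) (tfH : torsion_free H).
Notation t := (stable j).
Notation val := (nval i j).
Notation reduced := (@reduced H v d).
Notation inner := (@inner H v d).

(** Cyclic reduction: the tail [h] is conjugated to the front. If [h s] lies in [C(v)], the last
    stable letter is rotated past it and merges with the first, which shortens the form; otherwise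
    the form is cyclically reduced. *)
Lemma conjugacy_trichotomy L h : reduced L -> exists p u0, val L h = p ** u0 ** p^-1 /\
  ((exists c, u0 = i c) \/
   (exists z e, commutes v z /\ e <> gone /\ u0 = i z ** t e) \/
   (exists L', Forall inner L' /\ L' <> [] /\ u0 = val L' gone)).
Proof.
  remember (length L) as n eqn:En. revert L h En.
  induction n as [n IH] using lt_wf_ind. intros L h En HL.
  destruct L as [|[s e] L].
  { exists gone, (i h). split; [now gsimp|]. left. now exists h. }
  destruct HL as [He HL]. cbn [snd] in He.
  assert (E1 : val ((s, e) :: L) h = (i h)^-1 ** val ((h ** s, e) :: L) gone ** (i h)^-1^-1).
  { rewrite <- val_base_mul. rewrite inv_inv, !mulA', val_mul_base, mulKl, gmul1l.
    reflexivity. }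
  destruct (classic (commutes v (h ** s))) as [Hs|Hs].
  2: { exists ((i h)^-1), (val ((h ** s, e) :: L) gone). split; [assumption|].
       right. right. eexists. split; [|split; [|reflexivity]]; [|discriminate].
       constructor; [now split|assumption]. }
  set (z := h ** s) in *. destruct L as [|p0 L0].
  { exists ((i h)^-1), (i z ** t e). split.
    - rewrite E1. cbn [nval fst snd]. now rewrite hom_one, gmul1r.
    - right. left. now exists z, e. }
  destruct (exists_last (l := p0 :: L0)) as [L1 [[s' e'] EL]]; [discriminate|].
  rewrite EL in *. clear EL p0 L0.
  apply Forall_app in HL. destruct HL as [HL1 _].
  assert (E2 : val ((z, e) :: L1 ++ [(s', e')]) gone =
    (t e')^-1 ** (i z ** (t (e' ** e) ** val L1 s')) ** (t e')^-1^-1).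
  { assert (Ev : val (L1 ++ [(s', e')]) gone = val L1 s' ** t e').
    { transitivity (val (L1 ++ [(gone ** s', e')]) gone); [now rewrite gmul1l|].
      rewrite <- val_mul_cons. cbn [nval fst snd].
      rewrite hom_one, gmul1r, gmulA, val_mul_base, gmul1l. reflexivity. }
    cbn [nval fst snd]. rewrite Ev, stable_mul.
    transitivity ((t e')^-1 ** (t e' ** i z) ** (t e ** (val L1 s' ** t e')));
      [now gsimp|].
    rewrite (stable_comm Hpo z e' Hs). now gsimp. }
  assert (Hred : exists L2 h2, reduced L2 /\ (length L2 < n)%nat /\
            val L2 h2 = i z ** (t (e' ** e) ** val L1 s')).
  { cbn [length] in En. rewrite length_app in En. cbn [length] in En.
    destruct (classic (e' ** e = gone)) as [E0|E0].
    - rewrite E0, stable_one, gmul1l.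
      destruct (reduced_mul_base i j zero_length (fun _ => 0) z L1 s'
                  (inner_reduced v d L1 HL1)) as [L2 [h2 [F1 [F2 [_ F3]]]]].
      exists L2, h2. repeat split; [assumption|lia|assumption].
    - exists ((z, e' ** e) :: L1), s'. split; [now split|]. split; [cbn [length]; lia|].
      reflexivity. }
  destruct Hred as [L2 [h2 [F1 [F2 F3]]]].
  destruct (IH _ F2 L2 h2 eq_refl F1) as [p [u0 [Ep Hu0]]].
  exists ((i h)^-1 ** (t e')^-1 ** p), u0. split; [|assumption].
  rewrite E1, E2, <- F3, Ep. now gsimp.
Qed.

Lemma stable_pow_base_neq x z (e : ZnGroup d) b : e <> gone -> b <> 0 ->
  i x <> i z ** t (e ^^ b).
Proof.
  intros He Hb E.
  assert (Heb : e ^^ b <> gone).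
  { intros E0. apply He. apply functional_extensionality. intros k.
    assert (Ek := f_equal (fun f : ZnGroup d => f k) E0). cbv beta in Ek.
    rewrite Zn_pow_apply in Ek.
    assert (E1 : (gone : ZnGroup d) k = 0) by reflexivity. rewrite E1 in *. nia. }
  apply (@reduced_not_base H G v d i j Hnf (z, e ^^ b) [] gone x).
  - split; [exact Heb|constructor].
  - cbn [nval fst snd]. rewrite hom_one, gmul1r. now symmetry.
Qed.

(** Otherwise a conjugate of [c] lies in [C(v)] and commutes with both [v] and [t e], which satisfy
    no power relation. *)
Lemma rank_one_not_in_base_centralizer c (e : ZnGroup d) : rank_one_centralizer (i c) -> e <> gone ->
  forall g, ~ commutes c (g ** v ** g^-1).
Proof.
  intros Hr He g Hc.
  assert (Hr' : rank_one_centralizer (i (g^-1 ** c ** g))).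
  { apply (rank_one_centralizer_conj _ (i g)).
    rewrite !hmorph, hom_inv.
    replace (i g ** ((i g)^-1 ** i c ** i g) ** (i g)^-1) with (i c) by now gsimp.
    assumption. }
  set (c' := g^-1 ** c ** g) in *.
  assert (Hc' : commutes v c').
  { apply commutes_sym. assert (E := commutes_conj (g^-1) Hc). rewrite inv_inv in E.
    replace (g^-1 ** (g ** v ** g^-1) ** g) with v in E by now gsimp. exact E. }
  destruct (Hr' (i v) (t e)) as [a [b [Hab E]]].
  - red. rewrite <- !hmorph. f_equal. symmetry. exact Hc'.
  - red. now apply (stable_comm Hpo).
  - rewrite <- hom_gpowZ, <- stable_pow in E.
    destruct (Z.eq_dec b 0) as [->|Hb].
    + apply Hv, torsion_free_pow with a; [assumption| |lia].
      apply (base_inj Hpo). rewrite E, hom_one. apply stable_one.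
    + apply (stable_pow_base_neq (v ^^ a) gone e b He Hb).
      rewrite hom_one, gmul1l. exact E.
Qed.

(** The element commutes with [v], but no nontrivial power relation links the two: a nonzero power
    of the element involves a nontrivial stable letter. *)
Lemma rank_one_not_mixed z (e : ZnGroup d) : commutes v z -> e <> gone ->
  ~ rank_one_centralizer (i z ** t e).
Proof.
  intros Hz He Hr.
  assert (Hzt : commutes (i z) (t e)) by now apply (stable_comm Hpo).
  destruct (Hr (i v) (i z ** t e)) as [a [b [Hab E]]].
  - apply commutes_sym, cent_mul.
    + red. rewrite <- !hmorph. f_equal. exact Hz.
    + red. apply (stable_comm Hpo). apply commutes_refl.
  - apply commutes_refl.
  - rewrite gpowZ_commuting_mul, <- !hom_gpowZ, <- stable_pow in E by assumption.
    destruct (Z.eq_dec b 0) as [->|Hb].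
    + apply Hv, torsion_free_pow with a; [assumption| |lia].
      apply (base_inj Hpo). rewrite E, hom_one. simpl gpowZ at 1.
      rewrite hom_one, gmul1l. apply stable_one.
    + exact (stable_pow_base_neq (v ^^ a) (z ^^ b) e b He Hb E).
Qed.

Section Elliptic.
Context (Y : list H) (HY : generates Y) (c : H) (K : Z) (HK : 0 <= K).
Notation lH := (wlen Y).
Notation altH R := (alt c lH (K * (1 + R)) R).
Context (Hne : forall R x g0, 0 <= R -> altH R x -> lH g0 <= R -> g0 ** x <> gone).
Context (Hcent : forall e : ZnGroup d, e <> gone ->
  forall R x g0, 0 <= R -> altH R x -> lH g0 <= R -> ~ commutes v (g0 ** x)).
Notation YG := (ext_gens i j Y).

Lemma reduced_bounded R g : wlen YG g <= R -> exists L h, reduced L /\ val L h = g /\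
  lH h <= R /\ match L with [] => True | p :: _ => lH (fst p) <= R end.
Proof.
  intros Hg. destruct (reduced_cost Hpo g HY) as [L [h [HL [E Hc]]]].
  exists L, h. repeat split; [assumption..| |].
  - assert (HlH := wlen_is_length Y HY).
    assert (HlE := wlen_is_length _ (Zn_basis_generates d)).
    assert (Hh : lH h <= cost lH (wlen (Zn_basis d)) L h); [|lia]. clear - HlH HlE.
    induction L as [|p L IH]; cbn [cost]; [lia|].
    assert (E1 := len_ge0 HlH (fst p)). assert (E2 := len_ge0 HlE (snd p)). lia.
  - destruct L as [|p L]; [exact Logic.I|]. cbn [cost] in Hc.
    assert (E1 := len_ge0 (wlen_is_length _ (Zn_basis_generates d)) (snd p)).
    assert (E2 := cost_ge0 d lH (wlen_is_length Y HY) _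
                    (wlen_is_length _ (Zn_basis_generates d)) L h). lia.
Qed.

(** Only the block [b] before the first stable letter is remembered: it is still open, and is again
    an alternating product in [H]. When a stable letter to its left closes it, [Hcent] keeps it
    outside [C(v)], so the form stays reduced. *)
Lemma alt_elliptic R x : 0 <= R -> alt (i c) (wlen YG) (K * (1 + R)) R x ->
  exists b, altH R b /\
    (x = i b \/ exists e L h, e <> gone /\ Forall inner L /\ x = val ((b, e) :: L) h).
Proof.
  intros HR Hx. induction Hx as [m g Hm Hg|m g x Hm Hg Hc Hx [b [Hb IH]]];
    destruct (reduced_bounded R g Hg) as [L [h [HL [<- [Hh Hs]]]]].
  - rewrite <- hom_gpowZ. destruct L as [|[s e] L].
    + exists (c ^^ m ** h). split; [now apply alt_one|]. left. now rewrite hmorph.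
    + destruct HL as [He HL]. exists (c ^^ m ** s). split; [now apply alt_one|].
      right. exists e, L, h. split; [assumption|]. split; [assumption|]. apply val_base_mul.
  - rewrite <- hom_gpowZ. destruct L as [|[s e] L].
    + exists (c ^^ m ** (h ** b)). split.
      { apply alt_cons; [assumption..| |assumption]. intros E. apply Hc. red in E |- *.
        cbn [nval]. now rewrite <- !hmorph, E. }
      cbn [nval]. destruct IH as [->|[e [L [h' [He [HL' ->]]]]]].
      * left. now rewrite !hmorph.
      * right. exists e, L, h'. repeat split; [assumption..|]. now rewrite !val_base_mul.
    + destruct HL as [He HL]. cbn [fst snd] in *.
      exists (c ^^ m ** s). split; [now apply alt_one|]. right. exists e.
      destruct IH as [->|[e' [L' [h' [He' [HL' ->]]]]]].
      * exists L, (h ** b). repeat split; [assumption..|].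
        now rewrite val_mul_base, val_base_mul.
      * exists (L ++ (h ** b, e') :: L'), h'. repeat split; [assumption| |].
        { apply Forall_app. split; [assumption|]. constructor; [|assumption].
          split; [|assumption]. cbn [fst]. exact (Hcent e He R b h HR Hb Hh). }
        rewrite val_mul_cons. cbn [app]. now rewrite val_base_mul.
Qed.

Lemma elliptic_big_powers : big_powers (i c) (wlen YG).
Proof.
  exists K. split; [assumption|]. intros R x g0 HR Hx Hg0.
  destruct (alt_elliptic R x HR Hx) as [b [Hb Hform]].
  destruct (reduced_bounded R g0 Hg0) as [L [h [HL [<- [Hh Hs]]]]].
  destruct Hform as [->|[e [L' [h' [He [HL' ->]]]]]].
  - rewrite val_mul_base. destruct L as [|p L]; [|now apply Hnf].
    cbn [nval]. intros E. apply (Hne R b h HR Hb Hh).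
    apply (base_inj Hpo). now rewrite E, hom_one.
  - rewrite val_mul_cons. destruct L as [|p L]; [apply Hnf; now split|].
    destruct HL as [Hp HL]. cbn [app]. apply Hnf. split; [assumption|].
    apply Forall_app. split; [assumption|]. constructor; [|assumption].
    split; [|assumption]. cbn [fst]. exact (Hcent e He R b h HR Hb Hh).
Qed.
End Elliptic.

Context (Hmal : forall z h, z <> gone -> commutes v z -> commutes v (h^-1 ** z ** h) ->
  commutes v h).
Context (Hroot : forall u : G, u <> gone -> rootable u).
Context (HBP : forall c : H, c <> gone -> rank_one_centralizer c ->
  forall Y, generates Y -> big_powers c (wlen Y)).

Lemma step_big_powers (Y : list H) (u : G) : generates Y -> u <> gone ->
  rank_one_centralizer u -> big_powers u (wlen (ext_gens i j Y)).
Proof.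
  intros HY Hu Hr. assert (HYG := ext_gens_generates Hpo HY).
  destruct (reduced_exists Hpo u) as [L [h [HL <-]]].
  destruct (conjugacy_trichotomy L h HL) as [p [u0 [E Hcase]]].
  rewrite E in *. clear E L h HL.
  apply (big_powers_conj p (wlen_is_length _ HYG)).
  assert (Hu0 : u0 <> gone) by (intros ->; apply Hu; now gsimp).
  apply rank_one_centralizer_conj in Hr.
  destruct Hcase as [[c ->]|[[z [e [Hz [He ->]]]]|[L [HL [HLne ->]]]]].
  - assert (Hc : c <> gone) by (intros ->; apply Hu0, hom_one).
    assert (Hrc : rank_one_centralizer c).
    { intros x y Hx Hy. destruct (Hr (i x) (i y)) as [a [b [Hab E]]].
      - red. now rewrite <- !hmorph, Hx.
      - red. now rewrite <- !hmorph, Hy.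
      - exists a, b. split; [assumption|]. apply (base_inj Hpo). now rewrite !hom_gpowZ. }
    assert (HBc := HBP c Hc Hrc Y HY).
    assert (HlH := wlen_is_length Y HY).
    assert (HK2 : exists K, 0 <= K /\ forall e : ZnGroup d, e <> gone ->
      forall R x g0, 0 <= R -> alt c (wlen Y) (K * (1 + R)) R x -> wlen Y g0 <= R ->
      ~ commutes v (g0 ** x)).
    { destruct (classic (exists e : ZnGroup d, e <> gone)) as [[e He]|Hno].
      - destruct (big_powers_not_commuting HlH HBc
          (rank_one_not_in_base_centralizer c e Hr He)) as [K [HK HKc]].
        exists K. split; [assumption|]. intros _ _. exact HKc.
      (* In an extension of rank 0 no block is ever enclosed by stable letters, and [c] may commute
         with a conjugate of [v]. *)
      - exists 0. split; [lia|]. intros e He. exfalso. apply Hno. now exists e. }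
    destruct HBc as [K1 [HK1 H1]]. destruct HK2 as [K2 [HK20 H2]].
    apply (elliptic_big_powers Y HY c (K1 + K2)); [lia| |].
    + intros R x g0 HR Hx. apply (H1 R x g0 HR).
      apply alt_weaken with (3 := Hx); [auto|nia].
    + intros e He R x g0 HR Hx. apply (H2 e He R x g0 HR).
      apply alt_weaken with (3 := Hx); [auto|nia].
  - exfalso. exact (rank_one_not_mixed z e Hz He Hr).
  - apply (cyc_big_powers Hpo Hnf Hmal L HL HLne _ HYG). now apply Hroot.
Qed.
End Step.

(** * Properties inherited from the hyperbolic group, and induction over the tower *)

Definition malnormal_centralizers (G : Group) : Prop := forall u z h : G,
  u <> gone -> z <> gone -> commutes u z -> commutes u (h^-1 ** z ** h) -> commutes u h.

Record hyperbolic_like (G : Group) : Prop := {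
  hl_torsion_free : torsion_free G;
  hl_rootable : forall u : G, u <> gone -> rootable u;
  hl_malnormal : malnormal_centralizers G;
  hl_fg : exists Y : list G, generates Y;
  hl_big_powers : forall u : G, u <> gone -> forall Y, generates Y -> big_powers u (wlen Y) }.

Lemma torsion_free_hyperbolic_like (Gamma : Group) :
  torsion_free Gamma -> hyperbolic Gamma -> hyperbolic_like Gamma.
Proof.
  intros tf Hh. destruct (hyperbolic_four_point Hh) as [X [D [HX [HD H4]]]].
  assert (Hl := wlen_is_length X HX).
  assert (Hb := wlen_ball_finite X HX). assert (Hg := wlen_geodesic X HX).
  constructor.
  - assumption.
  - apply (rootable_of_torsion_free_hyperbolic tf _ Hl D HD H4 Hb Hg).
  - exact (malnormal_of_torsion_free_hyperbolic tf _ Hl D HD H4 Hb Hg).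
  - now exists X.
  - intros u Hu Y HY. destruct (len_le_wlen Y _ HY Hl) as [A [HA HAl]].
    apply big_powers_le with (wlen X) A; [assumption..|].
    exact (big_powers_of_torsion_free_hyperbolic tf _ Hl D HD H4 Hb Hg u Hu).
Qed.

Section Residual.
Context {G Gamma : Group} (Hres : fully_residually G Gamma).
Context (HGam : hyperbolic_like Gamma).

Lemma residual_torsion_free : torsion_free G.
Proof.
  intros g k E. apply NNPP. intros Hg.
  destruct (Hres [g]) as [f Hf]; [intros x [<-|[]]; assumption|].
  apply (Hf g); [now left|]. apply (hl_torsion_free _ HGam _ k).
  now rewrite <- hom_gpow, E, hom_one.
Qed.

Lemma residual_rootable (u : G) : u <> gone -> rootable u.
Proof.
  intros Hu g a b Ha E. apply NNPP. intros Hg. rewrite <- commutator_eq_one in Hg.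
  destruct (Hres [u; commutator u g]) as [f Hf].
  { intros x [<-|[<-|[]]]; assumption. }
  apply (Hf (commutator u g)); [right; now left|].
  rewrite hom_commutator, commutator_eq_one.
  apply (hl_rootable _ HGam (f u)) with a b; [apply Hf; now left|assumption|].
  now rewrite <- !hom_gpowZ, <- hom_inv, <- !hmorph, E.
Qed.

Lemma residual_malnormal : malnormal_centralizers G.
Proof.
  intros u z h Hu Hz H1 H2. apply NNPP. intros Hh. rewrite <- commutator_eq_one in Hh.
  destruct (Hres [u; z; commutator u h]) as [f Hf].
  { intros x [<-|[<-|[<-|[]]]]; assumption. }
  apply (Hf (commutator u h)); [right; right; now left|].
  rewrite hom_commutator, commutator_eq_one.
  apply (hl_malnormal _ HGam) with (f z).
  - apply Hf. now left.
  - apply Hf. right. now left.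
  - now apply hom_commutes.
  - apply (hom_commutes f) in H2. now rewrite !hmorph, hom_inv in H2.
Qed.
End Residual.

Lemma has_big_powers_of_like (Gamma : Group) : hyperbolic_like Gamma -> has_big_powers Gamma.
Proof.
  intros HGam u Hu. destruct (hl_fg _ HGam) as [Y HY]. exists (wlen Y).
  split; [now apply wlen_is_length|]. now apply (hl_big_powers _ HGam).
Qed.

Section ResidualStep.
Context {H G : Group} {v : H} {d : nat} {i : hom H G} {j : hom (ExtA H v d) G}.
Context (Hpo : is_pushout (cent_incl H v) (extA_incl H v d) i j).
Context (Gamma : Group) (HGam : has_big_powers Gamma) (Hres : fully_residually H Gamma).
Context (Hv : v <> gone).

Lemma reduced_neq_one p L h : reduced v (p :: L) -> nval i j (p :: L) h <> gone.
Proof.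
  intros HL E.
  destruct (retraction_neq_one v d i j Gamma HGam Hres Hv (p :: L) h HL) as [N HN];
    [discriminate|].
  destruct (retraction_exists Hpo N) as [r Hr].
  apply (HN N r (Z.le_refl N) Hr). now rewrite E, hom_one.
Qed.

Lemma step_residual : fully_residually G Gamma.
Proof.
  intros S HS.
  assert (HN : exists N, forall B r, N <= B -> is_retraction i j B r ->
            forall x, In x S -> r x <> gone).
  { induction S as [|a S IH]; [exists 0; intros B r _ _ x []|].
    destruct IH as [N HN]; [intros x Hx; apply HS; now right|].
    destruct (reduced_exists Hpo a) as [L [h [HL E]]].
    destruct (retraction_neq_one v d i j Gamma HGam Hres Hv L h HL) as [N' HN'].
    { intros -> ->. apply (HS a); [now left|]. rewrite <- E. apply hom_one. }
    exists (Z.max N N'). intros B r HB Hr x [<-|Hx].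
    - rewrite <- E. apply (HN' B); [lia|assumption].
    - apply (HN B); [lia|assumption..]. }
  destruct HN as [N HN]. destruct (retraction_exists Hpo N) as [r Hr].
  destruct (Hres (map r S)) as [f Hf].
  { intros x Hx. apply in_map_iff in Hx. destruct Hx as [y [<- Hy]].
    now apply (HN N r (Z.le_refl N) Hr). }
  exists (hom_comp f r). intros x Hx. apply Hf. now apply in_map.
Qed.
End ResidualStep.

(** The centralizer of 1 is the whole group. *)
Lemma abelian_centralizer_neq_one {G : Group} (u : G) : nonabelian G ->
  (forall x y : G, commutes u x -> commutes u y -> x ** y = y ** x) -> u <> gone.
Proof.
  intros [g [h Hgh]] Hab ->. apply Hgh, Hab; red; now rewrite gmul1l, gmul1r.
Qed.

Record tower_like (Gamma G : Group) : Prop := {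
  tl_nonabelian : nonabelian G;
  tl_residual : fully_residually G Gamma;
  tl_fg : exists Y : list G, generates Y;
  tl_big_powers : forall u : G, u <> gone -> rank_one_centralizer u ->
    forall Y, generates Y -> big_powers u (wlen Y) }.

Lemma iterated_extension_tower_like (Gamma G : Group) :
  nonabelian Gamma -> hyperbolic_like Gamma -> IterExt Gamma G -> tower_like Gamma G.
Proof.
  intros Hna HGam HG. induction HG as [|H G v d HH IH [Hab [i [j Hpo]]]].
  - constructor; [assumption| |apply (hl_fg _ HGam)|].
    + intros L HL. now exists (hom_id Gamma).
    + intros u Hu _. now apply (hl_big_powers _ HGam).
  - destruct IH as [Hn Hres [Y HY] HBP].
    assert (Hv := abelian_centralizer_neq_one v Hn Hab).
    assert (HBGam := has_big_powers_of_like Gamma HGam).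
    assert (HresG := step_residual Hpo Gamma HBGam Hres Hv).
    assert (HYG := ext_gens_generates Hpo HY).
    constructor; [|assumption|now exists (ext_gens i j Y)|].
    + destruct Hn as [g [h Hgh]]. exists (i g), (i h). rewrite <- !hmorph. intros E.
      now apply Hgh, (base_inj Hpo).
    + intros u Hu Hr Y' HY'.
      destruct (len_le_wlen Y' _ HY' (wlen_is_length _ HYG)) as [A [HA HAl]].
      apply big_powers_le with (wlen (ext_gens i j Y)) A; [assumption..|].
      apply (step_big_powers Hpo (reduced_neq_one Hpo Gamma HBGam Hres Hv) Hv
               (residual_torsion_free Hres HGam)
               (fun z h => residual_malnormal Hres HGam v z h Hv)
               (residual_rootable HresG HGam) HBP); assumption.
Qed.

Lemma cyclic_rank_one {G : Group} (u : G) : cyclic_centralizer u -> rank_one_centralizer u.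
Proof.
  intros [c [_ Hc]] x y Hx Hy. destruct (Hc x Hx) as [a ->]. destruct (Hc y Hy) as [b ->].
  destruct (Z.eq_dec a 0) as [->|Ha].
  - exists 1, 0. split; [lia|]. simpl. apply gmul1r.
  - exists b, a. split; [lia|]. rewrite <- !gpowZ_mul. f_equal. lia.
Qed.

(** * Discriminating retractions and the complexity bound *)

Section Discriminating.
Context {G G' : Group} {u : G} {n : nat} {i : hom G G'} {j : hom (ExtA G u n) G'}.
Context (Hpo : is_pushout (cent_incl G u) (extA_incl G u n) i j).
Context (X : list G') (Y : list G) (HX : generates X) (HY : generates Y).
Notation YG := (ext_gens i j Y).
Context (K : Z) (HK : 0 <= K) (HBP : forall R x g0, 0 <= R ->
  alt u (wlen Y) (K * (1 + R)) R x -> wlen Y g0 <= R -> g0 ** x <> gone).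

(** [R < B] makes the coordinates of the stable syllables admissible digits, and [K * (1 + R) <= B]
    lifts the resulting exponents above the threshold. *)
Lemma retraction_discriminates R B r : 0 <= R -> K * (1 + R) <= B -> R < B ->
  is_retraction i j B r ->
  forall g, wlen YG g <= R -> g <> gone -> r g <> gone.
Proof.
  intros HR HB HRB Hr g Hg Hne.
  assert (HlH := wlen_is_length Y HY).
  assert (HlE := wlen_is_length _ (Zn_basis_generates n)).
  destruct (reduced_cost Hpo g HY) as [L [h [HL [<- Hc]]]].
  destruct L as [|[s e] L].
  { cbn [nval]. rewrite (proj1 Hr). intros ->. apply Hne, hom_one. }
  destruct HL as [He HL]. cbn [cost fst snd] in *.
  assert (Hs0 := len_ge0 HlH s). assert (He0 := len_ge0 HlE e).
  assert (HL0 := cost_ge0 n _ HlH _ HlE L h).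
  assert (Hcost : forall M, cost (wlen Y) (wlen (Zn_basis n)) M h <= R ->
    wlen Y h <= R /\ forall p, In p M ->
      wlen Y (fst p) <= R /\ wlen (Zn_basis n) (snd p) <= R).
  { induction M as [|p M IH]; cbn [cost]; intros HM; [split; [assumption|intros p []]|].
    assert (E1 := len_ge0 HlH (fst p)). assert (E2 := len_ge0 HlE (snd p)).
    assert (E3 := cost_ge0 n _ HlH _ HlE M h).
    destruct IH as [IH1 IH2]; [lia|]. split; [assumption|].
    intros q [<-|Hq]; [lia|now apply IH2]. }
  destruct (Hcost L) as [Hh HLb]; [lia|].
  assert (Hdot : forall e' : ZnGroup n, e' <> gone -> wlen (Zn_basis n) e' <= R ->
            K * (1 + R) <= Z.abs (dot B n e')).
  { intros e' Hne' Hle. assert (F : B <= Z.abs (dot B n e')); [|lia].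
    apply dot_large; [assumption|]. intros k. assert (E := coord_le_wlen n e' k). lia. }
  cbn [nval fst snd]. rewrite hmorph, (proj1 Hr).
  apply (HBP R); [assumption| |lia].
  apply (retraction_alt u n i j (hom_id G) (wlen Y) B r); [assumption| |assumption|].
  - apply Hdot; [assumption|lia].
  - intros p Hp. rewrite Forall_forall in HL. destruct (HL p Hp) as [Hc1 Hc2].
    destruct (HLb p Hp) as [F1 F2]. repeat split; [now apply Hdot|assumption..].
Qed.

Lemma retraction_norm B r : 1 <= B -> is_retraction i j B r ->
  forall g, wlen Y (r g) <= (B ^ Z.of_nat n * wlen Y u + 1) * wlen YG g.
Proof.
  intros HB [Hi Ht]. assert (HlH := wlen_is_length Y HY).
  assert (Hu := len_ge0 HlH u).
  assert (HBn : 0 < B ^ Z.of_nat n) by (apply Z.pow_pos_nonneg; lia).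
  apply (len_hom_le YG (ext_gens_generates Hpo HY)); [assumption|nia|].
  intros x Hx. apply in_app_or in Hx. destruct Hx as [Hx|Hx]; apply in_map_iff in Hx;
    destruct Hx as [y [<- Hy]].
  - rewrite Hi. assert (E := wlen_gen Y HY y Hy). nia.
  - rewrite Ht. apply in_map_iff in Hy. destruct Hy as [k [<- _]].
    assert (E := len_pow_le HlH u (dot B n (unit_vec k))).
    assert (E2 := dot_unit_vec_le B n k HB). nia.
Qed.

Lemma complexity_polynomial : complexity_dominated_by_pow X Y n.
Proof.
  assert (HYG := ext_gens_generates Hpo HY).
  assert (HlG := wlen_is_length _ HYG). assert (HlX := wlen_is_length _ HX).
  assert (HlH := wlen_is_length Y HY). assert (Hu := len_ge0 HlH u).
  destruct (len_le_wlen X _ HX HlG) as [A [HA HAl]].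
  (* [c] gives [B <= c * R] for positive [R]; the other terms of [K0] absorb the length of [u] and
     the change of generating set of [G']. *)
  set (c := (K + 1) * (1 + A)).
  set (K0 := c + A * wlen Y u + A). assert (HK0 : 0 <= K0) by (unfold K0, c; nia).
  exists (Z.to_nat K0). intros R. destruct R as [|R'].
  (* Radius 0 is separate, because [B] is at least 1 and cannot be bounded by a multiple of [R]; the
     ball is trivial there. *)
  { exists (hom_triv G' G). split.
    - intros g [w [_ [Hw <-]]] Hg. exfalso. apply Hg.
      destruct w; [reflexivity|cbn [length] in Hw; lia].
    - intros x _. apply wlen_le_one. }
  set (R := Z.of_nat (S R')). assert (HR : 1 <= R) by (unfold R; lia).
  set (B := (K + 1) * (1 + A * R)).
  assert (HB1 : 1 <= B) by (unfold B; nia).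
  destruct (retraction_exists Hpo B) as [r Hr]. exists r. split.
  - intros g Hg Hne. apply (wlen_le_iff X HX) in Hg. fold R in Hg.
    apply (retraction_discriminates (A * R) B r); [nia|unfold B; nia|unfold B; nia
      |assumption| |assumption].
    specialize (HAl g). nia.
  - intros x Hx. apply (wlen_le_iff Y HY).
    assert (E := retraction_norm B r HB1 Hr x). assert (Ex := HAl x).
    assert (Hx1 := wlen_gen X HX x Hx). assert (Hx0 := len_ge0 HlG x).
    assert (HBc : B <= K0 * R) by (unfold B, K0, c; nia).
    assert (HBn : B ^ Z.of_nat n <= (K0 * R) ^ Z.of_nat n)
      by (apply Z.pow_le_mono_l; lia).
    assert (HB0 : 0 < B ^ Z.of_nat n) by (apply Z.pow_pos_nonneg; lia).
    rewrite Nat2Z.inj_add, Nat2Z.inj_mul, Nat2Z.inj_pow, Nat2Z.inj_mul, Z2Nat.id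
      by assumption.
    fold R. set (P := (K0 * R) ^ Z.of_nat n) in *.
    assert (F1 : wlen YG x <= A).
    { assert (A * wlen X x <= A * 1) by (apply Z.mul_le_mono_nonneg_l; lia). lia. }
    assert (F0 : B ^ Z.of_nat n * wlen Y u <= P * wlen Y u)
      by (apply Z.mul_le_mono_nonneg_r; lia).
    assert (F2 : wlen Y (r x) <= (P * wlen Y u + 1) * A).
    { eapply Z.le_trans; [exact E|]. apply Z.mul_le_mono_nonneg; nia. }
    assert (F3 : A * wlen Y u <= K0) by (unfold K0, c; nia).
    assert (F4 : A <= K0) by (unfold K0, c; nia).
    assert (F5 : P * (A * wlen Y u) <= P * K0) by nia. nia.
Qed.
End Discriminating.

Theorem theoremC (Gamma G G' : Group) (n : nat) :
  nonabelian Gamma -> torsion_free Gamma -> hyperbolic Gamma ->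
  IterExt Gamma G ->
  CyclicCentExt G G' n ->
  forall (X : list G') (Y : list G), generates X -> generates Y ->
    complexity_dominated_by_pow X Y n.
Proof.
  intros Hna tf Hh HG [u [Hcyc [Hab [i [j Hpo]]]]] X Y HX HY.
  assert (HGam := torsion_free_hyperbolic_like Gamma tf Hh).
  assert (HT := iterated_extension_tower_like Gamma G Hna HGam HG).
  assert (Hu := abelian_centralizer_neq_one u (tl_nonabelian _ _ HT) Hab).
  destruct (tl_big_powers _ _ HT u Hu (cyclic_rank_one u Hcyc) Y HY) as [K [HK HBP]].
  exact (complexity_polynomial Hpo X Y HX HY K HK HBP).
Qed.
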